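(* Let $T:\Sigma\to\Sigma$ be a topologically mixing two-sided subshift of finite type and $\mathcal{A}\in\mathcal{W}$, with values in $GL(k,\mathbb{R})$. Suppose that $P_{\vec{\Phi}_{\mathcal{A}}}(\vec{q})\in\mathbb{R}$ for each $\vec{q}\in\mathbb{R}^k$. Then for every $\vec{\alpha}\in\vec{L}$, $$h_{top}(T,E(\vec{\alpha}))=\inf\{P_{\vec{\Phi}_{\mathcal{A}}}(\vec{q})-\vec{\alpha}\cdot\vec{q}:\ \vec{q}\in\mathbb{R}^k\}.$$
   Context: Subshift: for a $0$-$1$ matrix $Q$, $\Sigma=\{(x_i)_{i\in\mathbb{Z}}: Q_{x_i,x_{i+1}}=1\ \forall i\}$ with left shift $T$. Fix $\omega\in(0,1)$ and the metric $d(x,y)=\omega^{m}$, where $m$ is the largest integer with $x_i=y_i$ for all $|i|<m$. $W^s_{loc}(x)=\{y:y_n=x_n\ \forall n\ge0\}$, $W^u_{loc}(x)=\{y:y_n=x_n\ \forall n<0\}$; $W^s(x)=\{y: T^ny\in W^s_{loc}(T^nx)\text{ for some }n\ge0\}$, $W^u(x)=\{y:T^ny\in W^u_{loc}(T^nx)\text{ for some }n\le0\}$. Cocycles: for $\mathcal{A}:\Sigma\to GL(k,\mathbb{R})$, $\mathcal{A}^n(x)=\mathcal{A}(T^{n-1}x)\cdots\mathcal{A}(x)$ and $\mathcal{A}^{-n}(x)=\mathcal{A}(T^{-n}x)^{-1}\cdots\mathcal{A}(T^{-1}x)^{-1}$ for $n\ge1$; $\|\cdot\|$ is the Euclidean operator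 norm. Fix $r>0$. $H^r_b(\Sigma,GL(k,\mathbb{R}))$ is the set of $r$-Hölder maps $\mathcal{A}:\Sigma\to GL(k,\mathbb{R})$ that are fiber bunched: $\|\mathcal{A}(x)\|\,\|\mathcal{A}(x)^{-1}\|\,\omega^r<1$ for all $x$. For such $\mathcal{A}$ the canonical holonomies $H^s_{y\leftarrow x}=\lim_{n\to\infty}\mathcal{A}^n(y)^{-1}\mathcal{A}^n(x)$ ($y\in W^s_{loc}(x)$) and $H^u_{y\leftarrow x}=\lim_{n\to-\infty}\mathcal{A}^n(y)^{-1}\mathcal{A}^n(x)$ ($y\in W^u_{loc}(x)$) exist; they extend to $y\in W^{s}(x)$ (resp. $W^u(x)$) by $H^{s/u}_{y\leftarrow x}=\mathcal{A}^n(y)^{-1}H^{s/u}_{T^ny\leftarrow T^nx}\mathcal{A}^n(x)$ with $n$ (resp. $-n$) large. Typical cocycles: $\mathcal{A}\in H^r_b(\Sigma,GL(k,\mathbb{R}))$ is 1-typical if there are a periodic point $p$ and a homoclinic point $z\in W^s(p)\cap W^u(p)$, $z\ne p$, such that (i) the eigenvalues of $P:=\mathcal{A}^{per(p)}(p)$ have multiplicity 1 and distinct absolute values, with eigenvectors $v_1,\dots,v_k$; (ii) with $\psi:=H^s_{p\leftarrow z}\circ H^u_{z\leftarrow p}$, for all $1\le i,j\le k$, $\psi(v_i)$ is not in the hyperplane spanned by all the $v_l$ with $l\ne j$. A 1-typical $\mathcal{A}$ is $t$-typical ($2\le t\le k-1$) if, for the same $p,z$: (I) all products of $t$ distinct eigenvalues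 of $P$ are distinct; (II) the induced map $\psi^{\wedge t}$ on $\wedge^t\mathbb{R}^k$ satisfies the analogue of (ii) with respect to the eigenvectors $\{v_{i_1}\wedge\dots\wedge v_{i_t}\}_{i_1<\dots<i_t}$ of $P^{\wedge t}$. $\mathcal{A}$ is typical if it is $t$-typical for all $1\le t\le k-1$ (same $p,z$); $\mathcal{W}\subset H^r_b(\Sigma,GL(k,\mathbb{R}))$ is the set of typical maps. Spectrum: $\chi_i(\mathcal{A}(x))=\lim_{n\to\infty}\frac1n\log\|(\mathcal{A}^n(x))^{\wedge i}\|$ when the limit exists, $1\le i\le k$ ($B^{\wedge i}$ is the $i$-th exterior power). $E(\vec{\alpha})=\{x\in\Sigma:\chi_i(\mathcal{A}(x))=\alpha_i\text{ for all }1\le i\le k\}$ and $\vec{L}=\{\vec{\alpha}\in\mathbb{R}^k:E(\vec{\alpha})\neq\emptyset\}$. Topological entropy of a subset $Y\subset\Sigma$ (Bowen): let $d_n(x,y)=\max_{0\le j<n}d(T^jx,T^jy)$, $B_n(x,\epsilon)$ the open $d_n$-ball. $S(Y,s,N,\epsilon)=\inf\sum_ie^{-sn_i}$ over countable covers of $Y$ by balls $B_{n_i}(x_i,\epsilon)$ with all $n_i\ge N$; $S(Y,s,\epsilon)=\lim_{N\to\infty}S(Y,s,N,\epsilon)$; $h_{top}(T,Y,\epsilon)$ is the critical $s$ at which $S(Y,s,\epsilon)$ jumps from $\infty$ to $0$; $h_{top}(T,Y)=\lim_{\epsilon\to0}h_{top}(T,Y,\epsilon)$. Pressure: $\vec{\Phi}_{\mathcal{A}}=(\{\log\|(\mathcal{A}^n)^{\wedge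 i}\|\}_{n\ge1})_{i=1}^k$, and $P_{\vec{\Phi}_{\mathcal{A}}}(\vec{q})$ is the topological pressure of $\vec q\cdot\vec\Phi_{\mathcal{A}}$: $P_{\vec{\Phi}_{\mathcal{A}}}(\vec{q})=\lim_{\epsilon\to0}\limsup_{n\to\infty}\frac1n\log\sup\{\sum_{x\in E}\prod_{i=1}^k\|(\mathcal{A}^n(x))^{\wedge i}\|^{q_i}: E\subset\Sigma\ (n,\epsilon)\text{-separated}\}$, where $E$ is $(n,\epsilon)$-separated if $d_n(x,y)>\epsilon$ for distinct $x,y\in E$. *)

(* Defs.v *)
From HB Require Import structures.
From mathcomp Require Import all_boot all_order all_algebra.
From mathcomp Require Import all_classical all_reals all_analysis.

Set Implicit Arguments.
Unset Strict Implicit.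
Unset Printing Implicit Defensive.

Import Order.TTheory GRing.Theory Num.Theory.
Import numFieldNormedType.Exports.

Local Open Scope classical_set_scope.
Local Open Scope ring_scope.

Section EuclideanNorm.
Context {R : realType}.

Definition l2norm n (v : 'cV[R]_n) : R := Num.sqrt (\sum_i v i 0 ^+ 2).

Definition opnorm n (B : 'M[R]_n) : R :=
  sup [set l2norm (B *m v) | v in [set v | l2norm v <= 1]].

End EuclideanNorm.

(* The t-th exterior power of R^k in coordinates: the basis vectors
   e_{i_1} ^ ... ^ e_{i_t}, i_1 < ... < i_t (orthonormal for the Euclidean
   structure of the exterior power), are indexed by the increasing maps from
   'I_t to 'I_k. *)
Section ExteriorPower.

Definition multi_index (t k : nat) : finType :=
  {f : {ffun 'I_t -> 'I_k} |
    [forall a : 'I_t, forall b : 'I_t, (a < b)%N ==> (f a < f b)%N]}.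

Definition mi_fun t k (I : multi_index t k) : 'I_t -> 'I_k := sval I.

Context {R : realType}.

(* The coefficient of w_1 ^ ... ^ w_t on e_{i_1} ^ ... ^ e_{i_t} is the minor
   of the matrix (w_1 | ... | w_t) on the rows i_1, ..., i_t. *)
Definition wedge t k (w : 'I_t -> 'cV[R]_k) : 'cV[R]_#|multi_index t k| :=
  \col_I \det (\matrix_(a < t, b < t) w b (mi_fun (enum_val I) a) 0).

(* The matrix of the induced map: the column of index (j_1 < ... < j_t) is
   B e_{j_1} ^ ... ^ B e_{j_t}. *)
Definition extpow t k (B : 'M[R]_k) : 'M[R]_#|multi_index t k| :=
  \matrix_(I, J) wedge (fun b => col (mi_fun (enum_val J) b) B) I 0.

End ExteriorPower.

Definition subshift N (Q : 'M[bool]_N) : Type :=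
  {x : int -> 'I_N | forall i : int, Q (x i) (x (i + 1))}.

(* [esum] requires a choice type of indices. *)
HB.instance Definition _ N (Q : 'M[bool]_N) := gen_eqMixin (subshift Q).
HB.instance Definition _ N (Q : 'M[bool]_N) := gen_choiceMixin (subshift Q).

Section Subshift.
Context {N : nat} {Q : 'M[bool]_N}.
Local Notation Sigma := (subshift Q).

Definition symbol (x : Sigma) (i : int) : 'I_N := sval x i.

Lemma sigma_shift_subproof (n : int) (x : Sigma) (i : int) :
  Q (symbol x (i + n)) (symbol x (i + 1 + n)).
Proof. by rewrite addrAC; exact: (svalP x). Qed.

(* The power T^n of the left shift T = [sigma_shift 1], for any integer n. *)
Definition sigma_shift (n : int) (x : Sigma) : Sigma :=
  exist _ (fun i => symbol x (i + n)) (sigma_shift_subproof n x).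

Definition agree (x y : Sigma) (m : nat) : Prop :=
  forall i : int, (`|i|%N < m)%N -> symbol x i = symbol y i.

Definition max_agree (x y : Sigma) : set nat :=
  [set m | agree x y m /\ forall m', agree x y m' -> (m' <= m)%N].

(* For x <> y, [max_agree x y] is a singleton. *)
Definition dist {R : realType} (omega : R) (x y : Sigma) : R :=
  if `[< x = y >] then 0 else omega ^+ xget 0%N (max_agree x y).

Definition Wsloc (x : Sigma) : set Sigma :=
  [set y | forall n : int, 0 <= n -> symbol y n = symbol x n].

Definition Wuloc (x : Sigma) : set Sigma :=
  [set y | forall n : int, n < 0 -> symbol y n = symbol x n].

Definition Ws (x : Sigma) : set Sigma :=
  [set y | exists2 n : int, 0 <= n & Wsloc (sigma_shift n x) (sigma_shift n y)].

Definition Wu (x : Sigma) : set Sigma :=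
  [set y | exists2 n : int, n <= 0 & Wuloc (sigma_shift n x) (sigma_shift n y)].

Definition least_period (p : Sigma) (l : nat) : Prop :=
  [/\ (0 < l)%N, sigma_shift l p = p
    & forall m : nat, (0 < m < l)%N -> sigma_shift m p <> p].

Context {R : realType} (omega : R).

Definition dopen (U : set Sigma) : Prop :=
  forall x, U x -> exists2 e : R, 0 < e & forall y, dist omega x y < e -> U y.

Definition topologically_mixing : Prop :=
  forall U V : set Sigma, dopen U -> dopen V -> U !=set0 -> V !=set0 ->
  exists n0 : nat, forall n : nat, (n0 <= n)%N ->
    (sigma_shift n @` U) `&` V !=set0.

Definition dist_n (n : nat) (x y : Sigma) : R :=
  \big[Num.max/0]_(j < n) dist omega (sigma_shift j x) (sigma_shift j y).

Definition Bowen_ball (n : nat) (x : Sigma) (e : R) : set Sigma :=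
  [set y | dist_n n x y < e].

Definition dn_separated (n : nat) (e : R) (E : set Sigma) : Prop :=
  forall x y, E x -> E y -> x <> y -> e < dist_n n x y.

(* A countable family of balls B_{n_i}(x_i, e) is given by the set of the
   pairs (n_i, x_i). *)
Definition Bowen_cover (Y : set Sigma) (M : nat) (e : R) :
    set (set (nat * Sigma)) :=
  [set C | [/\ countable C, forall c, C c -> (M <= c.1)%N
             & Y `<=` \bigcup_(c in C) Bowen_ball c.1 c.2 e]].

Definition Bowen_sum (Y : set Sigma) (s : R) (M : nat) (e : R) : \bar R :=
  ereal_inf [set (\esum_(c in C) (expR (- s * c.1%:R))%:E)%E
            | C in Bowen_cover Y M e].

Definition Bowen_lim (Y : set Sigma) (s e : R) : \bar R :=
  limn (fun M => Bowen_sum Y s M e).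

Definition htop_scale (Y : set Sigma) (e : R) : \bar R :=
  ereal_inf [set s%:E | s in [set s : R | Bowen_lim Y s e = 0%E]].

Definition htop (Y : set Sigma) : \bar R :=
  lim (htop_scale Y e @[e --> 0^'+]).

End Subshift.

Section Cocycle.
Context {N : nat} {Q : 'M[bool]_N} {R : realType} {k : nat}.
Local Notation Sigma := (subshift Q).
Variable A : Sigma -> 'M[R]_k.

Fixpoint cocycle_pos (n : nat) (x : Sigma) : 'M[R]_k :=
  if n is m.+1 then A (sigma_shift m x) *m cocycle_pos m x else 1%:M.

Fixpoint cocycle_neg (n : nat) (x : Sigma) : 'M[R]_k :=
  if n is m.+1 then invmx (A (sigma_shift (- n%:Z) x)) *m cocycle_neg m x
  else 1%:M.

Definition cocycle (n : int) (x : Sigma) : 'M[R]_k :=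
  match n with
  | Posz m => cocycle_pos m x
  | Negz m => cocycle_neg m.+1 x
  end.

Definition holder (omega r : R) : Prop :=
  exists C : R, forall x y, opnorm (A x - A y) <= C * dist omega x y `^ r.

Definition fiber_bunched (omega r : R) : Prop :=
  forall x, opnorm (A x) * opnorm (invmx (A x)) * omega `^ r < 1.

Definition Hrb (omega r : R) : Prop :=
  [/\ forall x, A x \in unitmx, holder omega r & fiber_bunched omega r].

(* [Hsloc y x] and [Hs y x H] stand for H^s_{y <- x}, and similarly for H^u. *)
Definition Hsloc (y x : Sigma) : 'M[R]_k :=
  limn (fun n : nat => invmx (cocycle n y) *m cocycle n x).

Definition Huloc (y x : Sigma) : 'M[R]_k :=
  limn (fun n : nat => invmx (cocycle (- n%:Z) y) *m cocycle (- n%:Z) x).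

Definition Hs (y x : Sigma) (H : 'M[R]_k) : Prop :=
  \forall n \near \oo,
    H = invmx (cocycle n%:Z y)
        *m Hsloc (sigma_shift n%:Z y) (sigma_shift n%:Z x)
        *m cocycle n%:Z x.

Definition Hu (y x : Sigma) (H : 'M[R]_k) : Prop :=
  \forall n \near \oo,
    H = invmx (cocycle (- n%:Z) y)
        *m Huloc (sigma_shift (- n%:Z) y) (sigma_shift (- n%:Z) x)
        *m cocycle (- n%:Z) x.

(* [lam] lists the roots of the characteristic polynomial with multiplicity.
   They may be taken real: non-real eigenvalues of a real matrix come in
   conjugate pairs, which have equal absolute values. *)
Definition simple_spectrum (P : 'M[R]_k) (lam : 'I_k -> R)
    (v : 'I_k -> 'cV[R]_k) : Prop :=
  [/\ char_poly P = \prod_i ('X - (lam i)%:P),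
      injective lam,
      injective (fun i => `|lam i|)
    & forall i, v i != 0 /\ P *m v i = lam i *: v i].

Definition general_position (I : finType) n (psi : 'M[R]_n)
    (v : I -> 'cV[R]_n) : Prop :=
  forall i j : I, psi *m v i \notin (\sum_(l | l != j) <[v l]>)%VS.

Definition one_typical (p z : Sigma) (lam : 'I_k -> R)
    (v : 'I_k -> 'cV[R]_k) (psi : 'M[R]_k) : Prop :=
  [/\ Ws p z, Wu p z, z <> p,
      exists2 l : nat, least_period p l & simple_spectrum (cocycle l p) lam v
    & (exists hs hu : 'M[R]_k, [/\ Hs p z hs, Hu z p hu & psi = hs *m hu])
      /\ general_position psi v].

Definition t_typical (t : nat) (lam : 'I_k -> R) (v : 'I_k -> 'cV[R]_k)
    (psi : 'M[R]_k) : Prop :=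
  injective (fun I : multi_index t k => \prod_a lam (mi_fun I a)) /\
  general_position (extpow t psi)
    (fun I : multi_index t k => wedge (fun a => v (mi_fun I a))).

Definition typical : Prop :=
  exists p z lam v psi, one_typical p z lam v psi /\
    forall t : nat, (2 <= t <= k.-1)%N -> t_typical t lam v psi.

Definition typical_map (omega r : R) : Prop := Hrb omega r /\ typical.

Definition lyapunov_level (alpha : 'rV[R]_k) : set Sigma :=
  [set x | forall i : 'I_k,
    n%:R^-1 * ln (opnorm (extpow i.+1 (cocycle n%:Z x)))
      @[n --> \oo] --> alpha 0 i].

Definition lyapunov_spectrum : set 'rV[R]_k :=
  [set alpha | lyapunov_level alpha !=set0].

Definition weight (q : 'rV[R]_k) (n : nat) (x : Sigma) : R :=
  \prod_(i < k) opnorm (extpow i.+1 (cocycle n%:Z x)) `^ q 0 i.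

Definition pressure_scale (omega : R) (q : 'rV[R]_k) (e : R) : \bar R :=
  limn_esup (fun n : nat => (n%:R^-1)%:E *
    lne (ereal_sup [set (\esum_(x in E) (weight q n x)%:E)%E
                   | E in dn_separated omega n e]))%E.

Definition pressure (omega : R) (q : 'rV[R]_k) : \bar R :=
  lim (pressure_scale omega q e @[e --> 0^'+]).

End Cocycle.

(* Main.v *)
(** Proof idea.  Let [p] and [z] be the periodic and homoclinic points of the
    typicality assumption.  An orbit that stays near [p], makes the excursion of
    [z] and stays near [p] again has a cocycle close, in the eigenbasis of the
    period matrix and after untwisting by holonomies, to [D^j Psi D^j] with [D]
    diagonal and all minors of [Psi] nonzero.  A compactness argument turns this
    into a uniform lower bound: between any two orbit segments one can insert a
    connection of bounded length such that [log ||(A^n)^i||] becomes additive up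
    to a bounded error, simultaneously for all exterior powers.  Consequently the
    partition sums [Z_n(q)] over words of length [n] grow like [exp(n P(q))].

    Upper bound: the cylinders of length [n] on which the exponents are close to
    [alpha] are covered at a cost at most [Z_n(q) exp(- n alpha . q)].

    Lower bound: for [s] below the infimum, a near minimiser in [q] of a
    regularisation of [log Z_n(q) - n alpha . q] provides a Gibbs weight on words
    whose mean exponents are close to [n alpha] and whose entropy is at least
    [s n]; the law of large numbers and gluing give [exp(s n)] words with
    exponents close to [alpha] for every large [n].  Gluing such words of
    increasing length yields a tree of points of the level set, and a Kraft
    inequality on this tree bounds the covering sums of Bowen from below. *)
Require Import Defs.
From mathcomp Require Import all_boot all_order all_algebra.
From mathcomp Require Import perm.
From mathcomp Require Import all_classical all_reals all_analysis.
From mathcomp Require Import zify ring lra.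

Set Implicit Arguments.
Unset Strict Implicit.
Unset Printing Implicit Defensive.

Import Order.TTheory GRing.Theory Num.Theory.
Import numFieldNormedType.Exports.

Local Open Scope classical_set_scope.
Local Open Scope ring_scope.

(** * Operator norm and exterior powers *)

Section OperatorNorm.
Context {R : realType}.

(** Fiber bunching acts at one decisive place. The shadowing errors of the excursion have size about
    [rho ^+ n] and sit between powers of the period matrix; moving them next to [psi] conjugates
    them by such a power, and bunching turns the result into [theta ^+ n]. Hence the twisting matrix
    is perturbed by an amount tending to 0, although the powers of the eigenvalues spread apart. The
    compactness argument cannot be run on the matrices before and after the connection, which form
    no compact set. It is run on their frames of [t] columns, normalised at a maximal minor so that
    all entries are at most 1. A limit frame is only known to have one nonzero minor, so the powers
    of the period must first carry it to a coordinate plane, where the minors of the twisting matrix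
    apply. In the lower bound the infimum over [q] need not be attained. A quadratic penalty keeps
    near minimisers bounded, and only finite words and near minimisers are used, so that neither
    invariant measures nor the differentiability of the pressure are needed. Once gluing is
    available, the cocycle enters only through a few estimates on the logarithms of its norms. *)

Lemma l2norm_ge0 n (v : 'cV[R]_n) : 0 <= l2norm v.
Proof. exact: sqrtr_ge0. Qed.

Lemma l2norm_sqr n (v : 'cV[R]_n) : l2norm v ^+ 2 = \sum_i v i 0 ^+ 2.
Proof. by rewrite sqr_sqrtr // sumr_ge0 // => i _; exact: sqr_ge0. Qed.

Lemma l2norm_entry n (v : 'cV[R]_n) i : `|v i 0| <= l2norm v.
Proof.
rewrite -sqrtr_sqr ler_sqrt ?sumr_ge0 // => [|j _]; last exact: sqr_ge0.
by rewrite (bigD1 i) //= lerDl sumr_ge0 // => j _; exact: sqr_ge0.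
Qed.

Lemma l2norm_le_sum n (v : 'cV[R]_n) : l2norm v <= \sum_i `|v i 0|.
Proof.
have h0 : 0 <= \sum_i `|v i 0| by rewrite sumr_ge0.
rewrite -(ler_pXn2r (n := 2)) ?nnegrE ?l2norm_ge0 // l2norm_sqr.
rewrite expr2 mulr_suml ler_sum // => i _.
rewrite -real_normK ?num_real // expr2 ler_wpM2l //.
by rewrite (bigD1 i) //= lerDl sumr_ge0.
Qed.

Lemma l2norm0 n : l2norm (0 : 'cV[R]_n) = 0.
Proof.
rewrite /l2norm big1 ?sqrtr0 // => i _.
by rewrite mxE expr0n.
Qed.

Lemma l2normZ n a (v : 'cV[R]_n) : l2norm (a *: v) = `|a| * l2norm v.
Proof.
rewrite /l2norm -sqrtr_sqr -sqrtrM ?sqr_ge0 //; congr Num.sqrt.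
by rewrite mulr_sumr; apply: eq_bigr => i _; rewrite mxE exprMn.
Qed.

(** By Lagrange's identity the double sum of the squares [(a i * b j - a j * b i) ^+ 2] is twice the
    difference of the two sides. *)
Lemma cauchy_schwarz_sum n (a b : 'I_n -> R) :
  (\sum_i a i * b i) ^+ 2 <= (\sum_i a i ^+ 2) * (\sum_i b i ^+ 2).
Proof.
have h : 0 <= \sum_i \sum_j (a i * b j - a j * b i) ^+ 2.
  by apply: sumr_ge0 => i _; apply: sumr_ge0 => j _; exact: sqr_ge0.
have e : \sum_i \sum_j (a i * b j - a j * b i) ^+ 2 =
    ((\sum_i a i ^+ 2) * (\sum_i b i ^+ 2) - (\sum_i a i * b i) ^+ 2) *+ 2.
  have e1 : (\sum_i a i ^+ 2) * (\sum_i b i ^+ 2) =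
      \sum_i \sum_j a i ^+ 2 * b j ^+ 2.
    by rewrite big_distrl /=; apply: eq_bigr => i _; rewrite big_distrr.
  have e2 : (\sum_i a i * b i) ^+ 2 = \sum_i \sum_j (a i * b i) * (a j * b j).
    by rewrite expr2 big_distrl /=; apply: eq_bigr => i _; rewrite big_distrr.
  have e3 : (\sum_i a i ^+ 2) * (\sum_i b i ^+ 2) =
      \sum_i \sum_j a j ^+ 2 * b i ^+ 2 by rewrite e1 exchange_big.
  rewrite mulr2n {1}e1 e3 e2 -!sumrN -!big_split /=; apply: eq_bigr => i _.
  rewrite -!sumrN -!big_split /=; apply: eq_bigr => j _; ring.
by move: h; rewrite e pmulrn_lge0 // subr_ge0.
Qed.

Lemma l2normD n (u v : 'cV[R]_n) : l2norm (u + v) <= l2norm u + l2norm v.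
Proof.
have h0 : 0 <= l2norm u + l2norm v by rewrite addr_ge0 // l2norm_ge0.
rewrite -(ler_pXn2r (n := 2)) ?nnegrE ?l2norm_ge0 // sqrrD !l2norm_sqr.
have -> : \sum_i (u + v) i 0 ^+ 2 = \sum_i u i 0 ^+ 2 +
   (\sum_i u i 0 * v i 0) *+ 2 + \sum_i v i 0 ^+ 2.
  rewrite -sumrMnl -!big_split /=; apply: eq_bigr => i _.
  by rewrite mxE sqrrD.
rewrite lerD2r lerD2l lerMn2r /=.
have h1 : 0 <= l2norm u * l2norm v by rewrite mulr_ge0 // l2norm_ge0.
apply: le_trans (ler_norm _) _.
rewrite -(ler_pXn2r (n := 2)) ?nnegrE // real_normK ?num_real //.
by rewrite exprMn !l2norm_sqr cauchy_schwarz_sum.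
Qed.

Lemma l2norm_mul_le n (B : 'M[R]_n) (v : 'cV[R]_n) :
  l2norm (B *m v) <= (\sum_i \sum_j `|B i j|) * l2norm v.
Proof.
apply: le_trans (l2norm_le_sum _) _.
rewrite mulr_suml ler_sum // => i _; rewrite mxE.
apply: le_trans (ler_norm_sum _ _ _) _.
rewrite mulr_suml ler_sum // => j _; rewrite normrM.
by rewrite ler_wpM2l // l2norm_entry.
Qed.

Let opset n (B : 'M[R]_n) := [set l2norm (B *m v) | v in [set v | l2norm v <= 1]].

Let opset_has_sup n (B : 'M[R]_n) : has_sup (opset B).
Proof.
split; first by exists (l2norm (B *m 0)), 0 => //=; rewrite l2norm0.
exists (\sum_i \sum_j `|B i j|) => _ [v /= hv <-].
apply: le_trans (l2norm_mul_le _ _) _.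
by rewrite ler_piMr // sumr_ge0 // => i _; rewrite sumr_ge0.
Qed.

Lemma opnorm_ge0 n (B : 'M[R]_n) : 0 <= opnorm B.
Proof.
apply: (@le_trans _ _ (l2norm (B *m 0))); first exact: l2norm_ge0.
by apply: (sup_upper_bound (opset_has_sup B)); exists 0 => //=; rewrite l2norm0.
Qed.

Lemma l2norm_eq0 n (v : 'cV[R]_n) : l2norm v = 0 -> v = 0.
Proof.
move=> h; apply/matrixP => i j; rewrite (ord1 j) mxE; apply/eqP.
by rewrite -normr_le0 -h l2norm_entry.
Qed.

Lemma l2norm_opnorm n (B : 'M[R]_n) v : l2norm (B *m v) <= opnorm B * l2norm v.
Proof.
have [v0|v0] := eqVneq (l2norm v) 0.
  by rewrite (l2norm_eq0 v0) mulmx0 l2norm0 mulr0.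
have vp : 0 < l2norm v by rewrite lt_def v0 l2norm_ge0.
rewrite -ler_pdivrMr // mulrC -[(l2norm v)^-1]gtr0_norm ?invr_gt0 //.
rewrite -l2normZ scalemxAr.
apply: (sup_upper_bound (opset_has_sup B)); exists ((l2norm v)^-1 *: v) => //=.
by rewrite l2normZ gtr0_norm ?invr_gt0 // mulVf.
Qed.

Lemma opnorm_le n (B : 'M[R]_n) c : 0 <= c ->
  (forall v, l2norm (B *m v) <= c * l2norm v) -> opnorm B <= c.
Proof.
move=> c0 h; apply: ge_sup; first exact: (opset_has_sup B).1.
move=> _ [v /= hv <-]; apply: le_trans (h v) _.
by rewrite ler_piMr.
Qed.

Lemma opnorm_le_sum n (B : 'M[R]_n) : opnorm B <= \sum_i \sum_j `|B i j|.
Proof.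
apply: opnorm_le => [|v]; last exact: l2norm_mul_le.
by rewrite sumr_ge0 // => i _; rewrite sumr_ge0.
Qed.

Lemma opnorm_entry n (B : 'M[R]_n) i j : `|B i j| <= opnorm B.
Proof.
have := l2norm_opnorm B (delta_mx j 0); have -> : l2norm (delta_mx j 0 : 'cV[R]_n) = 1.
  rewrite /l2norm (bigD1 j) //= big1 ?addr0 ?mxE ?eqxx ?expr1n ?sqrtr1 //.
  by move=> l lj; rewrite mxE (negbTE lj) /= expr0n.
rewrite mulr1 => /(le_trans _); apply.
by have := l2norm_entry (B *m delta_mx j 0) i; rewrite -colE mxE.
Qed.

Lemma opnormM n (B C : 'M[R]_n) : opnorm (B *m C) <= opnorm B * opnorm C.
Proof.
apply: opnorm_le => [|v]; first by rewrite mulr_ge0 // opnorm_ge0.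
rewrite -mulmxA -mulrA; apply: le_trans (l2norm_opnorm _ _) _.
by rewrite ler_wpM2l ?opnorm_ge0 // l2norm_opnorm.
Qed.

Lemma opnormM_le n (B C : 'M[R]_n) b c :
  opnorm B <= b -> opnorm C <= c -> opnorm (B *m C) <= b * c.
Proof.
by move=> hB hC; apply: le_trans (opnormM B C) _; rewrite ler_pM // opnorm_ge0.
Qed.

Lemma opnormD n (B C : 'M[R]_n) : opnorm (B + C) <= opnorm B + opnorm C.
Proof.
apply: opnorm_le => [|v]; first by rewrite addr_ge0 // opnorm_ge0.
rewrite mulmxDl mulrDl; apply: le_trans (l2normD _ _) _.
by rewrite lerD // l2norm_opnorm.
Qed.

Lemma opnormN n (B : 'M[R]_n) : opnorm (- B) = opnorm B.
Proof.
suff h C : opnorm (- C) <= opnorm (C : 'M[R]_n).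
  by apply/eqP; rewrite eq_le h -{1}[B]opprK h.
apply: opnorm_le => [|v]; first exact: opnorm_ge0.
rewrite mulNmx -scaleN1r l2normZ normrN1 mul1r; exact: l2norm_opnorm.
Qed.

Lemma opnorm_distC n (B C : 'M[R]_n) : opnorm (B - C) = opnorm (C - B).
Proof. by rewrite -opnormN opprB. Qed.

Lemma opnorm1_le n : opnorm (1%:M : 'M[R]_n) <= 1.
Proof. by apply: opnorm_le => // v; rewrite mul1mx mul1r. Qed.

Lemma opnorm0 n : opnorm (0 : 'M[R]_n) = 0.
Proof.
apply/eqP; rewrite eq_le opnorm_ge0 andbT.
by apply: opnorm_le => // v; rewrite mul0mx l2norm0 mul0r.
Qed.

Lemma opnorm_unit_gt0 n (B : 'M[R]_n) : (0 < n)%N -> B \in unitmx -> 0 < opnorm B.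
Proof.
move=> n0 uB; rewrite lt_def opnorm_ge0 andbT; apply/eqP => h.
have B0 : B = 0.
  apply/matrixP => i j; rewrite mxE; apply/eqP.
  by rewrite -normr_le0 -h opnorm_entry.
move: uB n0; rewrite unitmxE B0; case: n {B h B0} => // n.
by rewrite det0 unitr0.
Qed.

Lemma opnorm_near1 n (B : 'M[R]_n) a : opnorm (B - 1%:M) <= a -> opnorm B <= 1 + a.
Proof.
move=> h; rewrite -[B](subrK 1%:M) addrC; apply: le_trans (opnormD _ _) _.
by rewrite lerD // opnorm1_le.
Qed.

Lemma opnorm_near1M n (B C : 'M[R]_n) a b : 0 <= a -> 0 <= b ->
  opnorm (B - 1%:M) <= a -> opnorm (C - 1%:M) <= b ->
  opnorm (B *m C - 1%:M) <= a + b + a * b.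
Proof.
move=> a0 b0 hB hC.
have -> : B *m C - 1%:M = (B - 1%:M) + (C - 1%:M) + (B - 1%:M) *m (C - 1%:M).
  rewrite mulmxBl mul1mx mulmxBr mulmx1; move: (B *m C) => X.
  by apply/matrixP => i j; rewrite !mxE; ring.
apply: le_trans (opnormD _ _) _; apply: lerD.
  by apply: le_trans (opnormD _ _) _; apply: lerD.
by apply: le_trans (opnormM _ _) _; rewrite ler_pM // opnorm_ge0.
Qed.

End OperatorNorm.

(** * The Cauchy-Binet formula *)

Section CauchyBinet.
Context {R : realType}.
Variables (t k : nat).

Lemma mi_fun_mono (I : multi_index t k) : {homo mi_fun I : a b / (a < b)%N}.
Proof.
move=> a b ab; have /forallP/(_ a)/forallP/(_ b)/implyP := svalP I.
by apply.
Qed.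

Lemma mi_fun_inj (I : multi_index t k) : injective (mi_fun I).
Proof.
move=> a b e; apply/eqP/negPn/negP => ab.
have := ab; rewrite -val_eqE neq_ltn => /orP[] /(@mi_fun_mono I); rewrite e ltnn //.
Qed.

Lemma mi_fun_eq (I J : multi_index t k) : mi_fun I =1 mi_fun J -> I = J.
Proof. by move=> e; apply/val_inj/ffunP => a; exact: e. Qed.

(** The values of an increasing map form a strictly sorted list, and such a list is determined by
    its set of elements. *)
Lemma mi_codom_eq (I J : multi_index t k) :
  perm_eq (codom (mi_fun I)) (codom (mi_fun J)) -> I = J.
Proof.
have srt (K : multi_index t k) : sorted (fun i j : 'I_k => (i < j)%N) (codom (mi_fun K)).
  rewrite /codom /image_mem -/(codom _) sorted_map.
  have : sorted ltn [seq val a | a <- enum 'I_t] by rewrite val_enum_ord iota_ltn_sorted.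
  rewrite sorted_map; apply: sub_sorted => a b; exact: mi_fun_mono.
move=> /perm_mem e; apply: mi_fun_eq => a.
have := irr_sorted_eq _ _ (srt I) (srt J) e => h.
have {}h : codom (mi_fun I) = codom (mi_fun J).
  by apply: h => [x y z|x]; [exact: ltn_trans | exact: ltnn].
have sz (K : multi_index t k) : (a < size (codom (mi_fun K)))%N by rewrite size_codom card_ord.
have nt (K : multi_index t k) : nth (mi_fun I a) (codom (mi_fun K)) a = mi_fun K a.
  rewrite /codom /image_mem (nth_map a) ?size_enum_ord //; congr (mi_fun K _).
  by rewrite -[X in nth _ _ X]/(val a) nth_ord_enum.
by rewrite -nt h nt.
Qed.

(** Sorting the image gives [I], and [s] records the order in which [f] visits it. Minors along
    arbitrary injective index maps are thereby reduced, up to sign, to those along increasing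
    ones. *)
Lemma inj_mi_fun (f : 'I_t -> 'I_k) : injective f ->
  exists (I : multi_index t k) (s : {perm 'I_t}), forall a, f a = mi_fun I (s a).
Proof.
move=> inj_f.
pose l := sort (fun i j : 'I_k => (i <= j)%N) (codom f).
have szl : size l = t by rewrite size_sort size_codom card_ord.
have ul : uniq l.
  by rewrite sort_uniq; apply/injectiveP.
have sl : sorted (fun i j : 'I_k => (i < j)%N) l.
  have s1 : sorted (fun i j : 'I_k => (i <= j)%N) l.
    by apply: sort_sorted => x y; exact: leq_total.
  have : sorted ltn [seq val i | i <- l].
    rewrite ltn_sorted_uniq_leq map_inj_uniq ?ul //=; last exact: val_inj.
    by rewrite sorted_map.
  by rewrite sorted_map.
have szt : size l == t by apply/eqP.
pose g := tnth (Tuple szt).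
have gmono (a b : 'I_t) : (a < b)%N -> (g a < g b)%N.
  move=> ab; rewrite /g !(tnth_nth (g a)) /=.
  have := @sorted_ltn_nth _ (fun i j : 'I_k => (i < j)%N) _ (g a) l sl a b.
  by apply; rewrite ?inE ?szl //; move=> x y z; exact: ltn_trans.
have gI : [forall a : 'I_t, forall b : 'I_t, (a < b)%N ==>
     ([ffun a => g a] a < [ffun a => g a] b)%N].
  apply/forallP => a; apply/forallP => b; apply/implyP => ab.
  by rewrite !ffunE; exact: gmono.
pose I : multi_index t k := exist _ [ffun a => g a] gI.
have pe : perm_eq [tuple f a | a < t] (Tuple szt).
  by rewrite /= perm_sym perm_sort codomE enumT.
have [s hs] := tuple_permP pe.
exists I, s => a.
have := congr1 (fun u => nth (f a) u a) hs.
rewrite /= (nth_map a) ?size_enum_ord // nth_ord_enum => ->.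
by rewrite (nth_map a) ?size_enum_ord // nth_ord_enum /mi_fun /= ffunE.
Qed.

(** Multilinear expansion of the determinant in the rows of the product, each of which is a
    combination of rows of [Y]. *)
Lemma det_mulmx_ffun (X : 'M[R]_(t, k)) (Y : 'M[R]_(k, t)) :
  \det (X *m Y) = \sum_(f : {ffun 'I_t -> 'I_k})
     (\prod_a X a (f a)) * \det (rowsub f Y).
Proof.
rewrite /determinant.
under eq_bigr => s _.
  under eq_bigr => a _ do rewrite mxE.
  rewrite bigA_distr_bigA mulr_sumr.
  over.
rewrite /= exchange_big /=; apply: eq_bigr => f _.
rewrite mulr_sumr; apply: eq_bigr => s _.
rewrite big_split /= mulrCA; congr (_ * (_ * _)).
by apply: eq_bigr => a _; rewrite mxE.
Qed.

Lemma det_rowsub_perm (Y : 'M[R]_(k, t)) (f : 'I_t -> 'I_k) (s : {perm 'I_t}) :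
  \det (rowsub (fun a => f (s a)) Y) = (-1) ^+ s * \det (rowsub f Y).
Proof.
have -> : rowsub (fun a => f (s a)) Y = perm_mx s *m rowsub f Y.
  by rewrite -row_permE; apply/matrixP => a b; rewrite !mxE.
by rewrite det_mulmx det_perm.
Qed.

(** In the multilinear expansion a non-injective [f] repeats a row and contributes nothing. An
    injective [f] is uniquely an increasing map composed with a permutation, and the sum over the
    permutations reassembles the minor of [X]. *)
Lemma cauchy_binet (X : 'M[R]_(t, k)) (Y : 'M[R]_(k, t)) :
  \det (X *m Y) = \sum_(I : multi_index t k)
    \det (colsub (mi_fun I) X) * \det (rowsub (mi_fun I) Y).
Proof.
rewrite det_mulmx_ffun (bigID (fun f : {ffun 'I_t -> 'I_k} => injectiveb f)) /=.
rewrite [X in _ + X]big1 ?addr0 => [|f nif]; last first.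
  move/injectivePn: nif => [a [b ab e]].
  rewrite [X in _ * X](_ : _ = 0) ?mulr0 //.
  by apply: (determinant_alternate ab) => c; rewrite !mxE e.
pose h (p : multi_index t k * {perm 'I_t}) := [ffun a => mi_fun p.1 (p.2 a)].
have hinj : injective h.
  move=> [I s] [J s'] /ffunP e.
  have e' a : mi_fun I (s a) = mi_fun J (s' a) by have := e a; rewrite !ffunE.
  have pc (K : multi_index t k) (u : {perm 'I_t}) :
      perm_eq (codom (fun a => mi_fun K (u a))) (codom (mi_fun K)).
    rewrite !codomE (map_comp (mi_fun K) u); apply: perm_map.
    apply: uniq_perm; [by rewrite (map_inj_uniq perm_inj) enum_uniq | by rewrite enum_uniq |].
    move=> x; rewrite mem_enum inE; apply/mapP; exists (u^-1%g x); rewrite ?mem_enum //.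
    by rewrite permKV.
  have IJ : I = J.
    apply: mi_codom_eq; rewrite perm_sym; apply: perm_trans (pc I s).
    rewrite perm_sym (eq_codom e'); exact: pc.
  congr pair => //; apply/permP => a; move: (e' a); rewrite IJ; exact: mi_fun_inj.
have -> : \sum_(f : {ffun 'I_t -> 'I_k} | injectiveb f)
     (\prod_a X a (f a)) * \det (rowsub f Y) =
   \sum_(f in h @: [set: multi_index t k * {perm 'I_t}]%SET)
     (\prod_a X a (f a)) * \det (rowsub f Y).
  apply: eq_bigl => f; apply/injectiveP/imsetP => [inj_f|[[I s] _ ->]].
    have [I [s e]] := inj_mi_fun inj_f; exists (I, s); rewrite ?inE //.
    by apply/ffunP => a; rewrite ffunE e.
  by move=> a b; rewrite !ffunE => /mi_fun_inj/perm_inj.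
rewrite big_imset /=; last by move=> x y _ _; exact: hinj.
under eq_bigl => p do rewrite inE.
transitivity (\sum_(I : multi_index t k) \sum_(s : {perm 'I_t})
  (\prod_a X a (h (I, s) a)) * \det (rowsub (h (I, s)) Y)).
  by rewrite pair_bigA /=; apply: eq_bigr => -[I s] _.
apply: eq_bigr => I _; rewrite [\det (colsub _ _)]/determinant mulr_suml.
apply: eq_bigr => s _.
have -> : \det (rowsub (h (I, s)) Y) = (-1) ^+ s * \det (rowsub (mi_fun I) Y).
  rewrite -det_rowsub_perm; congr (\det _); apply/matrixP => a b.
  by rewrite !mxE ffunE.
rewrite mulrA [_ * (-1) ^+ s]mulrC; congr (_ * _ * _).
by apply: eq_bigr => a _; rewrite !mxE ffunE.
Qed.

End CauchyBinet.

Section ExteriorPowerNorm.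
Context {R : realType}.
Variables (t k : nat).
Implicit Types B C : 'M[R]_k.

Lemma extpowE B I J : extpow t B I J =
  \det (mxsub (mi_fun (enum_val I : multi_index t k)) (mi_fun (enum_val J : multi_index t k)) B).
Proof.
by rewrite /extpow mxE /wedge mxE; congr (\det _); apply/matrixP => a b; rewrite !mxE.
Qed.

Lemma sum_enum_val (V : nmodType) (F : multi_index t k -> V) :
  \sum_(I < #|multi_index t k|) F (enum_val I) = \sum_I F I.
Proof.
pose h : 'I_#|multi_index t k| -> multi_index t k := enum_val.
rewrite [RHS](reindex h) //=.
by exists enum_rank => x _; [exact: enum_valK | exact: enum_rankK].
Qed.

Lemma extpowM B C : extpow t (B *m C) = extpow t B *m extpow t C.
Proof.
apply/matrixP => I J; rewrite extpowE mxE.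
under [RHS]eq_bigr => K _ do rewrite !extpowE.
rewrite (sum_enum_val (fun K => \det (mxsub (mi_fun (enum_val I)) (mi_fun K) B) *
  \det (mxsub (mi_fun K) (mi_fun (enum_val J)) C))).
have -> : mxsub (mi_fun (enum_val I)) (mi_fun (enum_val J)) (B *m C) =
   rowsub (mi_fun (enum_val I)) B *m colsub (mi_fun (enum_val J)) C.
  by apply/matrixP => a b; rewrite !mxE; apply: eq_bigr => c _; rewrite !mxE.
rewrite cauchy_binet; apply: eq_bigr => K _; congr (_ * _); congr (\det _);
  by apply/matrixP => a b; rewrite !mxE.
Qed.

Lemma extpow1 : extpow t (1%:M : 'M[R]_k) = 1%:M.
Proof.
apply/matrixP => I J; rewrite extpowE !mxE.
have [->|IJ] := eqVneq I J.
  rewrite [mxsub _ _ _](_ : _ = 1%:M) ?det1 //; apply/matrixP => a b.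
  by rewrite !mxE (inj_eq (@mi_fun_inj _ _ _)).
(* Two distinct index sets of the same size: some index of [I] is missing from [J], so the minor of
   the identity has a zero row. *)
have [a ha] : exists a, mi_fun (enum_val I : multi_index t k) a \notin
    codom (mi_fun (enum_val J : multi_index t k)).
  apply/existsP; rewrite -negb_forall; apply/negP => /forallP h.
  move/negP: IJ; apply; apply/eqP/enum_val_inj/mi_codom_eq.
  have uI : uniq (codom (mi_fun (enum_val I : multi_index t k))).
    by apply/injectiveP; exact: mi_fun_inj.
  apply: uniq_perm => //; first by apply/injectiveP; exact: mi_fun_inj.
  have sub : {subset codom (mi_fun (enum_val I : multi_index t k)) <=
      codom (mi_fun (enum_val J : multi_index t k))}.
    by move=> _ /codomP[b ->]; exact: h.
  by have [] := uniq_min_size uI sub; rewrite ?size_codom.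
rewrite (expand_det_row _ a) big1 // => b _; rewrite !mxE.
case: eqP => [e|]; last by rewrite mul0r.
by move: ha; rewrite e codom_f.
Qed.

Lemma extpow_unit B : B \in unitmx -> extpow t B \in unitmx.
Proof.
move=> uB; have : extpow t B *m extpow t (invmx B) = 1%:M.
  by rewrite -extpowM mulmxV // extpow1.
by case/mulmx1_unit.
Qed.

Lemma card_multi_index_gt0 : (t <= k)%N -> (0 < #|multi_index t k|)%N.
Proof.
move=> tk; apply/card_gt0P.
have inj_w : injective (widen_ord tk) by move=> a b /(congr1 val) /= /ord_inj.
have [I _] := inj_mi_fun inj_w.
by exists I.
Qed.

Lemma opnorm_extpowM B C :
  opnorm (extpow t (B *m C)) <= opnorm (extpow t B) * opnorm (extpow t C).
Proof. by rewrite extpowM opnormM. Qed.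

Lemma minor_le_extpow B (I J : multi_index t k) :
  `|\det (mxsub (mi_fun I) (mi_fun J) B)| <= opnorm (extpow t B).
Proof.
have := opnorm_entry (extpow t B) (enum_rank I) (enum_rank J).
by rewrite extpowE !enum_rankK.
Qed.

(** Together with [minor_le_extpow], this makes the norm of an exterior power comparable to the
    largest minor, so that the twisting estimates can be carried out on determinants. *)
Lemma extpow_le_minors B c :
  (forall I J : multi_index t k, `|\det (mxsub (mi_fun I) (mi_fun J) B)| <= c) ->
  opnorm (extpow t B) <= #|multi_index t k|%:R ^+ 2 * c.
Proof.
move=> h; apply: le_trans (opnorm_le_sum _) _.
have e I J : `|extpow t B I J| <= c by rewrite extpowE.
apply: le_trans (ler_sum _ (fun I _ => ler_sum _ (fun J _ => e I J))) _.
by rewrite !sumr_const !card_ord -mulrnA -[c *+ _]mulr_natl natrM expr2.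
Qed.

Lemma opnorm_extpow_bound (K : R) : exists2 M : R, 0 < M &
  forall B, opnorm B <= K -> opnorm (extpow t B) <= M.
Proof.
exists (#|multi_index t k|%:R ^+ 2 * (\sum_(s : {perm 'I_t}) `|K| ^+ t) + 1).
  by rewrite ltr_wpDl // mulr_ge0 ?sqr_ge0 ?sumr_ge0.
move=> B hB; apply: (@le_trans _ _
  (#|multi_index t k|%:R ^+ 2 * (\sum_(s : {perm 'I_t}) `|K| ^+ t))); last by rewrite lerDl.
apply: extpow_le_minors => I J; rewrite /determinant.
apply: le_trans (ler_norm_sum _ _ _) _; apply: ler_sum => s _.
rewrite normrM normrX normrN1 expr1n mul1r normr_prod.
rewrite -[t in leRHS]card_ord -prodr_const ler_prod // => a _.
rewrite normr_ge0 /= mxE; apply: le_trans (opnorm_entry _ _ _) _.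
exact: le_trans hB (ler_norm _).
Qed.

End ExteriorPowerNorm.

(** * Uniform choices over finite families *)

Section FiniteFamilies.
Context {R : realType}.

Lemma finite_maximizer (X : finType) (P : pred X) (F : X -> R) x0 : P x0 ->
  exists2 x, P x & forall y, P y -> F y <= F x.
Proof. by move=> Px0; case: (arg_maxP F Px0) => x Px h; exists x. Qed.

Lemma finite_common_bound (X : finType) (P : X -> nat -> Prop) :
  (forall x n m, (n <= m)%N -> P x n -> P x m) ->
  (forall x, exists n, P x n) -> exists n, forall x, P x n.
Proof.
move=> mono /choice[f hf]; exists (\max_x f x)%N => x.
exact: mono (leq_bigmax x) (hf x).
Qed.

Lemma finite_common_pos (X : finType) (P : X -> R -> Prop) :
  (forall x a b, 0 < a -> a <= b -> P x b -> P x a) ->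
  (forall x, exists2 a, 0 < a & P x a) -> exists2 a, 0 < a & forall x, P x a.
Proof.
move=> mono h.
have /choice[f hf] : forall x, exists a, 0 < a /\ P x a.
  by move=> x; have [a a0 Pa] := h x; exists a.
have [x0|] := pselect (exists x0 : X, True); last first.
  by move=> nX; exists 1 => // x; case: nX; exists x.
case: x0 => x0 _.
have [x _ hx] := @finite_maximizer X predT (fun x => - f x) x0 isT.
exists (f x); first exact: (hf x).1.
move=> y; apply: (mono y _ (f y)); [exact: (hf x).1 | | exact: (hf y).2].
by rewrite -lerN2; exact: hx.
Qed.

(** Bolzano-Weierstrass for a finite family of bounded sequences, read as a sequence of row vectors
    in a compact box. All entries cluster along the same indices. *)
Lemma bounded_cluster (X : finType) (K : R) (u : nat -> X -> R) :
  (forall n x, `|u n x| <= K) ->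
  exists l : X -> R, (forall x, `|l x| <= K) /\
    forall e n0, 0 < e -> exists2 n, (n0 <= n)%N & forall x, `|u n x - l x| <= e.
Proof.
move=> hu.
pose v n : 'rV[R]_#|X| := \row_i u n (enum_val i).
have cK : compact [set w : 'rV[R]_#|X| | forall i, `[- K, K]%classic (w ord0 i)].
  by apply: (@rV_compact R #|X| (fun=> `[- K, K]%classic)) => i; exact: segment_compact.
have vK : (v n @[n --> \oo]) [set w : 'rV[R]_#|X| | forall i, `[- K, K]%classic (w ord0 i)].
  exists 0%N => // n _ i /=; rewrite in_itv /= mxE.
  by rewrite -ler_norml.
have [l [lK lc]] := cK _ _ vK.
exists (fun x => l ord0 (enum_rank x)); split=> [x|e n0 e0].
  by have := lK (enum_rank x); rewrite /= in_itv /= -ler_norml.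
have A1 : (v n @[n --> \oo]) [set w | exists2 n, (n0 <= n)%N & w = v n].
  by exists n0 => // n /= hn; exists n.
have [w [[n hn ->]]] := lc _ _ A1 (nbhsx_ballx l e e0).
move=> [_ hb]; exists n => // x; have := hb ord0 (enum_rank x).
rewrite /ball /= mxE enum_rankK distrC => h; exact: ltW.
Qed.

End FiniteFamilies.

(** * Uniform continuity of determinants *)

Section DetContinuity.
Context {R : realType}.

Lemma prod_dist_le (X : Type) (s : seq X) (a b : X -> R) K d : 1 <= K -> 0 <= d ->
  (forall x, `|a x| <= K) -> (forall x, `|b x| <= K) ->
  (forall x, `|a x - b x| <= d) ->
  `|\prod_(x <- s) a x| <= K ^+ size s /\
  `|\prod_(x <- s) a x - \prod_(x <- s) b x| <= (size s)%:R * K ^+ size s * d.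
Proof.
move=> K1 d0 ha hb hd; have K0 : 0 <= K by exact: le_trans K1.
elim: s => [|x s [IH1 IH2]].
  by rewrite !big_nil normr1 subrr normr0 !mul0r.
rewrite !big_cons /= normrM exprS; split; first by rewrite ler_pM.
set p := \prod_(j <- s) a j in IH1 IH2 *; set q := \prod_(j <- s) b j in IH2 *.
have -> : a x * p - b x * q = (a x - b x) * p + b x * (p - q) by ring.
apply: le_trans (ler_normD _ _) _; rewrite !normrM.
have h1 : `|a x - b x| * `|p| <= d * K ^+ size s by rewrite ler_pM.
have h2 : `|b x| * `|p - q| <= K * ((size s)%:R * K ^+ size s * d) by rewrite ler_pM.
apply: le_trans (lerD h1 h2) _.
have -> : (size s).+1%:R = (size s)%:R + 1 :> R by rewrite natr1.
have h3 : d * K ^+ size s <= d * (K * K ^+ size s).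
  by rewrite ler_wpM2l // ler_peMl // exprn_ge0.
apply: le_trans (lerD h3 (lexx _)) _.
by rewrite le_eqVlt; apply/orP; left; apply/eqP; ring.
Qed.

Lemma det_uniform_continuous t (K e : R) : 0 < e -> exists2 d, 0 < d &
  forall X Y : 'M[R]_t, (forall i j, `|X i j| <= K) -> (forall i j, `|Y i j| <= K) ->
    (forall i j, `|X i j - Y i j| <= d) -> `|\det X - \det Y| <= e.
Proof.
move=> e0; pose K' := `|K| + 1.
have K1 : 1 <= K' by rewrite lerDr.
(* The number of permutations times the Lipschitz constant of a product of [t] factors; the added 1
   keeps the quotient [e / c] meaningful. *)
pose c := #|{perm 'I_t}|%:R * (t%:R * K' ^+ t) + 1.
have c0 : 0 < c by rewrite ltr_wpDl // !mulr_ge0 // exprn_ge0 // (le_trans _ K1).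
exists (e / c); first exact: divr_gt0.
move=> X Y hX hY hd; rewrite /determinant -sumrB.
apply: le_trans (ler_norm_sum _ _ _) _.
have h s : `|(-1) ^+ odd_perm s * \prod_i X i (s i) - (-1) ^+ odd_perm s * \prod_i Y i (s i)|
    <= t%:R * K' ^+ t * (e / c).
  rewrite -mulrBr normrM normrX normrN1 expr1n mul1r.
  have KK : K <= K' by rewrite (le_trans (ler_norm K)) // lerDl.
  have [] := @prod_dist_le _ (index_enum 'I_t) (fun i => X i (s i)) (fun i => Y i (s i))
     K' (e / c) K1 (ltW (divr_gt0 e0 c0)).
  - by move=> i; exact: le_trans (hX _ _) KK.
  - by move=> i; exact: le_trans (hY _ _) KK.
  - by move=> i; exact: hd.
  have -> : size (index_enum 'I_t) = t by rewrite -[RHS]card_ord cardT enumT.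
  by [].
apply: le_trans (ler_sum _ (fun s _ => h s)) _.
rewrite sumr_const -[_ *+ _]mulr_natl.
set a := _ * (e / c); set b := _%:R * _.
have -> : b = (c - 1) * (e / c) by rewrite /b /a /c; ring.
apply: (@le_trans _ _ (c * (e / c))); last by rewrite mulrCA divff ?gt_eqF ?mulr1.
by rewrite ler_wpM2r ?(ltW (divr_gt0 e0 c0)) // gerBl.
Qed.

Lemma mulmx3_dist_le m k n (K d : R) (F F' : 'M[R]_(m, k)) (P P' : 'M[R]_k)
    (E E' : 'M[R]_(k, n)) : 1 <= K -> 0 <= d ->
  (forall i j, `|F i j| <= K /\ `|F' i j| <= K) ->
  (forall i j, `|P i j| <= K /\ `|P' i j| <= K) ->
  (forall i j, `|E i j| <= K /\ `|E' i j| <= K) ->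
  (forall i j, `|F i j - F' i j| <= d) -> (forall i j, `|P i j - P' i j| <= d) ->
  (forall i j, `|E i j - E' i j| <= d) ->
  forall a b, `|(F *m P *m E) a b| <= k%:R ^+ 2 * K ^+ 3 /\
    `|(F *m P *m E) a b - (F' *m P' *m E') a b| <= k%:R ^+ 2 * (3 * K ^+ 3 * d).
Proof.
move=> K1 d0 hF hP hE dF dP dE a b; have K0 : 0 <= K by exact: le_trans K1.
have ex (X : 'M[R]_(m, k)) Y (Z : 'M[R]_(k, n)) : (X *m Y *m Z) a b =
    \sum_j \sum_i X a i * Y i j * Z j b.
  by rewrite mxE; apply: eq_bigr => j _; rewrite mxE mulr_suml.
have bd (c : R) (G : 'I_k -> 'I_k -> R) : (forall i j, `|G i j| <= c) ->
   `|\sum_j \sum_i G i j| <= k%:R ^+ 2 * c.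
  move=> hG; apply: le_trans (ler_norm_sum _ _ _) _.
  have h j : `|\sum_i G i j| <= \sum_(i < k) c.
    by apply: le_trans (ler_norm_sum _ _ _) _; exact: ler_sum.
  apply: le_trans (ler_sum _ (fun j _ => h j)) _.
  by rewrite !sumr_const card_ord -mulrnA -[c *+ _]mulr_natl natrM expr2.
rewrite !ex; split.
  by apply: bd => i j; rewrite !normrM 2!exprSr expr1 !ler_pM ?mulr_ge0 //;
    [exact: (hF _ _).1|exact: (hP _ _).1|exact: (hE _ _).1].
rewrite -sumrB; under eq_bigr do rewrite -sumrB.
apply: bd => i j.
set f := F a i; set f' := F' a i; set p := P i j; set p' := P' i j.
set x := E j b; set x' := E' j b.
have -> : f * p * x - f' * p' * x' =
  (f - f') * p * x + f' * (p - p') * x + f' * p' * (x - x') by ring.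
have h1 : `|(f - f') * p * x| <= d * K * K.
  by rewrite !normrM !ler_pM ?mulr_ge0 //; [exact: dF|exact: (hP _ _).1|exact: (hE _ _).1].
have h2 : `|f' * (p - p') * x| <= K * d * K.
  by rewrite !normrM !ler_pM ?mulr_ge0 //; [exact: (hF _ _).2|exact: dP|exact: (hE _ _).1].
have h3 : `|f' * p' * (x - x')| <= K * K * d.
  by rewrite !normrM !ler_pM ?mulr_ge0 //; [exact: (hF _ _).2|exact: (hP _ _).2|exact: dE].
have h4 : d * K * K + K * d * K + K * K * d <= 3 * K ^+ 3 * d.
  have -> : d * K * K + K * d * K + K * K * d = 3 * K ^+ 2 * d by ring.
  rewrite ler_wpM2r // ler_wpM2l // [K ^+ 3]exprS ler_peMl //; exact: exprn_ge0.
apply: le_trans (ler_normD _ _) _; apply: le_trans _ h4.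
by rewrite lerD // (le_trans (ler_normD _ _)) // lerD.
Qed.

Lemma det_mulmx3_uniform_continuous m k (K e : R) : 1 <= K -> 0 < e ->
  exists2 d, 0 < d & forall (F F' : 'M[R]_(m, k)) (P P' : 'M[R]_k) (E E' : 'M[R]_(k, m)),
  (forall i j, `|F i j| <= K /\ `|F' i j| <= K) ->
  (forall i j, `|P i j| <= K /\ `|P' i j| <= K) ->
  (forall i j, `|E i j| <= K /\ `|E' i j| <= K) ->
  (forall i j, `|F i j - F' i j| <= d) -> (forall i j, `|P i j - P' i j| <= d) ->
  (forall i j, `|E i j - E' i j| <= d) ->
  `|\det (F *m P *m E) - \det (F' *m P' *m E')| <= e.
Proof.
move=> K1 e0; have K0 : 0 <= K by exact: le_trans K1.
have [d d0 hd] := @det_uniform_continuous m (k%:R ^+ 2 * K ^+ 3) e e0.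
pose c := k%:R ^+ 2 * (3 * K ^+ 3) + 1.
have c0 : 0 < c by rewrite ltr_wpDl // !mulr_ge0 // ?exprn_ge0.
have dc0 : 0 < d / c by exact: divr_gt0.
exists (d / c) => // F F' P P' E E' hF hP hE dF dP dE.
apply: hd => i j.
- by have [] := @mulmx3_dist_le m k m K (d / c) F F' P P' E E' K1 (ltW dc0) hF hP hE dF dP dE i j.
(* The entries of the second product are bounded by the first half of [mulmx3_dist_le], applied to
   two equal triples with [d = 0]. *)
- have [] // := @mulmx3_dist_le m k m K 0 F' F' P' P' E' E' K1 (lexx 0) _ _ _ _ _ _ i j.
  + by move=> a b; split; exact: (hF a b).2.
  + by move=> a b; split; exact: (hP a b).2.
  + by move=> a b; split; exact: (hE a b).2.
  + by move=> a b; rewrite subrr normr0.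
  + by move=> a b; rewrite subrr normr0.
  + by move=> a b; rewrite subrr normr0.
- have [_] := @mulmx3_dist_le m k m K (d / c) F F' P P' E E' K1 (ltW dc0) hF hP hE dF dP dE i j.
  move=> h; apply: le_trans h _.
  have -> : k%:R ^+ 2 * (3 * K ^+ 3 * (d / c)) = (c - 1) * (d / c) by rewrite /c; ring.
  apply: (@le_trans _ _ (c * (d / c))); last by rewrite mulrCA divff ?gt_eqF ?mulr1.
  by rewrite ler_wpM2r ?(ltW dc0) // gerBl.
Qed.

End DetContinuity.

(** * Uniform twisting *)

Section Proximality.
Context {R : realType} {k : nat}.
Variable lam : 'I_k -> R.
Hypothesis lam_inj : injective (fun i => `|lam i|).
Hypothesis lam_neq0 : forall i, lam i != 0.

Definition diag_pow n : 'M[R]_k := diag_mx (\row_i lam i ^+ n).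

Lemma geometric_small (C q e : R) : 0 <= q < 1 -> 0 < e ->
  exists n0, forall n, (n0 <= n)%N -> C * q ^+ n <= e.
Proof.
move=> /andP[q0 q1] e0.
have := @cvg_geometric R C q; rewrite ger0_norm // => /(_ q1)/cvgrPdist_le/(_ e e0)[n0 _ h].
exists n0 => n hn; have := h n hn; rewrite sub0r normrN => /(le_trans _); apply.
by rewrite /geometric /= ler_norm.
Qed.

(** When the rows [f] of [E] form the identity, every entry of [E] is a minor with one row
    exchanged. Entries can then be controlled through the extremality of a minor. *)
Lemma det_replace_row t (E : 'M[R]_(k, t)) (f : 'I_t -> 'I_k) i b :
  rowsub f E = 1%:M ->
  \det (rowsub (fun a => if a == b then i else f a) E) = E i b.
Proof.
move=> fE; have fE' a c : E (f a) c = (a == c)%:R.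
  by have /matrixP/(_ a c) := fE; rewrite !mxE.
rewrite (expand_det_col _ b) (bigD1 b) //= big1 ?addr0 => [|a ab]; last first.
  by rewrite !mxE (negbTE ab) fE' (negbTE ab) mul0r.
rewrite !mxE eqxx /cofactor -signr_odd oddD addbb expr0 mul1r.
rewrite [row' _ _](_ : _ = 1%:M) ?det1 ?mulr1 //.
apply/matrixP => a c; rewrite !mxE eq_sym (negbTE (neq_lift _ _)) fE'.
by rewrite (inj_eq lift_inj).
Qed.

Lemma rowsub_mul t s (f : 'I_t -> 'I_k) (A : 'M[R]_(k, t)) (B : 'M[R]_(t, s)) :
  rowsub f (A *m B) = rowsub f A *m B.
Proof. by apply/matrixP => a b; rewrite !mxE; apply: eq_bigr => c _; rewrite mxE. Qed.

Lemma det_rowsub_inj t (W : 'M[R]_(k, t)) f : \det (rowsub f W) != 0 -> injective f.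
Proof.
move=> h a b e; apply/eqP; apply: contraNT h => ab; apply/eqP.
by apply: (determinant_alternate ab) => c; rewrite !mxE e.
Qed.

(* The limit coordinate plane is the index set maximising the product of the |lam| among
   the nonvanishing minors: after normalising that minor to the identity block, every other
   nonzero entry is itself a minor, hence belongs to a strictly smaller eigenvalue. *)
Lemma flag_limit t (W : 'M[R]_(k, t)) f0 : \det (rowsub f0 W) != 0 ->
  exists2 f : 'I_t -> 'I_k, injective f & forall e, 0 < e ->
    exists n0, forall n, (n0 <= n)%N -> exists2 G, G \in unitmx &
      forall i b, `|(diag_pow n *m W *m G) i b - (i == f b)%:R| <= e.
Proof.
move=> hf0.
pose P (f : {ffun 'I_t -> 'I_k}) := \det (rowsub f W) != 0.
have P0 : P [ffun a => f0 a].
  by rewrite /P (_ : rowsub _ W = rowsub f0 W) //; apply/matrixP => a b; rewrite !mxE ffunE.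
have [f Pf fmax] := @finite_maximizer R _ P (fun f : {ffun _} => \prod_a `|lam (f a)|) _ P0.
exists f; first exact: det_rowsub_inj Pf.
pose G0 := invmx (rowsub f W); pose E := W *m G0.
have uG : rowsub f W \in unitmx by rewrite unitmxE unitfE.
have fE : rowsub f E = 1%:M by rewrite rowsub_mul mulmxV.
have lam_lt i b : E i b != 0 -> i != f b -> `|lam i| < `|lam (f b)|.
  move=> Eib ifb; rewrite lt_neqAle; apply/andP; split.
    by apply: contra ifb => /eqP/lam_inj ->.
  pose f' := [ffun a => if a == b then i else f a].
  have Pf' : P f'.
    rewrite /P (_ : rowsub f' W = rowsub f' E *m rowsub f W); last first.
      by rewrite -rowsub_mul -mulmxA mulVmx // mulmx1.
    rewrite det_mulmx mulf_neq0 // (_ : rowsub f' E = rowsub (fun a => if a == b then i else f a) E).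
      by rewrite det_replace_row.
    by apply/matrixP => a c; rewrite !mxE ffunE.
  have := fmax _ Pf'; rewrite (bigD1 b) //= [leRHS](bigD1 b) //= ffunE eqxx.
  rewrite [X in _ * X <= _](_ : _ = \prod_(a | a != b) `|lam (f a)|); last first.
    by apply: eq_bigr => a ab; rewrite ffunE (negbTE ab).
  by rewrite ler_pM2r // prodr_gt0 // => a _; rewrite normr_gt0.
move=> e e0.
have [|ib|n0 hn0] := @finite_common_bound ('I_k * 'I_t)%type (fun ib n0 => forall n, (n0 <= n)%N ->
   `|lam ib.1 ^+ n * E ib.1 ib.2 * (lam (f ib.2) ^+ n)^-1 - (ib.1 == f ib.2)%:R| <= e).
- by move=> x n m nm h l ml; apply: h; exact: leq_trans ml.
- case: ib => i b /=; have [ifb|ifb] := eqVneq i (f b).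
    exists 0%N => n _; rewrite ifb.
    have /matrixP/(_ b b) := fE; rewrite !mxE eqxx => ->.
    by rewrite mulr1 divff ?expf_neq0 // subrr normr0 ltW.
  have [E0|E0] := eqVneq (E i b) 0.
    by exists 0%N => n _; rewrite E0 mulr0 mul0r subrr normr0 ltW.
  have q1 := lam_lt _ _ E0 ifb.
  have [|n0 hn] := @geometric_small `|E i b| (`|lam i| / `|lam (f b)|) e _ e0.
    by rewrite divr_ge0 //= ltr_pdivrMr ?normr_gt0 // mul1r.
  exists n0 => n /hn; rewrite subr0 !normrM normfV !normrX expr_div_n.
  by rewrite mulrA [`|E i b| * _]mulrC.
- exists n0 => n nn0.
  (* The first factor normalises the chosen minor, the second cancels the growth of the rows [f b],
     which dominate their columns. *)
  exists (G0 *m diag_mx (\row_b (lam (f b) ^+ n)^-1)).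
    rewrite unitmx_mul unitmx_inv uG unitmxE det_diag unitfE.
    by apply/prodf_neq0 => b _; rewrite mxE invr_eq0 expf_neq0.
  move=> i b; have := hn0 (i, b) n nn0; rewrite /=.
  by rewrite mulmxA -(mulmxA (diag_pow n)) -/E mul_mx_diag mxE mul_diag_mx !mxE.
Qed.

(** The minor is maximised over all row maps, not only the increasing ones, so that exchanging one
    row stays within the competition; by [det_replace_row] the entries of [W] are then at most 1.
    The frame [W] lives in a compact set while [G] carries the size of [g]. *)
Lemma max_minor_normalization (t : 'I_k.+1) (g : 'M[R]_k) : g \in unitmx ->
  exists W : 'M[R]_(k, t), exists (J : multi_index t k) (G : 'M[R]_t) (f : 'I_t -> 'I_k),
  [/\ colsub (mi_fun J) g = W *m G,
      forall I' J', `|\det (mxsub (mi_fun I') (mi_fun J' : 'I_t -> 'I_k) g)| <= `|\det G|,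
      forall i b, `|W i b| <= 1 & rowsub f W = 1%:M].
Proof.
move=> ug; have tk : (t <= k)%N by rewrite -ltnS.
have /card_gt0P[J0 _] := card_multi_index_gt0 tk.
have [[f J] _ hmax] := @finite_maximizer R ({ffun 'I_t -> 'I_k} * multi_index t k)%type predT
  (fun p => `|\det (mxsub p.1 (mi_fun p.2) g)|) (sval J0, J0) isT.
pose G := mxsub f (mi_fun J) g.
have hG I' J' : `|\det (mxsub (mi_fun I') (mi_fun J' : 'I_t -> 'I_k) g)| <= `|\det G|.
  exact: hmax (sval I', J') isT.
have uG : G \in unitmx.
  (* If the maximal minor vanished, all minors would, and the invertible matrix [extpow t g] would
     have norm 0. *)
  rewrite unitmxE unitfE; apply/eqP => G0.
  have := @extpow_le_minors R t k g 0; rewrite mulr0 leNgt => h.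
  suff : ~~ true by [].
  rewrite -[X in ~~ X](@opnorm_unit_gt0 R _ (extpow t g)); last exact: extpow_unit.
    by apply: h => I' J'; have := hG I' J'; rewrite G0 normr0.
  exact: card_multi_index_gt0.
exists (colsub (mi_fun J) g *m invmx G), J, G, f.
have fW : rowsub f (colsub (mi_fun J) g *m invmx G) = 1%:M.
  rewrite rowsub_mul (_ : rowsub f _ = G) ?mulmxV //.
  by apply/matrixP => a b; rewrite !mxE.
split => //; first by rewrite -mulmxA mulVmx // mulmx1.
move=> i b; rewrite -(det_replace_row i b fW) rowsub_mul det_mulmx normrM det_inv normfV.
rewrite ler_pdivrMr ?normr_gt0 -?unitfE -?unitmxE // mul1r.
have := hmax ([ffun a => if a == b then i else f a], J) isT; rewrite /=.
rewrite (_ : mxsub _ _ g = rowsub (fun a => if a == b then i else f a) (colsub (mi_fun J) g)) //.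
by apply/matrixP => a c; rewrite !mxE ffunE.
Qed.

Variable Psi : 'M[R]_k.
Hypothesis Psi_minors : forall t (I J : multi_index t k),
  \det (mxsub (mi_fun I) (mi_fun J) Psi) != 0.

Lemma det_mxsub_inj_neq0 t (f f' : 'I_t -> 'I_k) : injective f -> injective f' ->
  \det (mxsub f f' Psi) != 0.
Proof.
move=> /inj_mi_fun[I [s hI]] /inj_mi_fun[J [s' hJ]].
have -> : mxsub f f' Psi = perm_mx s *m mxsub (mi_fun I) (mi_fun J) Psi *m (perm_mx s')^T.
  rewrite tr_perm_mx -row_permE -col_permE.
  by apply/matrixP => a b; rewrite !mxE hI hJ.
rewrite !det_mulmx det_tr !det_perm !mulf_neq0 ?Psi_minors // expf_neq0 //;
  by rewrite oppr_eq0 oner_eq0.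
Qed.

Variable kappa : nat -> R.
Hypothesis kappa0 : forall e, 0 < e -> exists n0, forall n, (n0 <= n)%N -> kappa n <= e.

Let close n (psi : 'M[R]_k) := forall i j, `|psi i j - Psi i j| <= kappa n.

(** By [flag_limit], applied to [W] and to the transpose of [F], large powers carry both frames to
    coordinate planes [f1] and [f2]. After normalisation the determinant is close to the minor of
    [Psi] on these planes, which is nonzero. The bound [d] depends on [n] but not on [psi]. *)
Lemma twisted_minor_lower_bound t (F : 'M[R]_(t, k)) (W : 'M[R]_(k, t)) f f' :
  \det (rowsub f W) != 0 -> \det (rowsub f' F^T) != 0 ->
  exists n0, forall n, (n0 <= n)%N -> exists2 d, 0 < d &
    forall psi, close n psi ->
      d <= `|\det (F *m (diag_pow n *m psi *m diag_pow n) *m W)|.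
Proof.
move=> /flag_limit[f1 f1i h1] /flag_limit[f2 f2i h2].
(* The limiting value; half of it survives once the normalised frames, and [psi], are close enough
   to their limits. *)
pose D := `|\det (mxsub f2 f1 Psi)|.
have D0 : 0 < D by rewrite normr_gt0 det_mxsub_inj_neq0.
have K1 : 1 <= opnorm Psi + 2.
  by rewrite (le_trans (_ : 1 <= 2)) ?ler1n // lerDr opnorm_ge0.
have [|d d0 hd] := @det_mulmx3_uniform_continuous R t k (opnorm Psi + 2) (D / 2) K1.
  exact: divr_gt0.
pose e := Num.min d 1.
have e0 : 0 < e by rewrite lt_min d0 ltr01.
have ed : e <= d by rewrite ge_min lexx.
have e1 : e <= 1 by rewrite ge_min lexx orbT.
have [n1 {}h1] := h1 e e0; have [n2 {}h2] := h2 e e0; have [n3 h3] := kappa0 e0.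
exists (n1 + n2 + n3)%N => n hn.
have [|G uG hG] := h1 n; first by apply: leq_trans hn; rewrite -addnA leq_addr.
have [|G' uG' hG'] := h2 n; first by apply: leq_trans hn; rewrite addnAC leq_addl.
have {}h3 := h3 n (leq_trans (leq_addl _ _) hn).
have dG : 0 < `|\det G'| * `|\det G|.
  by rewrite mulr_gt0 // normr_gt0 -unitfE -unitmxE.
exists (D / 2 / (`|\det G'| * `|\det G|)); first by rewrite !divr_gt0.
move=> psi hpsi; rewrite ler_pdivrMr //.
pose F1 := (diag_pow n *m F^T *m G')^T; pose E1 := diag_pow n *m W *m G.
pose F0 : 'M[R]_(t, k) := \matrix_(a, i) (i == f2 a)%:R.
pose E0 : 'M[R]_(k, t) := \matrix_(i, b) (i == f1 b)%:R.
have -> : `|\det (F *m (diag_pow n *m psi *m diag_pow n) *m W)| * (`|\det G'| * `|\det G|)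
   = `|\det (F1 *m psi *m E1)|.
  rewrite /F1 !trmx_mul trmxK tr_diag_mx /E1 -[\det G']det_tr -!normrM; congr (`| _ |).
  by rewrite mulrCA -!det_mulmx /diag_pow !mulmxA.
have eq0 : F0 *m Psi *m E0 = mxsub f2 f1 Psi.
  apply/matrixP => a b; rewrite !mxE (bigD1 (f1 b)) //= [X in _ + X]big1 ?addr0; last first.
    by move=> j jb; rewrite [E0 _ _]mxE (negbTE jb) mulr0.
  rewrite !mxE eqxx mulr1 (bigD1 (f2 a)) //= big1 ?addr0; last first.
    by move=> j jb; rewrite [F0 _ _]mxE (negbTE jb) mul0r.
  by rewrite mxE eqxx mul1r.
have b01 (b : bool) : `|b%:R| <= 1 :> R by case: b; rewrite ?normr1 ?normr0.
have near2 (x : R) (b : bool) : `|x - b%:R| <= e ->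
    `|x| <= opnorm Psi + 2 /\ `|b%:R : R| <= opnorm Psi + 2.
  move=> hx; split.
    rewrite -[x](subrK b%:R); apply: le_trans (ler_normD _ _) _.
    rewrite (le_trans (lerD (le_trans hx e1) (b01 b))) // lerDr opnorm_ge0 //.
  exact: le_trans (b01 b) K1.
have := hd F1 F0 psi Psi E1 E0; rewrite eq0 => /(_ _ _ _ _ _ _)/wrap[].
- by move=> a i; rewrite [F0 _ _]mxE; apply: near2; rewrite mxE.
- move=> i j; split; last first.
    by rewrite (le_trans (opnorm_entry _ _ _)) // lerDl.
  rewrite -[psi i j](subrK (Psi i j)); apply: le_trans (ler_normD _ _) _.
  rewrite addrC lerD ?opnorm_entry // (le_trans (hpsi i j)) // (le_trans h3) //.
  by rewrite (le_trans e1) // ler1n.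
- by move=> i b; rewrite [E0 _ _]mxE; apply: near2.
- by move=> a i; rewrite !mxE (le_trans _ ed) //; have := hG' i a; rewrite !mxE.
- by move=> i j; rewrite (le_trans (hpsi i j)) // (le_trans h3).
- by move=> i b; rewrite [E0 _ _]mxE (le_trans (hG i b)).
set x := \det (F1 *m psi *m E1) => hx.
have : D <= D / 2 + `|x|.
  rewrite {1}/D -[\det (mxsub f2 f1 Psi)](subrK x).
  by apply: le_trans (ler_normD _ _) _; rewrite distrC lerD.
by rewrite -lerBlDl {1}[D]splitr addrK.
Qed.

End Proximality.

Section UniformTwisting.
Context {R : realType} {k : nat}.
Variable lam : 'I_k -> R.
Hypothesis lam_inj : injective (fun i => `|lam i|).
Hypothesis lam_neq0 : forall i, lam i != 0.
Variable Psi : 'M[R]_k.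
Hypothesis Psi_minors : forall t (I J : multi_index t k),
  \det (mxsub (mi_fun I) (mi_fun J) Psi) != 0.
Variable kappa : nat -> R.
Hypothesis kappa0 : forall e, 0 < e -> exists n0, forall n, (n0 <= n)%N -> kappa n <= e.

Let close n (psi : 'M[R]_k) := forall i j, `|psi i j - Psi i j| <= kappa n.
Let mid n psi := diag_pow lam n *m psi *m diag_pow lam n.

Let normal_form (t : 'I_k.+1) (g : 'M[R]_k) (W : 'M[R]_(k, t)) :=
  exists (J : multi_index t k) (G : 'M[R]_t) (f : 'I_t -> 'I_k),
  [/\ colsub (mi_fun J) g = W *m G,
      forall I' J', `|\det (mxsub (mi_fun I') (mi_fun J' : 'I_t -> 'I_k) g)| <= `|\det G|,
      forall i b, `|W i b| <= 1 & rowsub f W = 1%:M].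

(** The minor of [h *m M *m g] on [I] and [J] factors into the twisted minor of the normal forms and
    the two maximal minors. Each norm on the right is at most the squared number of multi-indices
    times a maximal minor, whence the fourth power. *)
Let det_le_extpow (t : 'I_k.+1) (h g M : 'M[R]_k) (V W : 'M[R]_(k, t)) (c d : R) :
  g \in unitmx -> h \in unitmx ->
  normal_form g W -> normal_form h^T V -> d <= `|\det (V^T *m M *m W)| ->
  opnorm (extpow t (h *m M *m g)) < c * (opnorm (extpow t h) * opnorm (extpow t g)) ->
  0 < c -> d <= c * #|multi_index t k|%:R ^+ 4.
Proof.
move=> ug uh [J [G [f [eJ hJ _ _]]]] [I [G' [f' [eI hI _ _]]]] hd hlt c0.
have pos (a : 'M[R]_k) : a \in unitmx -> 0 < opnorm (extpow t a).
  move=> ua; apply: opnorm_unit_gt0; last exact: extpow_unit.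
  by apply: card_multi_index_gt0; rewrite -ltnS.
have hg : opnorm (extpow t g) <= #|multi_index t k|%:R ^+ 2 * `|\det G|.
  exact: extpow_le_minors.
have hh : opnorm (extpow t h) <= #|multi_index t k|%:R ^+ 2 * `|\det G'|.
  apply: extpow_le_minors => I' J'; apply: le_trans (hI J' I').
  by rewrite -trmx_mxsub det_tr.
have eq : mxsub (mi_fun I) (mi_fun J) (h *m M *m g) = G'^T *m (V^T *m M *m W) *m G.
  have -> : mxsub (mi_fun I) (mi_fun J) (h *m M *m g) =
     (colsub (mi_fun I) h^T)^T *m M *m colsub (mi_fun J) g.
    apply/matrixP => a b; rewrite !mxE; apply: eq_bigr => x _; rewrite !mxE.
    by congr (_ * _); apply: eq_bigr => y _; rewrite !mxE.
  by rewrite eI eJ trmx_mul !mulmxA.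
have := minor_le_extpow (h *m M *m g) I J; rewrite eq !det_mulmx det_tr !normrM => low.
have G0 : 0 < `|\det G'| * `|\det G|.
  have := lt_le_trans (pos g ug) hg; have := lt_le_trans (pos h uh) hh.
  have c2 : 0 <= #|multi_index t k|%:R ^+ 2 :> R by rewrite exprn_ge0.
  move=> p1 p2; rewrite mulr_gt0 // lt_def normr_ge0 andbT; apply/eqP => z.
    by move: p1; rewrite z mulr0 ltxx.
  by move: p2; rewrite z mulr0 ltxx.
rewrite -(ler_pM2r G0).
have h1 : d * (`|\det G'| * `|\det G|) <= opnorm (extpow t (h *m M *m g)).
  apply: le_trans low; rewrite mulrAC [leRHS]mulrC.
  by rewrite ler_wpM2r // ltW.
apply: le_trans h1 _; apply: le_trans (ltW hlt) _.
rewrite -mulrA ler_wpM2l ?(ltW c0) //.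
apply: le_trans (ler_pM _ _ hh hg) _; rewrite ?opnorm_ge0 //.
by rewrite le_eqVlt; apply/orP; left; apply/eqP; ring.
Qed.

(** Otherwise there are pairs [(g, h)] that fail for every [n] from [nmin] up to [m], with constant
    [m.+1%:R^-1]. Their normal forms cluster, the limit frames satisfy [twisted_minor_lower_bound]
    for one [n] and all [t], and continuity contradicts the failure for large [m]. The order of the
    quantifiers matters: [n] is chosen before [psi], which later depends on it, and serves all
    exterior powers at once. *)
Lemma uniform_twisting nmin : exists2 c, 0 < c & exists nmax,
  forall g h : 'M[R]_k, g \in unitmx -> h \in unitmx ->
  exists2 n, (nmin <= n <= nmax)%N & forall psi, close n psi ->
  forall t : 'I_k.+1, c * (opnorm (extpow t h) * opnorm (extpow t g)) <=
    opnorm (extpow t (h *m mid n psi *m g)).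
Proof.
apply: contrapT => H.
have /choice[gh hgh] : forall m : nat, exists gh : 'M[R]_k * 'M[R]_k,
   [/\ gh.1 \in unitmx, gh.2 \in unitmx & forall n, (nmin <= n <= m)%N ->
   exists psi, close n psi /\ exists t : 'I_k.+1,
     opnorm (extpow t (gh.2 *m mid n psi *m gh.1)) <
     m.+1%:R^-1 * (opnorm (extpow t gh.2) * opnorm (extpow t gh.1))].
  move=> m; apply: contrapT => hm; apply: H; exists m.+1%:R^-1; first by rewrite invr_gt0.
  exists m => g h ug uh; apply: contrapT => hn; apply: hm; exists (g, h); split => // n hn'.
  apply: contrapT => hc; apply: hn; exists n => // psi hpsi t; rewrite leNgt; apply/negP => hlt.
  by apply: hc; exists psi; split => //; exists t.
have ug m : (gh m).1 \in unitmx by have [] := hgh m.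
have uh m : (gh m).2 \in unitmx by have [] := hgh m.
have uhT m : (gh m).2^T \in unitmx by rewrite unitmx_tr.
have exW m (t : 'I_k.+1) : {W : 'M[R]_(k, t) | normal_form (gh m).1 W}.
  by apply: cid; exact: max_minor_normalization.
have exV m (t : 'I_k.+1) : {V : 'M[R]_(k, t) | normal_form (gh m).2^T V}.
  by apply: cid; exact: max_minor_normalization.
(* All entries of the frames of all ranks, for both matrices, so that a single cluster point handles
   every [t] simultaneously. *)
pose X : finType := {t : 'I_k.+1 & ('I_k * 'I_t)%type}.
pose u m (x : X + X) : R := match x with
  | inl y => sval (exW m (tag y)) (tagged y).1 (tagged y).2
  | inr y => sval (exV m (tag y)) (tagged y).1 (tagged y).2 end.
have u1 m x : `|u m x| <= 1.
  by case: x => y; [have [J [G [f [_ _ hW _]]]] := svalP (exW m (tag y)) |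
    have [J [G [f [_ _ hW _]]]] := svalP (exV m (tag y))]; exact: hW.
have [l [l1 hl]] := bounded_cluster u1.
pose pt (t : 'I_k.+1) (i : 'I_k) (b : 'I_t) : X := Tagged (fun t : 'I_k.+1 => ('I_k * 'I_t)%type) (i, b).
pose W (t : 'I_k.+1) : 'M[R]_(k, t) := \matrix_(i < k, b < t) l (inl (pt t i b)).
pose V (t : 'I_k.+1) : 'M[R]_(k, t) := \matrix_(i < k, b < t) l (inr (pt t i b)).
(* Each normal form has an identity block, hence a minor equal to 1; its position varies with [m],
   but a close enough normal form gives a nonzero minor of the limit. *)
have lim_minor (t : 'I_k.+1) (Y : 'M[R]_(k, t)) (Ym : nat -> 'M[R]_(k, t)) :
    (forall i b, `|Y i b| <= 1) -> (forall m i b, `|Ym m i b| <= 1) ->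
    (forall m, exists f, rowsub f (Ym m) = 1%:M) ->
    (forall e, 0 < e -> exists m, forall i b, `|Ym m i b - Y i b| <= e) ->
    exists f, \det (rowsub f Y) != 0.
  move=> Y1 Ym1 Ymf hY.
  have [d d0 hd] := @det_uniform_continuous R t 1 (1 / 2) (divr_gt0 ltr01 (ltr0n _ 2)).
  have [m hm] := hY d d0; have [f hf] := Ymf m; exists f.
  have := hd (rowsub f (Ym m)) (rowsub f Y).
  rewrite hf det1 => h; apply/eqP => z; move: h; rewrite z subr0 normr1 => h.
  have : 1 <= 1 / 2 :> R.
    apply: h => i j; rewrite ?mxE //.
    + by case: (i == j); rewrite ?normr1 ?normr0.
    + have := hm (f i) j; have /matrixP/(_ i j) := hf; rewrite mxE => ->.
      by rewrite mxE.
  lra.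
have Wmin t : exists f, \det (rowsub f (W t)) != 0.
  apply: (@lim_minor t (W t) (fun m => sval (exW m t))).
  - by move=> i b; rewrite mxE.
  - by move=> m i b; have := u1 m (inl (pt t i b)).
  - by move=> m; case: (exW m t) => Z [J [G [f []]]]; exists f.
  - move=> e e0; have [m _ hm] := hl e 0%N e0; exists m => i b; rewrite mxE.
    exact: hm (inl (pt t i b)).
have Vmin t : exists f, \det (rowsub f (V t)^T^T) != 0.
  apply: (@lim_minor t (V t)^T^T (fun m => sval (exV m t))).
  - by move=> i b; rewrite trmxK mxE.
  - by move=> m i b; have := u1 m (inr (pt t i b)).
  - by move=> m; case: (exV m t) => Z [J [G [f []]]]; exists f.
  - move=> e e0; have [m _ hm] := hl e 0%N e0; exists m => i b; rewrite trmxK mxE.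
    exact: hm (inr (pt t i b)).
have [||n0 hn0] := @finite_common_bound 'I_k.+1 (fun t n0 => forall n, (n0 <= n)%N ->
   exists2 d, 0 < d & forall psi, close n psi ->
      d <= `|\det ((V t)^T *m mid n psi *m W t)|).
- by move=> x n m nm h z mz; apply: h; exact: leq_trans mz.
- move=> t; have [f hf] := Wmin t; have [f' hf'] := Vmin t.
  have [n0 hn0] := twisted_minor_lower_bound lam_inj lam_neq0 Psi_minors kappa0 hf hf'.
  by exists n0.
pose n := (n0 + nmin)%N.
have [||d d0 hd] := @finite_common_pos R 'I_k.+1 (fun t d => forall psi, close n psi ->
      d <= `|\det ((V t)^T *m mid n psi *m W t)|).
- by move=> t a b _ ab h psi hpsi; exact: le_trans ab (h psi hpsi).
- by move=> t; exact: hn0 (leq_addr _ _).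
pose K := opnorm (diag_pow lam n) * (k%:R ^+ 2 * (opnorm Psi + `|kappa n|)) *
   opnorm (diag_pow lam n) + 1.
have K1 : 1 <= K by rewrite lerDr !mulr_ge0 ?addr_ge0 ?opnorm_ge0.
have psiK psi : close n psi -> forall i j, `|mid n psi i j| <= K.
  move=> hpsi i j; apply: le_trans (opnorm_entry _ _ _) _.
  apply: (@le_trans _ _ (opnorm (diag_pow lam n) * opnorm psi * opnorm (diag_pow lam n))).
    apply: le_trans (opnormM _ _) _; rewrite ler_wpM2r ?opnorm_ge0 //; exact: opnormM.
  apply: (@le_trans _ _ (K - 1)); last by rewrite gerBl.
  rewrite /K addrK ler_wpM2r ?opnorm_ge0 // ler_wpM2l ?opnorm_ge0 //.
  apply: le_trans (opnorm_le_sum _) _.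
  have e a b : `|psi a b| <= opnorm Psi + `|kappa n|.
    rewrite -[psi a b](subrK (Psi a b)) addrC; apply: le_trans (ler_normD _ _) _.
    by rewrite lerD ?opnorm_entry // (le_trans (hpsi a b)) ?ler_norm.
  apply: le_trans (ler_sum _ (fun I _ => ler_sum _ (fun J _ => e I J))) _.
  by rewrite !sumr_const !card_ord -mulrnA -[_ *+ (k * k)]mulr_natl natrM expr2.
have [||dd dd0 hdd] := @finite_common_pos R 'I_k.+1 (fun t dd => forall psi, close n psi ->
   forall Y Z : 'M[R]_(k, t), (forall i b, `|Y i b| <= 1 /\ `|Y i b - V t i b| <= dd) ->
     (forall i b, `|Z i b| <= 1 /\ `|Z i b - W t i b| <= dd) ->
     d / 2 <= `|\det (Y^T *m mid n psi *m Z)|).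
- move=> t a b a0 ab h psi hpsi Y Z hY hZ; apply: h => // i c.
    by split; [exact: (hY i c).1 | exact: le_trans (hY i c).2 ab].
  by split; [exact: (hZ i c).1 | exact: le_trans (hZ i c).2 ab].
- move=> t.
  have [dd dd0 hdd] := @det_mulmx3_uniform_continuous R t k K (d / 2) K1 (divr_gt0 d0 (ltr0n _ 2)).
  exists dd => // psi hpsi Y Z hY hZ.
  have := hdd Y^T (V t)^T (mid n psi) (mid n psi) Z (W t) => /(_ _ _ _ _ _ _)/wrap[].
  + by move=> a i; rewrite !mxE; split; apply: le_trans K1; [exact: (hY _ _).1 | exact: l1].
  + by move=> i j; split; exact: psiK.
  + by move=> i b; rewrite !mxE; split; apply: le_trans K1; [exact: (hZ _ _).1 | exact: l1].
  + by move=> a i; rewrite !mxE; have := (hY i a).2; rewrite !mxE.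
  + by move=> i j; rewrite subrr normr0 ltW.
  + by move=> i b; exact: (hZ _ _).2.
  set x := \det _; set y := \det ((V t)^T *m _ *m _) => hxy.
  have hy : d <= `|y| by exact: hd.
  have : `|y| <= `|x| + `|x - y|.
    by rewrite -[y in leLHS](subrK x) addrC (le_trans (ler_normD _ _)) // distrC.
  lra.
pose B := \sum_(t < k.+1) #|multi_index t k|%:R ^+ 4 : R.
(* Beyond this index the bound of [det_le_extpow] with constant [m.+1%:R^-1] falls below [d / 2]. *)
have [m0 hm0] : exists m0 : nat, 2 * B / d < m0%:R.
  by exists (Num.bound (2 * B / d)); rewrite archi_boundP // !mulr_ge0 ?sumr_ge0 ?invr_ge0 ?ltW // => t _; rewrite exprn_ge0.
have [m hm hmd] := hl dd (m0 + n)%N dd0.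
have [_ _ /(_ n)] := hgh m.
rewrite leq_addl (leq_trans (leq_addl m0 n) hm) => /(_ isT)[psi [hpsi [t hlt]]].
have := det_le_extpow (ug m) (uh m) (svalP (exW m t)) (svalP (exV m t)) _ hlt.
move=> /(_ (d / 2)) /(_ _ _)/wrap[].
- apply: hdd => // i b; split.
  + exact: u1 m (inr (pt t i b)).
  + by rewrite mxE; exact: hmd (inr (pt t i b)).
  + exact: u1 m (inl (pt t i b)).
  + by rewrite mxE; exact: hmd (inl (pt t i b)).
- by rewrite invr_gt0.
apply/negP; rewrite -ltNge ltr_pdivrMl //.
apply: (@le_lt_trans _ _ B).
  by rewrite /B (bigD1 t) //= lerDl sumr_ge0 // => s _; rewrite exprn_ge0.
move: hm0; rewrite ltr_pdivrMr // => hm0.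
have hmm : m0%:R <= m.+1%:R :> R by rewrite ler_nat (leq_trans (leq_addr n m0)) // leqW.
have : m0%:R * d <= m.+1%:R * d by rewrite ler_pM2r.
lra.
Qed.

End UniformTwisting.

(** * Points of the subshift *)

Section SubshiftPoints.
Context {N : nat} {Q : 'M[bool]_N}.
Local Notation Sigma := (subshift Q).
Implicit Types x y z : Sigma.

Lemma subshift_ext x y : (forall i, symbol x i = symbol y i) -> x = y.
Proof.
case: x y => [x hx] [y hy] h; have e : x = y by exact/funext.
by move: hx hy h; rewrite e => hx hy _; congr exist; exact: Prop_irrelevance.
Qed.

Lemma symbol_shift n x i : symbol (sigma_shift n x) i = symbol x (i + n).
Proof. by []. Qed.

Lemma sigma_shiftD a b x : sigma_shift a (sigma_shift b x) = sigma_shift (a + b) x.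
Proof. by apply: subshift_ext => i; rewrite !symbol_shift addrA. Qed.

Lemma sigma_shift0 x : sigma_shift 0 x = x.
Proof. by apply: subshift_ext => i; rewrite symbol_shift addr0. Qed.

(** Admissibility only involves adjacent symbols, so two points can be exchanged at any coordinate
    where they coincide. *)
Lemma splice (i0 : int) x y : symbol x i0 = symbol y i0 ->
  exists z, (forall i, i <= i0 -> symbol z i = symbol x i) /\
            (forall i, i0 <= i -> symbol z i = symbol y i).
Proof.
move=> e; pose f (i : int) := if i <= i0 then symbol x i else symbol y i.
have fQ i : Q (f i) (f (i + 1)).
  rewrite /f; case: (ltrgtP i i0) => [lt|gt|->].
  - have -> : (i + 1 <= i0) = true by lia.
    exact: (svalP x).
  - have -> : (i + 1 <= i0) = false by lia.
    exact: (svalP y).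
  - have -> : (i0 + 1 <= i0) = false by lia.
    by rewrite e; exact: (svalP y).
exists (exist _ f fQ); split=> i hi; rewrite /symbol /= /f; first by rewrite hi.
by case: ifP => // hi'; have -> : i = i0 by lia.
Qed.

Lemma pigeonhole_infinite (T : finType) (S : set nat) (f : nat -> T) :
  (forall n0, exists2 n, (n0 <= n)%N & S n) ->
  exists c, forall n0, exists2 n, (n0 <= n)%N & S n /\ f n = c.
Proof.
move=> hS; apply: contrapT => h.
have [||n0 hn0] := @finite_common_bound T (fun c n0 => forall n, (n0 <= n)%N -> ~ (S n /\ f n = c)).
- by move=> c n m nm hn l ml; apply: hn; exact: leq_trans ml.
- move=> c; apply: contrapT => hc; apply: h; exists c => n0; apply: contrapT => hn.
  by apply: hc; exists n0 => n nn0 hSf; apply: hn; exists n.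
- by have [n nn0 Sn] := hS n0; exact: hn0 _ _ nn0 (conj Sn erefl).
Qed.

(** Diagonal extraction: [S m.+1] is an infinite subset of [S m] along which the symbols at the
    coordinates of absolute value at most [m] are constant. *)
Lemma subshift_cluster (u : nat -> Sigma) :
  exists x, forall m n0, exists2 n, (n0 <= n)%N & agree (u n) x m.
Proof.
pose inf (S : set nat) := forall n0, exists2 n, (n0 <= n)%N & S n.
pose win m n := [ffun i : 'I_(2 * m).+1 => symbol (u n) ((i : nat)%:Z - m%:Z)].
have /choice[next hnext] : forall p : nat * set nat, exists S' : set nat, inf p.2 ->
   [/\ inf S', S' `<=` p.2 & forall n n', S' n -> S' n' -> win p.1 n = win p.1 n'].
  move=> [m S] /=; have [iS|nS] := pselect (inf S); last by exists set0.
  have [c hc] := @pigeonhole_infinite _ S (win m) iS.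
  exists [set n | S n /\ win m n = c] => _; split.
  - by [].
  - by move=> n [].
  - by move=> n n' [_ ->] [_ ->].
pose fix S m := if m is m'.+1 then next (m', S m') else setT.
have iS m : inf (S m).
  elim: m => [|m IH] /=; first by move=> n0; exists n0.
  by have [] := hnext (m, S m) IH.
have subS m m' : (m <= m')%N -> S m' `<=` S m.
  elim: m' => [|m' IH]; first by rewrite leqn0 => /eqP ->.
  rewrite leq_eqVlt => /orP[/eqP ->//|]; rewrite ltnS => /IH h.
  by apply: subset_trans h; have [] := hnext (m', S m') (iS m').
have wS m n n' (i : int) : S m n -> S m n' -> (`|i|%N < m)%N -> symbol (u n) i = symbol (u n') i.
  case: m => [//|m] /= Sn Sn' im.
  have [_ _ /(_ n n' Sn Sn')/ffunP h] := hnext (m, S m) (iS m).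
  have hi : (absz (i + m%:Z)%R < (2 * m).+1)%N by lia.
  have := h (Ordinal hi); rewrite !ffunE /=.
  by have -> : (absz (i + m%:Z)%R)%:Z - m%:Z = i by lia.
have /choice[pt hpt] : forall m, exists n, S m n.
  by move=> m; have [n _ Sn] := iS m 0%N; exists n.
pose f (i : int) := symbol (u (pt (absz i).+1)) i.
have fE m n i : S m n -> (`|i|%N < m)%N -> f i = symbol (u n) i.
  move=> Sn im; apply: (wS (absz i).+1) => //; exact: subS Sn.
have fQ i : Q (f i) (f (i + 1)).
  pose m := (absz i + absz (i + 1)%R).+1.
  rewrite (fE m (pt m)) ?(fE m (pt m)) //; try (by rewrite /m; lia).
  exact: (svalP (u (pt m))).
exists (exist _ f fQ) => m n0; have [n nn0 Sn] := iS m n0; exists n => // i im.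
by rewrite [RHS](_ : _ = f i) // (fE m n).
Qed.

(** Compactness as a uniformity principle: counterexamples for larger and larger [n] would cluster
    at a point near which some bound holds. *)
Lemma subshift_compact (P : Sigma -> nat -> Prop) :
  (forall x n m, (n <= m)%N -> P x n -> P x m) ->
  (forall x, exists n m, forall y, agree y x m -> P y n) ->
  exists n, forall x, P x n.
Proof.
move=> mono loc; apply: contrapT => h.
have /choice[u hu] : forall n, exists x, ~ P x n.
  move=> n; apply: contrapT => hn; apply: h; exists n => x; apply: contrapT => hx.
  by apply: hn; exists x.
have [x hx] := subshift_cluster u; have [n [m hm]] := loc x.
have [n' nn' ag] := hx m n; apply: (hu n'); apply: mono nn' _; exact: hm.
Qed.

Context {R : realType} (omega : R).
Hypothesis homega : 0 < omega < 1.

Lemma dist_agree x y m : agree x y m -> dist omega x y <= omega ^+ m.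
Proof.
have /andP[w0 w1] := homega; move=> ag; rewrite /dist; case: ifPn => [_|/asboolP xy].
  by rewrite exprn_ge0 // ltW.
have [i hi] : exists i, symbol x i <> symbol y i.
  apply: contrapT => h; apply: xy; apply: subshift_ext => i.
  by apply: contrapT => hi; apply: h; exists i.
have bd m' : agree x y m' -> (m' <= absz i)%N.
  by move=> h; rewrite leqNgt; apply/negP => /h.
have ex : exists m', `[< agree x y m' >] by exists m; exact/asboolP.
have ub m' : `[< agree x y m' >] -> (m' <= absz i)%N by move/asboolP/bd.
have [M /asboolP agM maxM] := ex_maxnP ex ub.
have mM : max_agree x y M by split => // m' /asboolP; exact: maxM.
have [agX mX] := xgetPex 0%N (ex_intro _ M mM).
by rewrite ler_wiXn2l ?(ltW w0) ?(ltW w1) //; exact: mX.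
Qed.

Lemma dist_lt1 x y : dist omega x y < 1 -> symbol x 0 = symbol y 0.
Proof.
rewrite /dist; case: ifPn => [/asboolP -> //|_].
have [->|] := eqVneq (xget 0%N (max_agree x y)) 0%N; first by rewrite expr0 ltxx.
by case: xgetP => [M _ [agM _] M0 _|]; [apply: agM; rewrite lt0n | rewrite eqxx].
Qed.

Lemma dist_ge0 x y : 0 <= dist omega x y.
Proof.
have /andP[w0 w1] := homega.
by rewrite /dist; case: ifP => // _; rewrite exprn_ge0 // ltW.
Qed.

(** Mixing is applied to the cylinders of one symbol at coordinate 0. There are finitely many pairs
    of symbols, hence a common length; the connecting point is then spliced to the past of [x] and
    the future of [y]. *)
Lemma mixing_connection : topologically_mixing (Q := Q) omega ->
  exists2 L : nat, (0 < L)%N & forall x y, exists z,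
    (forall i : int, i <= 0 -> symbol z i = symbol x i) /\
    (forall i : int, L%:Z <= i -> symbol z i = symbol y (i - L%:Z)).
Proof.
move=> mix; pose U a : set Sigma := [set x | symbol x 0 = a].
have opU a : dopen omega (U a).
  by move=> x xa; exists 1 => // y /dist_lt1 xy; rewrite /U /= -xy.
have [||L hL] := @finite_common_bound ('I_N * 'I_N)%type (fun ab n0 => forall n, (n0 <= n)%N ->
   (exists x : Sigma, symbol x 0 = ab.1) -> (exists y : Sigma, symbol y 0 = ab.2) ->
   exists w : Sigma, symbol w 0 = ab.1 /\ symbol w n%:Z = ab.2).
- by move=> ab n m nm h l ml; apply: h; exact: leq_trans ml.
- move=> [a b] /=; have [ea|na] := pselect (exists x : Sigma, symbol x 0 = a); last by exists 0%N.
  have [eb|nb] := pselect (exists x : Sigma, symbol x 0 = b); last by exists 0%N.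
  have [n0 h] := mix (U a) (U b) (opU a) (opU b) ea eb.
  exists n0 => n nn _ _; have [v [[w wa hw] vb]] := h n nn.
  by exists w; split => //; move: vb; rewrite -hw /U /mkset symbol_shift add0r.
exists L.+1 => // x y.
have [|||w [wx wy]] := hL (symbol x 0, symbol y 0) L.+1; first exact: leqnSn.
- by exists x.
- by exists y.
have [z1 [h1 h1']] := @splice 0 x w (esym wx).
have [|z [h2 h2']] := @splice L.+1%:Z z1 (sigma_shift (- L.+1%:Z) y).
  by rewrite symbol_shift subrr h1' //= wy.
exists z; split=> i hi; first by rewrite h2 ?h1 //; lia.
by rewrite h2' // symbol_shift.
Qed.

End SubshiftPoints.

(** * Holonomies of fiber bunched cocycles *)

Section InverseLimits.
Context {R : realType} {k : nat}.
Implicit Types X Y : 'M[R]_k.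

Lemma inv_mulmx X Y : X \in unitmx -> Y \in unitmx ->
  invmx (X *m Y) = invmx Y *m invmx X.
Proof.
move=> uX uY; have uXY : X *m Y \in unitmx by rewrite unitmx_mul uX.
rewrite -[RHS](mulmxK uXY) !mulmxA mulmxKV // -!mulmxA.
by rewrite (mulmxA _ Y) mulVmx // mul1mx.
Qed.

(** Used to pass identities to the limit: a difference bounded by every term of a geometric sequence
    vanishes. *)
Lemma opnorm_geometric_eq0 X (C q : R) : 0 <= q < 1 ->
  (forall n, opnorm X <= C * q ^+ n) -> X = 0.
Proof.
move=> hq h; apply/matrixP => i j; rewrite mxE; apply/eqP; rewrite -normr_le0.
apply: le_trans (opnorm_entry X i j) _; rewrite leNgt; apply/negP => X0.
have [n0 hn0] := @geometric_small R C q (opnorm X / 2) hq (divr_gt0 X0 (ltr0n _ 2)).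
have := hn0 _ (leqnn n0); have := h n0; lra.
Qed.

(** The limit is taken in the entrywise topology; the estimate returns to the operator norm, which
    is at most the sum of the [k ^ 2] entries. *)
Lemma opnorm_cauchy_lim (D : nat -> 'M[R]_k) (C q : R) : 0 <= q < 1 ->
  (forall n m, opnorm (D (n + m)%N - D n) <= C * q ^+ n) ->
  forall n, opnorm (limn D - D n) <= C * q ^+ n.
Proof.
move=> hq hD n.
have cD : cvgn D.
  apply/cauchy_cvgP/cauchy_exP => e e0.
  have [n0 hn0] := @geometric_small R C q (e / 2) hq (divr_gt0 e0 (ltr0n _ 2)).
  exists (D n0), n0 => // m /= nm; split => // i j.
  rewrite /ball /= distrC.
  have := opnorm_entry (D m - D n0) i j; rewrite !mxE.
  have := hD n0 (m - n0)%N; rewrite subnKC // => h1 h2.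
  have := hn0 n0 (leqnn _); lra.
apply/ler_addgt0Pl => e e0.
have e1 : 0 < e / (k%:R ^+ 2 + 1) by rewrite divr_gt0 // ltr_wpDl.
have [m0 _ hm0] := cD _ (nbhsx_ballx (limn D) _ e1).
have := hm0 (n + m0)%N (leq_addl _ _) => -[_ hb].
have -> : limn D - D n = (limn D - D (n + m0)%N) + (D (n + m0)%N - D n).
  by rewrite addrA subrK.
apply: le_trans (opnormD _ _) _; rewrite lerD //.
apply: le_trans (opnorm_le_sum _) _.
have h i j : `|(limn D - D (n + m0)%N) i j| <= e / (k%:R ^+ 2 + 1).
  by have := hb i j; rewrite /ball /= !mxE => /ltW.
apply: le_trans (ler_sum _ (fun i _ => ler_sum _ (fun j _ => h i j))) _.
rewrite !sumr_const card_ord -mulrnA -[_ *+ (k * k)]mulr_natl natrM -expr2.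
by rewrite mulrA ler_pdivrMr ?ltr_wpDl // mulrC ler_wpM2l ?lerDl // ltW.
Qed.

End InverseLimits.

Section ComparableProducts.
Context {R : realType} {k : nat}.
Implicit Types b c : nat -> 'M[R]_k.

(** Arbitrary factors are allowed so that stable holonomies, with factors along the future, and
    unstable ones, with inverse factors along the past, are instances of the same construction. *)
Fixpoint iter_mulmx b n : 'M[R]_k := if n is m.+1 then b m *m iter_mulmx b m else 1%:M.

Lemma iter_mulmxD b n m :
  iter_mulmx b (n + m) = iter_mulmx (fun j => b (n + j)%N) m *m iter_mulmx b n.
Proof.
elim: m => [|m IH]; first by rewrite addn0 mul1mx.
by rewrite addnS /= IH mulmxA.
Qed.

Lemma iter_mulmx_unit b n : (forall j, b j \in unitmx) -> iter_mulmx b n \in unitmx.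
Proof. by move=> ub; elim: n => [|n IH] /=; rewrite ?unitmx1 // unitmx_mul ub. Qed.

Lemma eq_iter_mulmx b c n : b =1 c -> iter_mulmx b n = iter_mulmx c n.
Proof. by move=> e; elim: n => //= n ->; rewrite e. Qed.

Variables (K theta rho : R) (M : nat).
Hypotheses (K1 : 1 <= K) (htheta : 0 < theta < 1) (hrho : 0 < rho < 1).

Definition half_close a b c := forall j,
  [/\ b j \in unitmx, opnorm (b j) <= K, opnorm (invmx (b j)) <= K,
      (M <= j)%N -> opnorm (b j) * opnorm (invmx (c j)) * rho <= theta
    & opnorm (invmx (c j) *m b j - 1%:M) <= K * rho ^+ (a + j)].

(* [b] and [c] are the successive factors of two fiber bunched cocycles along orbits at
   distance [omega ^ (a + j)] at time [j]. *)
Definition close_factors a b c := half_close a b c /\ half_close a c b.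

Lemma close_factors_sym a b c : close_factors a b c -> close_factors a c b.
Proof. by case. Qed.

Lemma close_factors_shift a b c n : close_factors a b c ->
  close_factors (a + n) (fun j => b (n + j)%N) (fun j => c (n + j)%N).
Proof.
by case=> h1 h2; split=> j; [have [] := h1 (n + j)%N | have [] := h2 (n + j)%N];
  move=> u x y h z; split => //; rewrite -?addnA // => Mj;
  apply: h; rewrite (leq_trans Mj) // leq_addl.
Qed.

Definition prod_ratio b c n := invmx (iter_mulmx c n) *m iter_mulmx b n.
Definition holonomy b c : 'M[R]_k := limn (prod_ratio b c).

(** The power of [K ^+ 2 / theta] pays for the first [M] factors, [K] for the distance of the
    factors in one step, and [1 / (1 - theta)] is the sum of the geometric series of the steps. *)
Definition hol_const : R := (K ^+ 2 / theta) ^+ M * K / (1 - theta).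

Let th0 : 0 < theta. Proof. by case/andP: htheta. Qed.
Let th1 : theta < 1. Proof. by case/andP: htheta. Qed.
Let K0 : 0 < K. Proof. exact: lt_le_trans K1. Qed.

Let Kth : 1 <= K ^+ 2 / theta.
Proof.
rewrite ler_pdivlMr // mul1r (le_trans (ltW th1)) //.
by rewrite expr_ge1 // ltW.
Qed.

Lemma hol_const_gt0 : 0 < hol_const.
Proof.
by rewrite /hol_const !mulr_gt0 ?invr_gt0 ?subr_gt0 // exprn_gt0 // (lt_le_trans ltr01 Kth).
Qed.

Lemma bunching_iterate a b c n : close_factors a b c ->
  opnorm (iter_mulmx b n) * opnorm (invmx (iter_mulmx c n)) * rho ^+ n <=
    (K ^+ 2 / theta) ^+ M * theta ^+ n.
Proof.
have /andP[r0 r1] := hrho.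
move=> [hb hc]; have uc j : c j \in unitmx by have [] := hc j.
(* The exponent [minn n M] counts the steps in which the factor [theta] is replaced by [K ^+ 2];
   this is the form that passes through the induction. *)
apply: (@le_trans _ _ ((K ^+ 2 / theta) ^+ (minn n M) * theta ^+ n)); last first.
  by rewrite ler_wpM2r ?exprn_ge0 ?(ltW th0) // ler_weXn2l // geq_minr.
elim: n => [|n IH] /=.
  rewrite min0n !expr0 !mulr1 invmx1 mulr_ile1 ?opnorm_ge0 //; exact: opnorm1_le.
rewrite inv_mulmx ?iter_mulmx_unit //.
have [_ bK _ hM _] := hb n; have [_ _ cK _ _] := hc n.
set x := opnorm (iter_mulmx b n) in IH *; set y := opnorm (invmx (iter_mulmx c n)) in IH *.
apply: (@le_trans _ _ ((opnorm (b n) * opnorm (invmx (c n)) * rho) * (x * y * rho ^+ n))).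
  apply: (@le_trans _ _ ((opnorm (b n) * x) * (y * opnorm (invmx (c n))) * rho ^+ n.+1)).
    by rewrite ler_wpM2r ?exprn_ge0 ?(ltW r0) // ler_pM ?opnorm_ge0 ?opnormM.
  rewrite [rho ^+ n.+1]exprS; move: (opnorm (b n)) (opnorm (invmx (c n))) => u v.
  by rewrite le_eqVlt; apply/orP; left; apply/eqP; ring.
have p1 : 0 <= opnorm (b n) * opnorm (invmx (c n)) * rho.
  by rewrite !mulr_ge0 ?opnorm_ge0 // ltW.
have p2 : 0 <= x * y * rho ^+ n by rewrite !mulr_ge0 ?opnorm_ge0 ?exprn_ge0 // ltW.
have [Mn|nM] := leqP M n.
  apply: le_trans (ler_pM p1 p2 (hM Mn) IH) _.
  by rewrite (minn_idPr (leqW Mn)) (minn_idPr Mn) [theta ^+ n.+1]exprS mulrCA.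
have hK : opnorm (b n) * opnorm (invmx (c n)) * rho <= K ^+ 2.
  rewrite -[leRHS]mulr1 expr2 ler_pM ?mulr_ge0 ?opnorm_ge0 ?(ltW r0) ?(ltW r1) //.
  by rewrite ler_pM ?opnorm_ge0.
apply: le_trans (ler_pM p1 p2 hK IH) _.
rewrite (minn_idPl nM) (minn_idPl (ltnW nM)).
rewrite [(K ^+ 2 / theta) ^+ n.+1]exprS [theta ^+ n.+1]exprS [leRHS]mulrACA.
by rewrite divfK ?gt_eqF.
Qed.

Lemma ratio_cauchy a b c n m : close_factors a b c ->
  opnorm (prod_ratio b c (n + m) - prod_ratio b c n) <= hol_const * rho ^+ a * theta ^+ n.
Proof.
have /andP[r0 r1] := hrho.
move=> h; have [hb hc] := h; have uc j : c j \in unitmx by have [] := hc j.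
(* One step inserts [invmx (c j) *m b j - 1%:M] between two products of length [j]. Its size
   [rho ^+ (a + j)] beats the distortion of these products by [bunching_iterate]. *)
have step j : opnorm (prod_ratio b c j.+1 - prod_ratio b c j) <=
    (hol_const * (1 - theta)) * rho ^+ a * theta ^+ j.
  have -> : prod_ratio b c j.+1 - prod_ratio b c j = invmx (iter_mulmx c j) *m
     (invmx (c j) *m b j - 1%:M) *m iter_mulmx b j.
    rewrite /prod_ratio /= inv_mulmx ?iter_mulmx_unit //.
    by rewrite mulmxBr mulmxBl mulmx1 !mulmxA.
  apply: le_trans (opnormM _ _) _.
  apply: le_trans (ler_wpM2r (opnorm_ge0 _) (opnormM _ _)) _.
  have [_ _ _ _ hj] := hb j.
  apply: (@le_trans _ _ ((opnorm (iter_mulmx b j) * opnorm (invmx (iter_mulmx c j)) * rho ^+ j)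
     * (K * rho ^+ a))).
    rewrite mulrAC [leRHS](_ : _ = opnorm (invmx (iter_mulmx c j)) * opnorm (iter_mulmx b j)
      * (K * rho ^+ (a + j))); last by rewrite exprD; ring.
    by rewrite ler_wpM2l // mulr_ge0 ?opnorm_ge0.
  apply: le_trans (ler_wpM2r _ (bunching_iterate j h)) _.
    by rewrite mulr_ge0 ?exprn_ge0 // ltW.
  rewrite /hol_const divfK ?gt_eqF ?subr_gt0 //.
  by rewrite le_eqVlt; apply/orP; left; apply/eqP; ring.
have C0 : 0 <= hol_const * rho ^+ a.
  by rewrite mulr_ge0 ?exprn_ge0 ?(ltW r0) ?(ltW hol_const_gt0).
(* The partial sum of the geometric series in closed form, for which the induction on [m] closes. *)
suff : opnorm (prod_ratio b c (n + m) - prod_ratio b c n) <=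
    hol_const * rho ^+ a * (theta ^+ n - theta ^+ (n + m)).
  move=> /le_trans; apply; rewrite ler_wpM2l // gerBl exprn_ge0 // ltW //.
elim: m => [|m IH]; first by rewrite addn0 !subrr opnorm0 mulr0.
rewrite addnS -(subrK (prod_ratio b c (n + m)) (prod_ratio b c (n + m).+1)) -addrA.
apply: le_trans (opnormD _ _) _; apply: le_trans (lerD (step _) IH) _.
by rewrite exprS le_eqVlt; apply/orP; left; apply/eqP; ring.
Qed.

Lemma holonomy_ratio a b c n : close_factors a b c ->
  opnorm (holonomy b c - prod_ratio b c n) <= hol_const * rho ^+ a * theta ^+ n.
Proof.
move=> h; apply: opnorm_cauchy_lim => [|i j]; first by rewrite (ltW th0) th1.
exact: ratio_cauchy.
Qed.

Lemma ratio_near1 a b c n : close_factors a b c ->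
  opnorm (prod_ratio b c n - 1%:M) <= hol_const * rho ^+ a.
Proof.
move=> h; have := ratio_cauchy 0 n h.
by rewrite add0n expr0 mulr1 {2}/prod_ratio /= invmx1 mul1mx.
Qed.

Lemma holonomy_near1 a b c : close_factors a b c ->
  opnorm (holonomy b c - 1%:M) <= hol_const * rho ^+ a.
Proof.
move=> h; have := holonomy_ratio 0 h.
by rewrite expr0 mulr1 {1}/prod_ratio /= invmx1 mul1mx.
Qed.

Lemma close_factors_unit a b c : close_factors a b c ->
  (forall j, b j \in unitmx) /\ (forall j, c j \in unitmx).
Proof. by move=> [hb hc]; split=> j; [have [] := hb j | have [] := hc j]. Qed.

(** The identity holds exactly for the finite ratios; the geometric rate of convergence carries it
    to the limit. The same argument gives the equivariance below. *)
Lemma holonomyK a b c : close_factors a b c -> holonomy b c *m holonomy c b = 1%:M.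
Proof.
move=> h; have h' := close_factors_sym h; have [ub uc] := close_factors_unit h.
apply/eqP; rewrite -subr_eq0; apply/eqP.
pose C := hol_const * rho ^+ a; have /andP[r0 _] := hrho.
have C0 : 0 <= C by rewrite mulr_ge0 ?exprn_ge0 ?(ltW r0) ?(ltW hol_const_gt0).
apply: (@opnorm_geometric_eq0 _ _ _ (C * (1 + C) + (1 + C) * C) theta).
  by rewrite (ltW th0) th1.
move=> n.
have e : prod_ratio b c n *m prod_ratio c b n = 1%:M.
  by rewrite /prod_ratio -mulmxA mulKVmx ?mulVmx ?iter_mulmx_unit.
have -> : holonomy b c *m holonomy c b - 1%:M = (holonomy b c - prod_ratio b c n) *m holonomy c b
   + prod_ratio b c n *m (holonomy c b - prod_ratio c b n).
  by rewrite -e mulmxBl mulmxBr addrA subrK.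
apply: le_trans (opnormD _ _) _; rewrite mulrDl; apply: lerD.
  apply: le_trans (opnormM _ _) _; rewrite mulrAC ler_pM ?opnorm_ge0 //.
    exact: holonomy_ratio.
  exact/opnorm_near1/holonomy_near1.
apply: le_trans (opnormM _ _) _; rewrite -mulrA ler_pM ?opnorm_ge0 //.
  exact/opnorm_near1/ratio_near1.
exact: holonomy_ratio.
Qed.

Lemma holonomy_equivariant a b c n : close_factors a b c ->
  holonomy b c = invmx (iter_mulmx c n) *m
    holonomy (fun j => b (n + j)%N) (fun j => c (n + j)%N) *m iter_mulmx b n.
Proof.
move=> h; have h' := close_factors_shift n h; have [ub uc] := close_factors_unit h.
apply/eqP; rewrite -subr_eq0; apply/eqP.
set x := invmx (iter_mulmx c n); set y := iter_mulmx b n.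
apply: (@opnorm_geometric_eq0 _ _ _ (hol_const * rho ^+ a * theta ^+ n +
    opnorm x * (hol_const * rho ^+ (a + n)) * opnorm y) theta).
  by rewrite (ltW th0) th1.
move=> m; set H := holonomy (fun j => b (n + j)%N) (fun j => c (n + j)%N).
have e : prod_ratio b c (n + m) = x *m prod_ratio (fun j => b (n + j)%N) (fun j => c (n + j)%N) m *m y.
  rewrite /prod_ratio !iter_mulmxD inv_mulmx ?iter_mulmx_unit // /x /y.
  by rewrite !mulmxA.
have -> : holonomy b c - x *m H *m y = (holonomy b c - prod_ratio b c (n + m)) -
   x *m (H - prod_ratio (fun j => b (n + j)%N) (fun j => c (n + j)%N) m) *m y.
  by rewrite e mulmxBr mulmxBl opprB addrA subrK.
apply: le_trans (opnormD _ _) _; rewrite opnormN mulrDl; apply: lerD.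
  by rewrite -mulrA -exprD; exact: holonomy_ratio.
apply: le_trans (opnormM _ _) _; rewrite mulrAC ler_wpM2r ?opnorm_ge0 //.
apply: le_trans (opnormM _ _) _; rewrite -mulrA ler_wpM2l ?opnorm_ge0 //.
exact: holonomy_ratio.
Qed.

End ComparableProducts.

Lemma exprn_powR (R : realType) (w r : R) m : 0 <= w -> (w `^ r) ^+ m = (w ^+ m) `^ r.
Proof.
move=> w0; elim: m => [|m IH]; first by rewrite !expr0 powR1.
by rewrite !exprS IH powRM ?exprn_ge0.
Qed.

Section FiberBunchedCocycle.
Context {N : nat} {Q : 'M[bool]_N} {R : realType} {k : nat}.
Local Notation Sigma := (subshift Q).
Variables (A : Sigma -> 'M[R]_k) (omega r : R).
Hypotheses (homega : 0 < omega < 1) (hr : 0 < r) (hA : Hrb A omega r).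
Implicit Types x y : Sigma.

Let rho := omega `^ r.

Lemma rho_bounds : 0 < rho < 1.
Proof.
have /andP[w0 w1] := homega; rewrite /rho powR_gt0 //=.
have e1 : 1 `^ r = 1 :> R by rewrite powR1.
by rewrite -[ltRHS]e1 gt0_ltr_powR // nnegrE ltW.
Qed.

Lemma A_unit x : A x \in unitmx.
Proof. by case: hA. Qed.

Lemma holder_agree : exists2 C, 0 < C & forall x y m, agree x y m ->
  opnorm (A x - A y) <= C * rho ^+ m.
Proof.
have /andP[w0 w1] := homega.
have [_ [C hC] _] := hA; exists (`|C| + 1); first by rewrite ltr_wpDl.
move=> x y m xy; apply: le_trans (hC x y) _.
apply: (@le_trans _ _ ((`|C| + 1) * dist omega x y `^ r)).
  by rewrite ler_wpM2r ?powR_ge0 // (le_trans (ler_norm _)) // lerDl.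
rewrite ler_wpM2l ?addr_ge0 //.
have -> : rho ^+ m = (omega ^+ m) `^ r.
  exact/exprn_powR/ltW.
rewrite ge0_ler_powR ?nnegrE ?exprn_ge0 ?(ltW w0) ?(ltW hr) //.
  exact: dist_ge0.
exact: dist_agree.
Qed.

(** Compactness upgrades the pointwise inequality of fiber bunching to one constant [theta < 1],
    valid even for two nearby points. The candidate [1 - n.+2%:R^-1] for [theta] makes the property
    monotone in [n], as [subshift_compact] requires. *)
Lemma uniform_bunching : exists K theta M, [/\ 1 <= K, 0 < theta < 1,
    forall x, opnorm (A x) <= K /\ opnorm (invmx (A x)) <= K,
    forall x y, agree x y M -> opnorm (A x) * opnorm (invmx (A y)) * rho <= theta
  & forall x y m, agree x y m -> opnorm (A x - A y) <= K * rho ^+ m].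
Proof.
have /andP[r0 r1] := rho_bounds; have [C C0 hC] := holder_agree.
have [_ _ fb] := hA.
pose P y (n : nat) := [/\ opnorm (A y) <= n.+1%:R, opnorm (invmx (A y)) <= n.+1%:R &
  forall y', agree y' y n -> opnorm (A y') * opnorm (invmx (A y)) * rho <= 1 - n.+2%:R^-1].
have [||n hn] := @subshift_compact N Q P.
- move=> x n m nm [h1 h2 h3].
  have nm' : n.+1%:R <= m.+1%:R :> R by rewrite ler_nat.
  split; [exact: le_trans nm' | exact: le_trans nm' |] => y' ag.
  apply: le_trans (h3 _ _) _ => [i im|]; first by apply: ag; exact: leq_trans nm.
  by rewrite lerD2l lerN2 lef_pV2 ?posrE // ler_nat.
- move=> x; have := fb x; rewrite -/rho.
  set a := opnorm (A x); set b := opnorm (invmx (A x)) => fbx.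
  have a0 : 0 <= a by exact: opnorm_ge0.
  have b0 : 0 <= b by exact: opnorm_ge0.
  (* Half of the slack in the inequality at [x]; the other half absorbs the variation of [A] and of
     its inverse near [x]. *)
  pose tau := (1 - a * b * rho) / 2.
  have tau0 : 0 < tau by rewrite divr_gt0 // subr_gt0.
  pose d := Num.min (tau / (2 * (b + 1))) (1 / (2 * (b + 1))).
  have b1 : 0 < 2 * (b + 1) by rewrite mulr_gt0 // ltr_wpDl.
  have d0 : 0 < d by rewrite lt_min (divr_gt0 tau0 b1) (divr_gt0 ltr01 b1).
  have db : 2 * (d * b) <= tau.
    have : d * (2 * (b + 1)) <= tau by rewrite -ler_pdivlMr // ge_min lexx.
    have -> : d * (2 * (b + 1)) = 2 * (d * b) + 2 * d by ring.
    lra.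
  have db1 : d * b <= 1 / 2.
    have : d * (2 * (b + 1)) <= 1 by rewrite -ler_pdivlMr // ge_min lexx orbT.
    have -> : d * (2 * (b + 1)) = 2 * (d * b) + 2 * d by ring.
    lra.
  have [m hm] := @geometric_small R C rho d (introT andP (conj (ltW r0) r1)) d0.
  have dA y : agree y x m -> opnorm (A y - A x) <= d.
    by move=> /hC h; apply: le_trans h (hm m (leqnn _)).
  have bA y : agree y x m -> opnorm (A y) <= a + d.
    move=> /dA h; rewrite -[A y](subrK (A x)) addrC; apply: le_trans (opnormD _ _) _.
    by rewrite lerD2l.
  (* The resolvent identity for the two inverses, solved for the norm of the inverse at [y]. *)
  have bI y : agree y x m -> opnorm (invmx (A y)) * (1 - d * b) <= b.
    move=> ag; rewrite mulrBr mulr1 lerBlDr.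
    have -> : invmx (A y) = invmx (A x) + invmx (A y) *m (A x - A y) *m invmx (A x).
      by rewrite mulmxBr mulmxBl mulmxK ?A_unit // mulVmx ?A_unit // mul1mx addrC subrK.
    apply: le_trans (opnormD _ _) _; rewrite lerD2l.
    apply: le_trans (opnormM _ _) _; rewrite mulrA ler_wpM2r //.
    apply: le_trans (opnormM _ _) _; rewrite [in leRHS](_ : _ + _ = invmx (A y)).
      by rewrite ler_wpM2l ?opnorm_ge0 // opnorm_distC; exact: dA.
    by rewrite mulmxBr mulmxBl mulmxK ?A_unit // mulVmx ?A_unit // mul1mx addrC subrK.
  pose n0 := (Num.bound (a + d + 2 * b + tau^-1) + m)%N.
  have hn0 : a + d + 2 * b + tau^-1 < n0%:R.
    apply: lt_le_trans (archi_boundP _) _; last by rewrite ler_nat leq_addr.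
    by rewrite !addr_ge0 ?mulr_ge0 ?invr_ge0 // ltW.
  have ti : 0 < tau^-1 by rewrite invr_gt0.
  have n01 : n0%:R <= n0.+1%:R :> R by rewrite ler_nat.
  exists n0, m => y ag; split.
  + apply: le_trans (bA y ag) _; lra.
  + have h2 := bI y ag; have i0 := opnorm_ge0 (invmx (A y)).
    have : opnorm (invmx (A y)) * (1 / 2) <= opnorm (invmx (A y)) * (1 - d * b).
      by rewrite ler_wpM2l //; lra.
    lra.
  move=> y' ag'.
  have ag2 : agree y' x m.
    move=> i im; rewrite -(ag i im); apply: ag'; rewrite (leq_trans im) //.
    by rewrite /n0 leq_addl.
  have h1 := bA y' ag2; have h2 := bI y ag.
  have i0 := opnorm_ge0 (invmx (A y)); have j0 := opnorm_ge0 (A y').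
  set u := opnorm (A y') in h1 j0 *; set v := opnorm (invmx (A y)) in h2 i0 *.
  have tn : n0.+2%:R^-1 <= tau.
    rewrite -[tau]invrK lef_pV2 ?posrE // (le_trans _ (_ : n0%:R <= _)) ?ler_nat //; last by rewrite ltnW.
    lra.
  have p : 0 < 1 - d * b by lra.
  suff h : u * v * rho <= 1 - tau by apply: le_trans h _; rewrite lerD2l lerN2.
  rewrite -(ler_pM2r p).
  have -> : u * v * rho * (1 - d * b) = (u * rho) * (v * (1 - d * b)) by ring.
  have h3 : u * rho <= a * rho + d.
    apply: le_trans (ler_wpM2r (ltW r0) h1) _; rewrite mulrDl lerD2l ler_piMr ?ltW //.
  have h4 : (u * rho) * (v * (1 - d * b)) <= (a * rho + d) * b.
    by rewrite ler_pM // ?mulr_ge0 // ltW.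
  apply: le_trans h4 _.
  have -> : (a * rho + d) * b = 1 - 2 * tau + d * b by rewrite /tau; field.
  have dbt : d * b * tau >= 0 by rewrite mulr_ge0 ?(ltW tau0) // mulr_ge0 ?(ltW d0).
  lra.
exists (n.+1%:R + C), (1 - n.+2%:R^-1), n; split.
- by rewrite (le_trans (_ : 1 <= n.+1%:R)) ?ler1n // lerDl ltW.
- rewrite subr_gt0 invf_lt1 ?ltr1n // gtrBl invr_gt0 ltr0n //.
- by move=> x; have [h1 h2 _] := hn x; split; [apply: le_trans h1 _ | apply: le_trans h2 _];
    rewrite lerDl ltW.
- by move=> x y ag; have [_ _ h] := hn y; exact: h.
- move=> x y m /hC h; apply: le_trans h _.
  by rewrite ler_wpM2r ?exprn_ge0 ?(ltW r0) // lerDr.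
Qed.

Lemma cocycle_posE n x : cocycle_pos A n x = iter_mulmx (fun j => A (sigma_shift j%:Z x)) n.
Proof. by elim: n => //= n ->. Qed.

Lemma cocycle_negE n x :
  cocycle_neg A n x = iter_mulmx (fun j => invmx (A (sigma_shift (- j.+1%:Z) x))) n.
Proof. by elim: n => //= n ->. Qed.

Lemma cocycle_pos_unit n x : cocycle_pos A n x \in unitmx.
Proof. by rewrite cocycle_posE iter_mulmx_unit // => j; exact: A_unit. Qed.

Lemma cocycle_posD n m x :
  cocycle_pos A (n + m) x = cocycle_pos A m (sigma_shift n%:Z x) *m cocycle_pos A n x.
Proof.
rewrite !cocycle_posE iter_mulmxD; congr (_ *m _); apply: eq_iter_mulmx => j.
by rewrite sigma_shiftD -PoszD addnC.
Qed.

Lemma cocycleNE n x : cocycle A (- n%:Z) x = cocycle_neg A n x.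
Proof. by case: n. Qed.

(** Translates dynamics into factors: [a] counts the extra coordinates on which the two points agree
    beyond time 0. The constant is [K ^+ 2] because the relative difference of two factors carries
    an inverse in addition to the Hölder constant. *)
Lemma close_factors_exist : exists K theta M, [/\ 1 <= K, 0 < theta < 1,
    forall x, opnorm (A x) <= K /\ opnorm (invmx (A x)) <= K,
    forall (a : nat) x y, (forall i : int, - a%:Z <= i -> symbol x i = symbol y i) ->
      close_factors K theta rho M a (fun j => A (sigma_shift j%:Z x))
        (fun j => A (sigma_shift j%:Z y))
  & forall (a : nat) x y, (forall i : int, i < a%:Z -> symbol x i = symbol y i) ->
      close_factors K theta rho M a (fun j => invmx (A (sigma_shift (- j.+1%:Z) x)))
        (fun j => invmx (A (sigma_shift (- j.+1%:Z) y)))].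
Proof.
have /andP[r0 r1] := rho_bounds.
have [K [theta [M [K1 hth hK hM hH]]]] := uniform_bunching.
have K0 : 0 <= K by exact: le_trans K1.
have K2 : K <= K ^+ 2 by rewrite expr2 ler_peMr.
exists (K ^+ 2), theta, M; split => //.
- exact: le_trans K2.
- by move=> x; have [h1 h2] := hK x; split; exact: le_trans K2.
- move=> a; suff h x y : (forall i : int, - a%:Z <= i -> symbol x i = symbol y i) ->
      half_close (K ^+ 2) theta rho M a (fun j => A (sigma_shift j%:Z x)) (fun j => A (sigma_shift j%:Z y)).
    by move=> x y e; split; apply: h => // i hi; rewrite e.
  move=> e j; set x' := sigma_shift _ x; set y' := sigma_shift _ y.
  have ag : agree x' y' (a + j) by move=> i hi; rewrite !symbol_shift e //; move: hi; clear; lia.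
  have [h1 h2] := hK x'; have [h3 h4] := hK y'; split.
  + exact: A_unit.
  + exact: le_trans h1 K2.
  + exact: le_trans h2 K2.
  + move=> Mj; apply: hM => i hi; apply: ag.
    by rewrite (leq_trans hi) // (leq_trans Mj) // leq_addl.
  + have -> : invmx (A y') *m A x' - 1%:M = invmx (A y') *m (A x' - A y').
      by rewrite mulmxBr mulVmx ?A_unit.
    apply: le_trans (opnormM _ _) _; rewrite expr2 -mulrA ler_pM ?opnorm_ge0 //.
    exact: hH.
- move=> a; suff h x y : (forall i : int, i < a%:Z -> symbol x i = symbol y i) ->
      half_close (K ^+ 2) theta rho M a (fun j => invmx (A (sigma_shift (- j.+1%:Z) x)))
       (fun j => invmx (A (sigma_shift (- j.+1%:Z) y))).
    by move=> x y e; split; apply: h => // i hi; rewrite e.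
  move=> e j; set x' := sigma_shift _ x; set y' := sigma_shift _ y.
  have ag : agree y' x' (a + j) by move=> i hi; rewrite !symbol_shift e //; move: hi; clear; lia.
  have [h1 h2] := hK x'; have [h3 h4] := hK y'; rewrite !invmxK; split.
  + by rewrite unitmx_inv A_unit.
  + exact: le_trans h2 K2.
  + exact: le_trans h1 K2.
  + move=> Mj; rewrite [X in X * _]mulrC; apply: hM => i hi; apply: ag.
    by rewrite (leq_trans hi) // (leq_trans Mj) // leq_addl.
  + have -> : A y' *m invmx (A x') - 1%:M = (A y' - A x') *m invmx (A x').
      by rewrite mulmxBl mulmxV ?A_unit.
    apply: le_trans (opnormM _ _) _; rewrite mulrC expr2 -mulrA ler_pM ?opnorm_ge0 //.
    exact: hH.
Qed.

Lemma HslocE y x :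
  Hsloc A y x = holonomy (fun j => A (sigma_shift j%:Z x)) (fun j => A (sigma_shift j%:Z y)).
Proof.
rewrite /Hsloc /holonomy; set f := (fun n : nat => _).
suff -> : f = prod_ratio (fun j => A (sigma_shift j%:Z x)) (fun j => A (sigma_shift j%:Z y)) by [].
by apply/funext => n; rewrite /f /prod_ratio /= !cocycle_posE.
Qed.

Lemma HulocE y x :
  Huloc A y x = holonomy (fun j => invmx (A (sigma_shift (- j.+1%:Z) x)))
    (fun j => invmx (A (sigma_shift (- j.+1%:Z) y))).
Proof.
rewrite /Huloc /holonomy; set f := (fun n : nat => _).
suff -> : f = prod_ratio (fun j => invmx (A (sigma_shift (- j.+1%:Z) x)))
    (fun j => invmx (A (sigma_shift (- j.+1%:Z) y))) by [].
by apply/funext => n; rewrite /f /prod_ratio !cocycleNE !cocycle_negE.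
Qed.

End FiberBunchedCocycle.

Section HolonomyEstimates.
Context {N : nat} {Q : 'M[bool]_N} {R : realType} {k : nat}.
Local Notation Sigma := (subshift Q).
Variables (A : Sigma -> 'M[R]_k) (rho K theta : R) (M : nat).
Hypotheses (hrho : 0 < rho < 1) (K1 : 1 <= K) (htheta : 0 < theta < 1).
Hypothesis AU : forall x, A x \in unitmx.
Hypothesis AK : forall x, opnorm (A x) <= K /\ opnorm (invmx (A x)) <= K.
Let bS (x : Sigma) (j : nat) := A (sigma_shift j%:Z x).
Let bU (x : Sigma) (j : nat) := invmx (A (sigma_shift (- j.+1%:Z) x)).
Hypothesis hS : forall (a : nat) x y, (forall i : int, - a%:Z <= i -> symbol x i = symbol y i) ->
  close_factors K theta rho M a (bS x) (bS y).
Hypothesis hU : forall (a : nat) x y, (forall i : int, i < a%:Z -> symbol x i = symbol y i) ->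
  close_factors K theta rho M a (bU x) (bU y).
Implicit Types x y z : Sigma.

Local Notation AA := (cocycle_pos A).
Let C := hol_const K theta M.

Let AAE n x : AA n x = iter_mulmx (bS x) n.
Proof. by elim: n => //= n ->. Qed.

Let uAA n x : AA n x \in unitmx.
Proof. by rewrite AAE iter_mulmx_unit // => j; exact: AU. Qed.

Let AAD n m x : AA (n + m) x = AA m (sigma_shift n%:Z x) *m AA n x.
Proof.
rewrite !AAE iter_mulmxD; congr (_ *m _); apply: eq_iter_mulmx => j.
by rewrite /bS sigma_shiftD -PoszD addnC.
Qed.

Let bUE n x : iter_mulmx (bU x) n = invmx (AA n (sigma_shift (- n%:Z) x)).
Proof.
elim: n => [|n IH]; first by rewrite /= invmx1.
rewrite -[in RHS]add1n AAD inv_mulmx ?uAA //= IH.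
rewrite /= mulmx1 sigma_shift0 sigma_shiftD.
by congr (_ *m invmx (AA n (sigma_shift _ x))); lia.
Qed.

Let C0 : 0 < C. Proof. exact: hol_const_gt0. Qed.

(** Uniformly in [n], agreement of the futures costs a right factor near the identity; agreement of
    the pasts, in the next lemma, costs a left factor. *)
Lemma stable_factor a x y n : (forall i : int, - a%:Z <= i -> symbol x i = symbol y i) ->
  exists2 D, AA n x = AA n y *m D & opnorm (D - 1%:M) <= C * rho ^+ a.
Proof.
move=> /hS h; exists (prod_ratio (bS x) (bS y) n); last exact: ratio_near1 h.
by rewrite /prod_ratio -!AAE mulKVmx.
Qed.

Lemma unstable_factor a x y n : (forall i : int, i < n%:Z + a%:Z -> symbol x i = symbol y i) ->
  exists2 D, AA n x = D *m AA n y & opnorm (D - 1%:M) <= C * rho ^+ a.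
Proof.
move=> e; have /hU h : forall i : int, i < a%:Z ->
    symbol (sigma_shift n%:Z y) i = symbol (sigma_shift n%:Z x) i.
  by move=> i hi; rewrite !symbol_shift e // addrC ltrD2l.
exists (prod_ratio (bU (sigma_shift n%:Z y)) (bU (sigma_shift n%:Z x)) n).
  by rewrite /prod_ratio !bUE invmxK !sigma_shiftD addNr !sigma_shift0 mulmxKV.
exact: ratio_near1 h.
Qed.

Let hS0 x y : (forall i : int, 0 <= i -> symbol x i = symbol y i) ->
  close_factors K theta rho M 0 (bS x) (bS y).
Proof. by move=> e; apply: hS => i; rewrite oppr0; exact: e. Qed.

(** Equivariance moves the holonomy to time [n], where the two orbits already agree on a long past;
    this second holonomy is the exponentially small error [E]. *)
Lemma stable_holonomy x y n : (forall i : int, 0 <= i -> symbol x i = symbol y i) ->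
  exists2 E, AA n x = E *m AA n y *m Hsloc A y x & opnorm (E - 1%:M) <= C * rho ^+ n.
Proof.
move=> /hS0 h.
have h' := close_factors_shift n h; have h2 := close_factors_sym h'.
exists (holonomy (fun j => bS y (n + j)%N) (fun j => bS x (n + j)%N)); last first.
  by have := holonomy_near1 K1 htheta hrho h2; rewrite add0n.
rewrite HslocE (holonomy_equivariant K1 htheta hrho n h) -!AAE.
set X := holonomy (fun j => bS y _) _; set Y := holonomy _ _.
have XY : X *m Y = 1%:M by exact: holonomyK h2.
by rewrite !mulmxA mulmxK // XY mul1mx.
Qed.

Lemma stable_holonomy_inv x y : (forall i : int, 0 <= i -> symbol x i = symbol y i) ->
  Hsloc A y x *m Hsloc A x y = 1%:M /\ opnorm (Hsloc A x y) <= 1 + C.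
Proof.
move=> /hS0 h; rewrite !HslocE; split; first exact: holonomyK h.
apply: opnorm_near1; rewrite -[leRHS]mulr1 -(expr0 rho).
exact: holonomy_near1 (close_factors_sym h).
Qed.

Let hU0 x y : (forall i : int, i < 0 -> symbol x i = symbol y i) ->
  close_factors K theta rho M 0 (bU x) (bU y).
Proof. exact: hU. Qed.

Lemma unstable_holonomy x y n : (forall i : int, i < 0 -> symbol x i = symbol y i) ->
  exists2 E, AA n (sigma_shift (- n%:Z) x) =
      Huloc A x y *m AA n (sigma_shift (- n%:Z) y) *m E
    & opnorm (E - 1%:M) <= C * rho ^+ n.
Proof.
move=> /hU0/close_factors_sym h.
have h' := close_factors_shift n h; have h2 := close_factors_sym h'.
exists (holonomy (fun j => bU x (n + j)%N) (fun j => bU y (n + j)%N)); last first.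
  by have := holonomy_near1 K1 htheta hrho h2; rewrite add0n.
rewrite HulocE (holonomy_equivariant K1 htheta hrho n h) !bUE invmxK.
set X := holonomy (fun j => bU y _) _; set Y := holonomy _ _.
have XY : X *m Y = 1%:M by exact: holonomyK h'.
by rewrite mulmxKV // -mulmxA XY mulmx1.
Qed.

Lemma unstable_holonomy_inv x y : (forall i : int, i < 0 -> symbol x i = symbol y i) ->
  Huloc A y x *m Huloc A x y = 1%:M /\ opnorm (Huloc A x y) <= 1 + C.
Proof.
move=> /hU0 h; rewrite !HulocE; split; first exact: holonomyK h.
apply: opnorm_near1; rewrite -[leRHS]mulr1 -(expr0 rho).
exact: holonomy_near1 (close_factors_sym h).
Qed.

(** The time [n1] is large enough both for the orbits to coincide and for the defining formula of
    [H] to hold; from there on the local statement applies, which explains the exponent [n - n1]. *)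
Lemma extended_stable_holonomy y x H : Ws x y -> Hs A x y H ->
  exists n1 : nat, (forall i : int, n1%:Z <= i -> symbol y i = symbol x i) /\
    H \in unitmx /\ forall n, (n1 <= n)%N ->
    exists2 E, AA n y = E *m AA n x *m H & opnorm (E - 1%:M) <= C * rho ^+ (n - n1).
Proof.
move=> [[m|m] // m0 hm] [n0 _ hn0]; pose n1 := (m + n0)%N; have n01 : (n0 <= n1)%N := leq_addl _ _.
have e1 (i : int) : n1%:Z <= i -> symbol y i = symbol x i.
  move=> hi; have := hm (i - m%:Z); rewrite !symbol_shift subrK; apply.
  by rewrite subr_ge0 (le_trans _ hi) // lez_nat leq_addr.
clearbody n1.
have e2 (i : int) : 0 <= i -> symbol (sigma_shift n1%:Z y) i = symbol (sigma_shift n1%:Z x) i.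
  by move=> hi; rewrite !symbol_shift e1 // lerDr.
have hH := hn0 n1 n01; rewrite /= in hH.
have [HK _] := stable_holonomy_inv e2; have [uL _] := mulmx1_unit HK.
exists n1; split=> //; split.
  by rewrite hH !unitmx_mul uL unitmx_inv !uAA.
move=> n nn1; have [E hE nE] := stable_holonomy (n - n1) e2; exists E => //.
rewrite -{1 2}(subnKC nn1) !AAD hE hH !mulmxA; congr (_ *m _ *m _).
by rewrite mulmxK.
Qed.

Lemma extended_unstable_holonomy y x H : Wu x y -> Hu A y x H ->
  exists n1 : nat, (forall i : int, i < - n1%:Z -> symbol y i = symbol x i) /\
    H \in unitmx /\ forall n, (n1 <= n)%N ->
    exists2 E, AA n (sigma_shift (- n%:Z) y) = H *m AA n (sigma_shift (- n%:Z) x) *m E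
      & opnorm (E - 1%:M) <= C * rho ^+ (n - n1).
Proof.
move=> [m0 m00 hm] [n0 _ hn0]; pose m := absz m0.
have m0E : m0 = - m%:Z by rewrite /m; lia.
pose n1 := (m + n0)%N; have n01 : (n0 <= n1)%N := leq_addl _ _.
have e1 (i : int) : i < - n1%:Z -> symbol y i = symbol x i.
  move=> hi; have := hm (i - m0); rewrite !symbol_shift subrK; apply.
  by rewrite m0E; rewrite /n1 in hi; lia.
clearbody n1.
have e2 (i : int) : i < 0 ->
    symbol (sigma_shift (- n1%:Z) y) i = symbol (sigma_shift (- n1%:Z) x) i.
  by move=> hi; rewrite !symbol_shift e1 // gtrDr.
have hH := hn0 n1 n01.
have negE u : cocycle A (- n1%:Z) u = invmx (AA n1 (sigma_shift (- n1%:Z) u)).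
  rewrite -bUE; transitivity (cocycle_neg A n1 u); first by case: (n1).
  by elim: (n1) => //= j ->.
rewrite !negE invmxK in hH.
have [HK _] := unstable_holonomy_inv e2; have [uL _] := mulmx1_unit HK.
have [HK' _] := unstable_holonomy_inv (fun i hi => esym (e2 i hi)).
have [uL' _] := mulmx1_unit HK'.
exists n1; split=> //; split.
  by rewrite hH !unitmx_mul uL' unitmx_inv !uAA.
move=> n nn1; have [E hE nE] := unstable_holonomy (n - n1) e2; exists E => //.
have sh u : sigma_shift (- n%:Z) u = sigma_shift (- (n - n1)%N%:Z) (sigma_shift (- n1%:Z) u).
  by rewrite sigma_shiftD; congr (sigma_shift _ u); lia.
have dec u : AA n (sigma_shift (- n%:Z) u) = AA n1 (sigma_shift (- n1%:Z) u) *m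
    AA (n - n1) (sigma_shift (- (n - n1)%N%:Z) (sigma_shift (- n1%:Z) u)).
  rewrite -{1}(subnK nn1) AAD; congr (AA n1 _ *m AA _ _) => //.
  by rewrite sigma_shiftD; congr (sigma_shift _ u); lia.
rewrite !dec hE hH !mulmxA; congr (_ *m _ *m _).
by rewrite mulmxKV.
Qed.

Lemma cocycle_bunching n x :
  opnorm (AA n x) * opnorm (invmx (AA n x)) * rho ^+ n <= (K ^+ 2 / theta) ^+ M * theta ^+ n.
Proof.
by rewrite AAE; apply: (bunching_iterate K1 htheta hrho n (hS0 _)) => i _.
Qed.

Lemma cocycle_pos_bound n x : opnorm (AA n x) <= K ^+ n /\ opnorm (invmx (AA n x)) <= K ^+ n.
Proof.
elim: n x => [|n IH] x.
  by rewrite /= invmx1 expr0; split; exact: opnorm1_le.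
have [h1 h2] := AK (sigma_shift n x); have [i1 i2] := IH x; rewrite /= inv_mulmx // exprS; split.
  by apply: le_trans (opnormM _ _) _; rewrite ler_pM ?opnorm_ge0.
by apply: le_trans (opnormM _ _) _; rewrite mulrC ler_pM ?opnorm_ge0.
Qed.

(** The intermediate point [w] has the past of [y] and the future of [x]: passing from [x] to [w]
    costs a right factor, from [w] to [y] a left factor. Splicing needs a common symbol, so [n = 0]
    is separate. *)
Lemma cocycle_distortion x y n :
  (forall i : nat, (i < n)%N -> symbol x i = symbol y i) ->
  exists D1 D2, [/\ AA n x = D1 *m AA n y *m D2, opnorm D1 <= 1 + C & opnorm D2 <= 1 + C].
Proof.
case: n => [_|n e].
  exists 1%:M, 1%:M; rewrite /= !mulmx1; split=> //.
    by apply: le_trans (opnorm1_le _) _; rewrite lerDl ltW.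
  by apply: le_trans (opnorm1_le _) _; rewrite lerDl ltW.
have [w [h1 h2]] := @splice _ _ 0 y x (esym (e 0%N isT)).
have [|D2 e2 n2] := @stable_factor 0 x w n.+1.
  by move=> i; rewrite oppr0 => hi; rewrite h2.
have [|D1 e1 n1] := @unstable_factor 0 w y n.+1.
  move=> i hi; have [i0|i0] := leP i 0; first exact: h1.
  rewrite h2 ?ltW //; case: i hi i0 => // i hi _; apply: e; lia.
exists D1, D2; split; first by rewrite e2 e1.
  by apply: opnorm_near1; move: n1; rewrite expr0 mulr1.
by apply: opnorm_near1; move: n2; rewrite expr0 mulr1.
Qed.

End HolonomyEstimates.

(** * Gluing of orbit segments *)

Section EigenvectorMatrix.
Context {R : realType} {k : nat}.
Variables (P : 'M[R]_k) (lam : 'I_k -> R) (v : 'I_k -> 'cV[R]_k).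
Hypotheses (lam_inj : injective lam) (hv : forall i, v i != 0 /\ P *m v i = lam i *: v i).

Definition eigen_mx : 'M[R]_k := \matrix_(i, j) v j i 0.

Lemma eigen_mxE : P *m eigen_mx = eigen_mx *m diag_mx (\row_i lam i).
Proof.
apply/matrixP => i j; rewrite mul_mx_diag !mxE mulrC.
have := congr1 (fun w : 'cV_k => w i 0) (hv j).2; rewrite !mxE => <-.
by apply: eq_bigr => l _; rewrite mxE.
Qed.

(** The product of the [P - lam i] over [i] in [l], which annihilates the eigenvectors with index in
    [l]. *)
Let op (l : seq 'I_k) (w : 'cV[R]_k) := foldr (fun i u => P *m u - lam i *: u) w l.

Let op_eigen l i : op l (v i) = \prod_(j <- l) (lam i - lam j) *: v i.
Proof.
elim: l => [|j l IH] /=; first by rewrite big_nil scale1r.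
rewrite IH big_cons -scalemxAr (hv i).2 !scalerA -scalerBl; congr (_ *: _); ring.
Qed.

Let op_sum l (c : 'I_k -> R) (w : 'I_k -> 'cV[R]_k) :
  op l (\sum_i c i *: w i) = \sum_i c i *: op l (w i).
Proof.
elim: l => [//|j l IH] /=; rewrite IH mulmx_sumr scaler_sumr -sumrB.
by apply: eq_bigr => i _; rewrite -scalemxAr scalerBr !scalerA [lam j * _]mulrC.
Qed.

(** Applying the product of the [P - lam j] over all [j != i] to a vanishing combination isolates
    its coefficient at [v i], since the eigenvalues are distinct. *)
Lemma eigen_mx_unit : eigen_mx \in unitmx.
Proof.
rewrite -unitmx_tr -row_free_unit; apply: inj_row_free => c hc.
have h : \sum_i c 0 i *: v i = 0.
  apply/matrixP => i j; rewrite (ord1 j) summxE mxE.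
  have hc' : (c *m eigen_mx^T) 0 i = 0 by rewrite hc mxE.
  by rewrite -[RHS]hc' mxE; apply: eq_bigr => l _; rewrite !mxE.
apply/matrixP => i0 i; rewrite (ord1 i0) mxE.
pose l := [seq j <- enum 'I_k | j != i].
have op0 w : w = 0 -> op l w = 0.
  by move=> ->; elim: l => //= j l' ->; rewrite mulmx0 scaler0 subr0.
have := op0 _ h; rewrite op_sum (bigD1 i) //= [X in _ + X]big1 ?addr0 => [|j ji]; last first.
  rewrite op_eigen (_ : \prod_(_ <- _) _ = 0) ?scale0r ?scaler0 //.
  apply/eqP; rewrite prodf_seq_eq0; apply/hasP; exists j; rewrite ?subrr //=.
  by rewrite mem_filter ji mem_enum.
rewrite op_eigen scalerA => /eqP; rewrite scaler_eq0 (negbTE (hv i).1) orbF mulf_eq0.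
case/orP => [/eqP //|]; rewrite prodf_seq_eq0 => /hasP[j].
rewrite mem_filter => /andP[ji _] /=; rewrite subr_eq0 => /eqP/lam_inj ij.
by rewrite ij eqxx in ji.
Qed.

Lemma eigenvalue_neq0 i : P \in unitmx -> lam i != 0.
Proof.
move=> uP; apply/eqP => l0; have [v0 e] := hv i.
by move: v0; rewrite -[v i](mulKmx uP) e l0 scale0r mulmx0 eqxx.
Qed.

End EigenvectorMatrix.

Section TwistingMinors.
Context {R : realType} {k : nat}.
Variables (psi : 'M[R]_k) (v : 'I_k -> 'cV[R]_k).
Let V := eigen_mx v.
Hypotheses (uV : V \in unitmx) (upsi : psi \in unitmx).

Lemma general_position_coef (I : finType) n (B : 'M[R]_n) (w : I -> 'cV[R]_n) (c : I -> I -> R) :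
  general_position B w -> (forall j, B *m w j = \sum_i c i j *: w i) ->
  forall i j, c i j != 0.
Proof.
move=> gp e i j; apply/eqP => c0; have /negP := gp j i; apply.
rewrite e (bigD1 i) //= c0 scale0r add0r; apply: memv_suml => l li.
apply: memvZ; rewrite memvE; exact: (sumv_sup l).
Qed.

Hypothesis gp1 : general_position psi v.
Hypothesis gpt : forall t, (2 <= t <= k.-1)%N ->
  general_position (extpow t psi)
    (fun I : multi_index t k => wedge (fun a => v (mi_fun I a))).

Let Psi := invmx V *m psi *m V.

Let psiV : psi *m V = V *m Psi.
Proof. by rewrite /Psi !mulmxA mulmxV // mul1mx. Qed.

(** The minors of rank [t] are the coefficients of [extpow t psi] in the basis of wedges of
    eigenvectors, so typicality gives [1 <= t <= k.-1]. Rank 0 is an empty determinant, and rank [k]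
    is the determinant of an invertible matrix up to sign. *)
Lemma twisting_minors t (I J : multi_index t k) :
  \det (mxsub (mi_fun I) (mi_fun J) Psi) != 0.
Proof.
have tk : (t <= k)%N.
  by rewrite -(card_ord t) -[k in leqRHS]card_ord; apply: leq_card; exact: mi_fun_inj I.
have [t0|t0] := leqP t 0.
  by move: t0 I J; rewrite leqn0 => /eqP -> I J; rewrite det_mx00 oner_eq0.
have [tk1|tk1] := leqP t k.-1; last first.
  have {tk tk1} tk : t = k by lia.
  move: I J; rewrite tk => I J.
  have -> : mxsub (mi_fun I) (mi_fun J) Psi =
      rowsub (mi_fun I) 1%:M *m Psi *m colsub (mi_fun J) 1%:M.
    rewrite mulmx_colsub mul_rowsub_mx mul1mx mulmx1.
    by rewrite /mxsub; apply/matrixP => a b; do 3 rewrite mxE.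
  have uI (L : multi_index k k) : rowsub (mi_fun L) (1%:M : 'M[R]_k) \in unitmx.
    have -> : rowsub (mi_fun L) (1%:M : 'M[R]_k) = perm_mx (perm (@mi_fun_inj _ _ L)).
      by apply/matrixP => a b; rewrite !mxE permE.
    exact: unitmx_perm.
  have uJ : colsub (mi_fun J) (1%:M : 'M[R]_k) \in unitmx.
    rewrite -unitmx_tr (_ : _^T = rowsub (mi_fun J) 1%:M) //.
    by apply/matrixP => a b; rewrite !mxE eq_sym.
  have : rowsub (mi_fun I) 1%:M *m Psi *m colsub (mi_fun J) 1%:M \in unitmx.
    by rewrite !unitmx_mul uI uJ unitmx_inv uV upsi.
  by rewrite unitmxE unitfE.
have [t1|t1] := leqP t 1.
  have {t0 t1} t1 : t = 1%N by lia.
  move: I J {tk tk1}; rewrite t1 => I J.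
  rewrite det_mx11 mxE.
  apply: (general_position_coef (c := fun i j => Psi i j) gp1) => j.
  apply/matrixP => i z; rewrite (ord1 z) summxE mxE.
  have /matrixP/(_ i j) := psiV; rewrite !mxE => h.
  rewrite -[LHS](_ : \sum_l psi i l * V l j = _); last by apply: eq_bigr => l _; rewrite mxE.
  by rewrite h; apply: eq_bigr => l _; rewrite !mxE mulrC.
have ht : (2 <= t <= k.-1)%N by rewrite t1.
apply: (general_position_coef (c := fun I J : multi_index t k =>
  \det (mxsub (mi_fun I) (mi_fun J) Psi)) (gpt ht)) => {}J.
have wE (L : multi_index t k) i : wedge (fun a => v (mi_fun L a)) i 0 = extpow t V i (enum_rank L).
  rewrite extpowE enum_rankK mxE; congr (\det _); apply/matrixP => a b.
  by rewrite !mxE.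
apply/matrixP => i z; rewrite (ord1 z) summxE mxE.
transitivity ((extpow t psi *m extpow t V) i (enum_rank J)).
  by rewrite mxE; apply: eq_bigr => l _; rewrite wE.
rewrite -extpowM psiV extpowM mxE.
rewrite -(sum_enum_val (fun L : multi_index t k => (\det (mxsub (mi_fun L) (mi_fun J) Psi) *:
  wedge (fun a => v (mi_fun L a))) i 0)).
apply: eq_bigr => l _; rewrite [RHS]mxE wE enum_valK [RHS]mulrC.
by congr (_ * _); rewrite extpowE enum_rankK.
Qed.

End TwistingMinors.

(** * Shadowing the homoclinic orbit *)

Section HomoclinicExcursion.
Context {N : nat} {Q : 'M[bool]_N} {R : realType} {k : nat}.
Local Notation Sigma := (subshift Q).
Variables (A : Sigma -> 'M[R]_k) (rho K theta : R) (M : nat).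
Hypotheses (hrho : 0 < rho < 1) (K1 : 1 <= K) (htheta : 0 < theta < 1).
Hypothesis AU : forall x, A x \in unitmx.
Hypothesis AK : forall x, opnorm (A x) <= K /\ opnorm (invmx (A x)) <= K.
Let bS (x : Sigma) (j : nat) := A (sigma_shift j%:Z x).
Let bU (x : Sigma) (j : nat) := invmx (A (sigma_shift (- j.+1%:Z) x)).
Hypothesis hS : forall (a : nat) x y, (forall i : int, - a%:Z <= i -> symbol x i = symbol y i) ->
  close_factors K theta rho M a (bS x) (bS y).
Hypothesis hU : forall (a : nat) x y, (forall i : int, i < a%:Z -> symbol x i = symbol y i) ->
  close_factors K theta rho M a (bU x) (bU y).
Implicit Types x y z : Sigma.

Local Notation AA := (cocycle_pos A).
Let C := hol_const K theta M.
Let C0 : 0 < C. Proof. exact: hol_const_gt0. Qed.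

Lemma near1_mul4 (X1 X2 X3 X4 : 'M[R]_k) d : 0 <= d -> d <= C ->
  opnorm (X1 - 1%:M) <= d -> opnorm (X2 - 1%:M) <= d ->
  opnorm (X3 - 1%:M) <= d -> opnorm (X4 - 1%:M) <= d ->
  opnorm (X1 *m X2 *m X3 *m X4 - 1%:M) <= (2 + (2 + C) * C) * (2 + C) * d.
Proof.
move=> d0 dC h1 h2 h3 h4.
have two c e (X Y : 'M[R]_k) : 0 <= e -> e <= c -> opnorm (X - 1%:M) <= e ->
   opnorm (Y - 1%:M) <= e -> opnorm (X *m Y - 1%:M) <= (2 + c) * e.
  move=> e0 ec hX hY; apply: le_trans (opnorm_near1M e0 e0 hX hY) _.
  have : e * e <= c * e by rewrite ler_wpM2r.
  lra.
rewrite -(mulmxA (X1 *m X2)) -mulrA; have Cge : 0 <= 2 + C by lra.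
apply: (two); [exact: mulr_ge0 | by rewrite ler_wpM2l | exact: two h1 h2 | exact: two h3 h4].
Qed.

Variables (p z : Sigma) (l : nat) (hs hu : 'M[R]_k) (n1 : nat).
Hypothesis (hper : sigma_shift l%:Z p = p).
Hypothesis zs : forall i : int, n1%:Z <= i -> symbol z i = symbol p i.
Hypothesis zu : forall i : int, i <= - n1%:Z -> symbol z i = symbol p i.
Hypothesis Zs : forall n, (n1 <= n)%N ->
  exists2 E, AA n z = E *m AA n p *m hs & opnorm (E - 1%:M) <= C * rho ^+ (n - n1).
Hypothesis Zu : forall n, (n1 <= n)%N ->
  exists2 E, AA n (sigma_shift (- n%:Z) z) = hu *m AA n (sigma_shift (- n%:Z) p) *m E
    & opnorm (E - 1%:M) <= C * rho ^+ (n - n1).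

Lemma period_mul j : sigma_shift (l * j)%N%:Z p = p.
Proof.
elim: j => [|j IH]; first by rewrite muln0 sigma_shift0.
by rewrite mulnS PoszD -sigma_shiftD IH hper.
Qed.

Lemma period_symbol j (i i' : int) : i = i' + (l * j)%N%:Z -> symbol p i = symbol p i'.
Proof. by move=> ->; rewrite -[in RHS](period_mul j). Qed.

(** The point [w] follows [zeta], already on the periodic orbit, then [z] on [[-n, n]], then [eta].
    Since [n] is a multiple of the period and exceeds [n1], the three pieces carry the same symbol
    where they meet. *)
Lemma excursion_point j (zeta eta : Sigma) : let n := (l * j)%N in (n1 < n)%N ->
  (forall i : int, 0 <= i -> symbol zeta i = symbol p i) ->
  (forall i : int, i <= 0 -> symbol eta i = symbol p i) ->
  exists w : Sigma, [/\ forall i : int, i <= - n%:Z -> symbol w i = symbol zeta (i + (n + n)%N%:Z),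
    forall i : int, - n%:Z <= i <= n%:Z -> symbol w i = symbol z i &
    forall i : int, n%:Z <= i -> symbol w i = symbol eta (i - (n + n)%N%:Z)].
Proof.
move=> n nn1 hz he.
have pn (i i' : int) : i = i' + n%:Z -> symbol p i = symbol p i' by exact: period_symbol.
have [|w1 [h1 h2]] := @splice _ _ (- n%:Z) (sigma_shift (n + n)%N%:Z zeta) z.
  rewrite symbol_shift hz; last by lia.
  rewrite zu; last by lia.
  rewrite (pn _ 0) ?(pn 0 (- n%:Z)) //; by lia.
have [|w [h3 h4]] := @splice _ _ n%:Z w1 (sigma_shift (- (n + n)%N%:Z) eta).
  rewrite symbol_shift he; last by lia.
  rewrite h2; last by lia.
  rewrite zs; last by lia.
  rewrite (pn _ 0) ?(pn 0 (n%:Z - (n + n)%N%:Z)) //; by lia.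
exists w; split=> i hi.
- rewrite h3; last by lia.
  by rewrite h1.
- rewrite h3; last by lia.
  by rewrite h2; last by lia.
- by rewrite h4.
Qed.

(** Because [z] coincides with [p] outside [(-n1, n1)], the shadowing extends beyond the junctions
    by [n - n1] coordinates on the sides of [zeta] and [eta], and to [[-2n, 2n]] for [z]. These
    overlaps make the errors small. *)
Lemma excursion_agree j (zeta eta : Sigma) : let n := (l * j)%N in (n1 < n)%N ->
  (forall i : int, 0 <= i -> symbol zeta i = symbol p i) ->
  (forall i : int, i <= 0 -> symbol eta i = symbol p i) ->
  exists w : Sigma, [/\ forall (a : nat) (i : int), i < (a + n)%N%:Z + (n - n1)%N%:Z ->
      symbol (sigma_shift (- (n + n + a)%N%:Z) w) i = symbol (sigma_shift (- a%:Z) zeta) i,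
    forall i : int, - n%:Z <= i <= (n + n)%N%:Z + n%:Z ->
      symbol (sigma_shift (- n%:Z) w) i = symbol (sigma_shift (- n%:Z) z) i &
    forall i : int, - (n - n1)%N%:Z <= i ->
      symbol (sigma_shift n%:Z w) i = symbol (sigma_shift (- n%:Z) eta) i].
Proof.
move=> n nn1 hz he.
have [w [wz wm we]] := excursion_point nn1 hz he; rewrite -/n in wz wm we.
have pn (i i' : int) : i = i' + n%:Z -> symbol p i = symbol p i' by exact: period_symbol.
clearbody n.
have pnn (i i' : int) : i = i' + (n + n)%N%:Z -> symbol p i = symbol p i'.
  by move=> e; rewrite (pn i (i' + n%:Z)) ?(pn (i' + n%:Z) i') //; rewrite e; lia.
exists w; split.
- move=> a i hi; rewrite !symbol_shift.
  have [i1|i1] := leP (i - (n + n + a)%N%:Z) (- n%:Z).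
    by rewrite wz //; congr (symbol zeta _); lia.
  rewrite wm; last by lia.
  rewrite zu; last by lia.
  rewrite hz; last by lia.
  by apply/esym/pnn; lia.
- move=> i' hi'; rewrite !symbol_shift.
  have [i hi ->] : exists2 i : int, - (n + n)%N%:Z <= i <= (n + n)%N%:Z & i' - n%:Z = i.
    by exists (i' - n%:Z) => //; lia.
  have [i1|i1] := leP i (- n%:Z).
    rewrite wz // hz; last by lia.
    rewrite zu; last by lia.
    by apply: pnn.
  have [i2|i2] := leP i n%:Z; first by apply: wm; lia.
  rewrite we; last by lia.
  rewrite he; last by lia.
  rewrite zs; last by lia.
  by apply/esym/pnn; lia.
- move=> i hi; rewrite !symbol_shift.
  have [i1|i1] := leP n%:Z (i + n%:Z).
    by rewrite we //; congr (symbol eta _); lia.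
  rewrite wm; last by lia.
  rewrite zs; last by lia.
  rewrite he; last by lia.
  by apply: pnn; lia.
Qed.

(** The passage crosses the periodic orbit for time [n] four times. All shadowing and holonomy
    errors collect in two blocks, [X] between the two later powers of the period and [Y] between the
    two earlier ones; each is conjugated by one power to reach [hs *m hu]. *)
Lemma excursion_matrix : exists C1, forall j, let n := (l * j)%N in (n1 < n)%N ->
  forall zeta eta : Sigma, (forall i : int, 0 <= i -> symbol zeta i = symbol p i) ->
  (forall i : int, i <= 0 -> symbol eta i = symbol p i) ->
  exists w : Sigma, [/\ forall (a : nat) (i : int), i < (a + n)%N%:Z + (n - n1)%N%:Z ->
      symbol (sigma_shift (- (n + n + a)%N%:Z) w) i = symbol (sigma_shift (- a%:Z) zeta) i,
    forall i : int, - (n - n1)%N%:Z <= i ->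
      symbol (sigma_shift n%:Z w) i = symbol (sigma_shift (- n%:Z) eta) i
  & forall a b : nat, exists2 psi, AA (a + n + (n + n) + (n + b)) (sigma_shift (- (n + n + a)%N%:Z) w) =
      (AA b eta *m Huloc A eta p) *m
      (AA n p *m AA n p *m psi *m (AA n p *m AA n p)) *m
      (Hsloc A p zeta *m AA a (sigma_shift (- a%:Z) zeta))
    & opnorm (psi - hs *m hu) <= C1 * theta ^+ n].
Proof.
have /andP[r0 r1] := hrho; have /andP[th0 th1] := htheta.
(* The constant of [near1_mul4] for four errors of size [C * rho ^+ (n - n1)]; [rho ^- n1] restores
   [rho ^+ n], and the last factor comes from bunching. *)
pose c4 := (2 + (2 + C) * C) * (2 + C) * C * rho ^- n1 * (K ^+ 2 / theta) ^+ M.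
have Kt : 0 <= K ^+ 2 / theta.
  by rewrite divr_ge0 ?(ltW th0) // exprn_ge0 // (le_trans _ K1).
have q0 : 0 <= (2 + (2 + C) * C) * (2 + C) * C.
  have h := ltW C0; have h2 : 0 <= 2 + C by rewrite addr_ge0.
  by apply: mulr_ge0 => //; apply: mulr_ge0 => //; apply: addr_ge0 => //; exact: mulr_ge0.
have rn0 : 0 <= rho ^- n1 by rewrite invr_ge0 exprn_ge0 // ltW.
have c40 : 0 <= c4 by apply: mulr_ge0; [exact: mulr_ge0 | exact: exprn_ge0].
exists (c4 * opnorm (hs *m hu) + (1 + c4) * c4 * opnorm (hs *m hu)).
move=> j n nn1 zeta eta hz he.
have [w [wa wm wb]] := excursion_agree nn1 hz he; rewrite -/n in wa wm wb.
exists w; split=> // a b.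
have uA m x : AA m x \in unitmx by rewrite cocycle_posE iter_mulmx_unit // => i; exact: AU.
have sP : sigma_shift (- n%:Z) p = p.
  by rewrite -[in LHS](period_mul j) sigma_shiftD addNr sigma_shift0.
clearbody n.
set Pn := AA n p; set s := sigma_shift (- a%:Z) zeta.
set w0 := sigma_shift (- (n + n + a)%N%:Z) w.
set z1 := sigma_shift (- n%:Z) z; set w1 := sigma_shift (- n%:Z) w.
set w2 := sigma_shift n%:Z w; set e2 := sigma_shift (- n%:Z) eta.
have [E1 eE1 nE1] := @unstable_factor _ _ _ _ A rho K theta M hrho K1 htheta AU hU (n - n1) w0 s (a + n)
  (wa a).
have [E2 eE2 nE2] := stable_holonomy hrho K1 htheta AU hS n hz.
(* The points [w1] and [z1] agree on a finite window only, so the comparison goes through a point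
   with the past of [w1] and the future of [z1]. *)
have [|w' [h5 h6]] := @splice _ _ 0 w1 z1.
  by apply: wm; clear; lia.
have [|E3 eE3 nE3] := @stable_factor _ _ _ _ A rho K theta M hrho K1 htheta AU hS n w' z1 (n + n).
  move=> i hi; have [i1|i1] := leP 0 i; first exact: h6.
  by rewrite h5 ?(ltW i1) //; apply: wm; move: hi i1; clear; lia.
have [|E4 eE4 nE4] := @unstable_factor _ _ _ _ A rho K theta M hrho K1 htheta AU hU n w1 w' (n + n).
  move=> i hi; have [i1|i1] := leP i 0; first by rewrite h5.
  by rewrite h6 ?(ltW i1) //; apply: wm; move: hi i1; clear; lia.
have [E5 eE5 nE5] := Zs (ltnW nn1).
have [E6 eE6 nE6] := Zu (ltnW nn1).
have [E7 eE7 nE7] := @stable_factor _ _ _ _ A rho K theta M hrho K1 htheta AU hS (n - n1) w2 e2 (n + b) wb.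
have [|E8 eE8 nE8] := @unstable_holonomy _ _ _ _ A rho K theta M hrho K1 htheta AU hU eta p n.
  by move=> i /ltW; exact: he.
rewrite sP in eE6 eE8; rewrite -/Pn -/z1 -/e2 in eE2 eE5 eE6 eE8.
pose X := E8 *m E7 *m E4 *m E5; pose Y := E6 *m E3 *m E1 *m E2.
pose d := C * rho ^+ (n - n1).
have d0 : 0 <= d by rewrite mulr_ge0 ?(ltW C0) // exprn_ge0 // ltW.
have dC : d <= C by rewrite ler_piMr ?(ltW C0) // exprn_ile1 // ltW.
have nd : C * rho ^+ n <= d.
  by rewrite ler_wpM2l ?(ltW C0) // ler_wiXn2l ?(ltW r0) ?(ltW r1) // leq_subr.
have nX : opnorm (X - 1%:M) <= (2 + (2 + C) * C) * (2 + C) * d.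
  by apply: near1_mul4 => //; exact: le_trans nd.
have nY : opnorm (Y - 1%:M) <= (2 + (2 + C) * C) * (2 + C) * d.
  by apply: near1_mul4 => //; exact: le_trans nd.
have uPn : Pn \in unitmx by exact: uA.
(* Conjugation moves the errors inwards: [Pn *m X *m Pn] becomes [Pn *m Pn *m U], and symmetrically
   for [Y] and [V]. *)
pose U := invmx Pn *m X *m Pn; pose V := Pn *m Y *m invmx Pn.
have bun : opnorm Pn * opnorm (invmx Pn) * rho ^+ n <= (K ^+ 2 / theta) ^+ M * theta ^+ n.
  exact: (@cocycle_bunching _ _ _ _ A rho K theta M hrho K1 htheta hS).
have c4d : opnorm (invmx Pn) * ((2 + (2 + C) * C) * (2 + C) * d) * opnorm Pn <= c4 * theta ^+ n.
  have -> : d = C * rho ^+ n * rho ^- n1.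
    by rewrite /d -mulrA -exprB ?unitfE ?gt_eqF ?(ltnW nn1).
  rewrite (_ : _ * _ * opnorm Pn = (opnorm Pn * opnorm (invmx Pn) * rho ^+ n) *
    ((2 + (2 + C) * C) * (2 + C) * C * rho ^- n1)); last by ring.
  rewrite (_ : c4 * _ = ((K ^+ 2 / theta) ^+ M * theta ^+ n) *
    ((2 + (2 + C) * C) * (2 + C) * C * rho ^- n1)); last first.
    by rewrite /c4; move: ((K ^+ 2 / theta) ^+ M) => q; ring.
  by rewrite ler_wpM2r // mulr_ge0.
have nU : opnorm (U - 1%:M) <= c4 * theta ^+ n.
  have -> : U - 1%:M = invmx Pn *m (X - 1%:M) *m Pn.
    by rewrite mulmxBr mulmxBl mulmx1 mulVmx.
  apply: le_trans _ c4d; apply: le_trans (opnormM _ _) _; rewrite ler_wpM2r ?opnorm_ge0 //.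
  by apply: le_trans (opnormM _ _) _; rewrite ler_wpM2l ?opnorm_ge0.
have nV : opnorm (V - 1%:M) <= c4 * theta ^+ n.
  have -> : V - 1%:M = Pn *m (Y - 1%:M) *m invmx Pn.
    by rewrite mulmxBr mulmxBl mulmx1 mulmxV.
  apply: le_trans _ c4d; apply: le_trans (opnormM _ _) _.
  have ac (x1 x2 x3 : R) : x1 * x2 * x3 = (x3 * x2) * x1 by ring.
  rewrite [leRHS]ac ler_wpM2r ?opnorm_ge0 //.
  by apply: le_trans (opnormM _ _) _; rewrite ler_wpM2l ?opnorm_ge0.
exists (U *m (hs *m hu) *m V).
  have sh1 : sigma_shift (a + n + (n + n))%N%:Z w0 = w2.
    by rewrite sigma_shiftD; congr (sigma_shift _ w); clear; lia.
  have sh2 : sigma_shift (a + n)%N%:Z w0 = w1.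
    by rewrite sigma_shiftD; congr (sigma_shift _ w); clear; lia.
  have sh3 : sigma_shift n%:Z e2 = eta.
    by rewrite sigma_shiftD addrN sigma_shift0.
  have sh4 : sigma_shift n%:Z z1 = z.
    by rewrite sigma_shiftD addrN sigma_shift0.
  have sh5 : sigma_shift a%:Z s = zeta.
    by rewrite sigma_shiftD addrN sigma_shift0.
  rewrite (cocycle_posD A (a + n + (n + n)) (n + b)) (cocycle_posD A (a + n) (n + n)) sh1 sh2.
  rewrite eE7 (cocycle_posD A n b) sh3 eE8.
  rewrite eE4 eE3 (cocycle_posD A n n z1) sh4 eE5 eE6.
  rewrite eE1 (cocycle_posD A a n) sh5 eE2.
  rewrite /U /V /X /Y !mulmxA; by rewrite (mulmxK uPn) (mulmxKV uPn).
have e4 : c4 * theta ^+ n <= c4 by rewrite ler_piMr // exprn_ile1 // ltW.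
have -> : U *m (hs *m hu) *m V - hs *m hu = (U - 1%:M) *m (hs *m hu) + U *m (hs *m hu) *m (V - 1%:M).
  by rewrite mulmxBl mul1mx mulmxBr mulmx1 [RHS]addrC [RHS]addrA subrK.
apply: le_trans (opnormD _ _) _; rewrite [leRHS]mulrDl; apply: lerD.
  by apply: le_trans (opnormM _ _) _; rewrite mulrAC ler_wpM2r ?opnorm_ge0.
apply: le_trans (opnormM _ _) _.
rewrite (_ : (1 + c4) * c4 * _ * _ = (1 + c4) * opnorm (hs *m hu) * (c4 * theta ^+ n)); last by ring.
rewrite ler_pM ?opnorm_ge0 //; apply: le_trans (opnormM _ _) _.
by rewrite ler_wpM2r ?opnorm_ge0 // opnorm_near1 // (le_trans nU).
Qed.

End HomoclinicExcursion.

Lemma product_lower_bound (R : realType) (a b h g T m1 m2 c s : R) :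
  0 <= a -> 0 <= b -> 0 < c -> 0 <= m1 -> 0 <= m2 -> 0 <= T ->
  a <= m1 * g -> b <= h * m2 -> c * (h * g) <= T -> m1 * m2 / c <= s -> a * b <= s * T.
Proof.
move=> a0 b0 c0 m10 m20 T0 ha hb hT hs.
apply: le_trans (ler_pM a0 b0 ha hb) _.
have -> : m1 * g * (h * m2) = m1 * m2 / c * (c * (h * g)).
  by field; rewrite gt_eqF.
have mc : 0 <= m1 * m2 / c by rewrite divr_ge0 ?mulr_ge0 // ltW.
apply: le_trans (ler_wpM2l mc hT) _.
by rewrite ler_wpM2r.
Qed.

Section Gluing.
Context {N : nat} {Q : 'M[bool]_N} {R : realType} {k : nat}.
Local Notation Sigma := (subshift Q).
Variables (A : Sigma -> 'M[R]_k) (omega r : R).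
Hypotheses (homega : 0 < omega < 1) (hr : 0 < r).
Hypothesis hmix : topologically_mixing (Q := Q) omega.
Hypothesis hA : typical_map A omega r.
Implicit Types x y z : Sigma.

Local Notation AA := (cocycle_pos A).

(** The point [v] follows [x], connects to [p] in [L] steps, makes an excursion of length [4 * n2],
    connects to [y] in [L] steps and follows [y]. Its cocycle is [h *m mid *m g] with [g] and [h]
    equal, up to bounded factors, to the cocycles of [x] and [y], so that [uniform_twisting]
    applies. *)
Lemma cocycle_gluing : exists2 c, 0 < c & exists g : nat, forall x n y m,
  exists v : Sigma, exists2 l : nat, (l <= g)%N &
  [/\ forall i : int, i < n%:Z -> symbol v i = symbol x i,
      forall i : int, 0 <= i -> symbol (sigma_shift (n + l)%N%:Z v) i = symbol y i
    & forall t : 'I_k.+1, opnorm (extpow t (AA n x)) * opnorm (extpow t (AA m y)) <=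
        c * opnorm (extpow t (AA (n + l + m) v))].
Proof.
have [hAb [p [z [lam [v [psi [[wsz wuz zp [l hl ss] [[hs [hu [HS HU epsi]]] gp1]] ht]]]]]]] := hA.
have hrho := rho_bounds homega hr; set rho := omega `^ r in hrho.
have [K [theta [M [K1 hth AK hS hU]]]] := close_factors_exist homega hr hAb.
have AU := A_unit hAb; have uAA := cocycle_pos_unit hAb.
have [l0 hper _] := hl.
have [ns [zs1 [uhs Zs1]]] := extended_stable_holonomy hrho K1 hth AU hS wsz HS.
have [nu [zu1 [uhu Zu1]]] := extended_unstable_holonomy hrho K1 hth AU hU wuz HU.
pose n1 := (ns + nu).+1.
have C0 : 0 < hol_const K theta M by exact: hol_const_gt0.
have /andP[r0 r1] := hrho; have /andP[th0 th1] := hth.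
have zs (i : int) : n1%:Z <= i -> symbol z i = symbol p i.
  by move=> hi; apply: zs1; move: hi; rewrite /n1; clear; lia.
have zu (i : int) : i <= - n1%:Z -> symbol z i = symbol p i.
  by move=> hi; apply: zu1; move: hi; rewrite /n1; clear; lia.
have [|| C1 exc] := @excursion_matrix _ _ _ _ A rho K theta M hrho K1 hth AU hS hU p z l hs hu n1
   hper zs zu.
- move=> n hn; have nn : (ns <= n)%N by move: hn; rewrite /n1; clear; lia.
  have [E e1 e2] := Zs1 n nn; exists E => //; apply: le_trans e2 _.
  rewrite ler_wpM2l ?(ltW C0) // ler_wiXn2l ?(ltW r0) ?(ltW r1) //.
  by rewrite /n1; clear; lia.
- move=> n hn; have nn : (nu <= n)%N by move: hn; rewrite /n1; clear; lia.
  have [E e1 e2] := Zu1 n nn; exists E => //; apply: le_trans e2 _.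
  rewrite ler_wpM2l ?(ltW C0) // ler_wiXn2l ?(ltW r0) ?(ltW r1) //.
  by rewrite /n1; clear; lia.
have [_ lam_inj nlam_inj hv] := ss; rewrite /= in hv.
pose V := eigen_mx v.
have uV : V \in unitmx by exact: eigen_mx_unit lam_inj hv.
have PV : AA l p *m V = V *m diag_mx (\row_i lam i) by exact: eigen_mxE hv.
have lam0 i : lam i != 0 by exact: eigenvalue_neq0 hv i (uAA l p).
(* Each side of the excursion crosses the periodic orbit twice, hence squared eigenvalues. *)
pose lam2 i := lam i ^+ 2.
have lam2_inj : injective (fun i => `|lam2 i|).
  move=> i j; rewrite /lam2 !normrX => /eqP; rewrite eqrXn2 // => /eqP; exact: nlam_inj.
have lam20 i : lam2 i != 0 by rewrite expf_neq0.
have upsi : psi \in unitmx by rewrite epsi unitmx_mul uhs.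
pose Psi := invmx V *m psi *m V.
have Pminors t (I J : multi_index t k) : \det (mxsub (mi_fun I) (mi_fun J) Psi) != 0.
  apply: twisting_minors => // t' ht'; have [_] := ht t' ht'; exact.
have powE j : AA (l * j) p *m V = V *m diag_pow lam j.
  elim: j => [|j IH].
    rewrite muln0 mul1mx /diag_pow (_ : \row__ _ = const_mx 1) ?diag_const_mx ?mulmx1 //.
    by apply/matrixP => i j; rewrite !mxE expr0.
  rewrite mulnSr cocycle_posD (period_mul hper) -mulmxA IH mulmxA PV -mulmxA.
  congr (_ *m _); apply/matrixP => i i'; rewrite /diag_pow mul_diag_mx !mxE.
  by case: eqP => [->|]; rewrite ?mulr0n ?mulr0 // !mulr1n exprS.
have pow2E j : AA (l * j) p *m AA (l * j) p = V *m diag_pow lam2 j *m invmx V.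
  have -> : diag_pow lam2 j = diag_pow lam j *m diag_pow lam j.
    apply/matrixP => i i'; rewrite /diag_pow mul_diag_mx !mxE.
    by case: eqP => [->|]; rewrite ?mulr0n ?mulr0 // !mulr1n /lam2 -exprM mul2n -addnn exprD.
  by rewrite mulmxA -powE -(mulmxA (AA _ p)) -powE !mulmxA mulmxK.
pose C2 := opnorm (invmx V) * `|C1| * opnorm V.
pose kappa j := C2 * theta ^+ j.
have C20 : 0 <= C2 by rewrite !mulr_ge0 ?opnorm_ge0.
have kappa0 e : 0 < e -> exists n0, forall n, (n0 <= n)%N -> kappa n <= e.
  by move=> e0; apply: geometric_small => //; rewrite (ltW th0) th1.
have [c c0 [jmax twist]] := uniform_twisting lam2_inj lam20 Pminors kappa0 n1.+1.
have [L L0 conn] := mixing_connection homega hmix.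
(* Bounds for the matrices that recover the cocycles of [x] and [y] from [g] and [h]: distortion,
   connection of length [L], holonomy and change of basis. *)
pose B1 := (1 + hol_const K theta M) * K ^+ L * (1 + hol_const K theta M) * opnorm V.
pose B2 := opnorm (invmx V) * (1 + hol_const K theta M) * K ^+ L * (1 + hol_const K theta M).
have /choice[M1 hM1] : forall t : 'I_k.+1, exists M1, 0 < M1 /\
    forall B : 'M[R]_k, opnorm B <= B1 -> opnorm (extpow t B) <= M1.
  by move=> t; have [m m0 hm] := @opnorm_extpow_bound R t k B1; exists m.
have /choice[M2 hM2] : forall t : 'I_k.+1, exists M2, 0 < M2 /\
    forall B : 'M[R]_k, opnorm B <= B2 -> opnorm (extpow t B) <= M2.
  by move=> t; have [m m0 hm] := @opnorm_extpow_bound R t k B2; exists m.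
have M10 t : 0 < M1 t by have [] := hM1 t.
have M20 t : 0 < M2 t by have [] := hM2 t.
have S0 t : 0 <= M1 t * M2 t / c by rewrite divr_ge0 ?mulr_ge0 ?ltW.
exists (1 + \sum_t M1 t * M2 t / c); first by rewrite ltr_pwDl // sumr_ge0.
exists (2 * L + 4 * (l * jmax))%N => x n y m.
have [zeta' [z1 z2]] := conn (sigma_shift n%:Z x) p.
have [eta [e1 e2]] := conn p y.
pose zeta := sigma_shift L%:Z zeta'.
have hz (i : int) : 0 <= i -> symbol zeta i = symbol p i.
  move=> hi; rewrite symbol_shift z2; last by rewrite lerDr.
  by congr (symbol p _); move: hi; clear; lia.
pose a := (n + L)%N; pose b := (L + m)%N; pose s := sigma_shift (- a%:Z) zeta.
pose g := invmx V *m (Hsloc A p zeta *m AA a s).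
pose h := AA b eta *m Huloc A eta p *m V.
have [H1 H1n] := stable_holonomy_inv hrho K1 hth hS hz.
have [H2 _] := stable_holonomy_inv hrho K1 hth hS (fun i hi => esym (hz i hi)).
have e0 (i : int) : i < 0 -> symbol eta i = symbol p i by move=> /ltW; exact: e1.
have [H3 _] := unstable_holonomy_inv hrho K1 hth hU e0.
have [H4 H4n] := unstable_holonomy_inv hrho K1 hth hU (fun i hi => esym (e0 i hi)).
have ug : g \in unitmx by rewrite !unitmx_mul unitmx_inv uV uAA (mulmx1_unit H1).1.
have uh : h \in unitmx by rewrite !unitmx_mul uV uAA (mulmx1_unit H4).1.
(* The length is fixed by [g] and [h] alone; only then is the excursion built, whose matrix [psi']
   depends on [j]. *)
have [j /andP[jn1 jmx] tw] := twist g h ug uh.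
have nj : (n1 < l * j)%N by rewrite (leq_trans jn1) // leq_pmull.
have [w [wa wb wab]] := exc j nj zeta eta hz e1.
have [psi' eP nP] := wab a b.
set n2 := (l * j)%N in nj wa wb wab eP nP.
have n2mx : (n2 <= l * jmax)%N by rewrite leq_mul2l jmx orbT.
have psiK i i' : `|(invmx V *m psi' *m V) i i' - Psi i i'| <= kappa j.
  have -> : (invmx V *m psi' *m V) i i' - Psi i i' = (invmx V *m (psi' - psi) *m V) i i'.
    by rewrite mulmxBr mulmxBl [RHS]mxE [X in _ = _ + X]mxE.
  apply: le_trans (opnorm_entry _ _ _) _; apply: le_trans (opnormM _ _) _.
  rewrite /kappa /C2 mulrAC ler_wpM2r ?opnorm_ge0 //; apply: le_trans (opnormM _ _) _.
  rewrite -mulrA ler_wpM2l ?opnorm_ge0 // epsi; apply: le_trans nP _.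
  apply: (@le_trans _ _ (`|C1| * theta ^+ n2)).
    by rewrite ler_wpM2r ?exprn_ge0 ?(ltW th0) // ler_norm.
  by rewrite ler_wpM2l // ler_wiXn2l ?(ltW th0) ?(ltW th1) // /n2 leq_pmull.
exists (sigma_shift (- (n2 + n2 + a)%N%:Z) w), (2 * L + 4 * n2)%N.
  by rewrite leq_add2l leq_mul2l n2mx orbT.
split.
- move=> i hi; rewrite wa; last by rewrite /a; move: hi; clear; lia.
  rewrite symbol_shift symbol_shift z1; last by rewrite /a; move: hi; clear; lia.
  by rewrite symbol_shift; congr (symbol x _); rewrite /a; clear; lia.
- move=> i hi.
  have -> : symbol (sigma_shift (n + (2 * L + 4 * n2))%N%:Z (sigma_shift (- (n2 + n2 + a)%N%:Z) w)) i
     = symbol (sigma_shift n2%:Z w) (i + (L + n2)%N%:Z).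
    rewrite !symbol_shift; congr (symbol w _); rewrite /a; clear; lia.
  rewrite wb; last by move: hi; clear; lia.
  rewrite symbol_shift e2; last by move: hi; clear; lia.
  by congr (symbol y _); clear; lia.
move=> t.
have lenE : (n + (2 * L + 4 * n2) + m)%N = (a + n2 + (n2 + n2) + (n2 + b))%N.
  by rewrite /a /b; clear; lia.
have eP' : AA (n + (2 * L + 4 * n2) + m) (sigma_shift (- (n2 + n2 + a)%N%:Z) w) =
    h *m (diag_pow lam2 j *m (invmx V *m psi' *m V) *m diag_pow lam2 j) *m g.
  by rewrite lenE eP pow2E /h /g !mulmxA.
rewrite eP'.
have {}tw := tw _ psiK t.
have hx : opnorm (extpow t (AA n x)) <= M1 t * opnorm (extpow t g).
  have [|D eD nD] := @unstable_factor _ _ _ _ A rho K theta M hrho K1 hth AU hU 0 x s n.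
    move=> i; rewrite addr0 => hi; rewrite symbol_shift symbol_shift z1; last by rewrite /a; move: hi; clear; lia.
    by rewrite symbol_shift; congr (symbol x _); rewrite /a; clear; lia.
  have -> : AA n x = (D *m invmx (AA L (sigma_shift n%:Z s)) *m Hsloc A zeta p *m V) *m g.
    rewrite /g !mulmxA mulmxK // -(mulmxA _ (Hsloc A zeta p)) H2 mulmx1.
    by rewrite /a cocycle_posD !mulmxA mulmxKV.
  apply: le_trans (opnorm_extpowM _ _ _) _; rewrite ler_wpM2r ?opnorm_ge0 //.
  apply: (hM1 t).2; rewrite /B1; apply: opnormM_le; last exact: lexx.
  apply: opnormM_le; last exact: H1n.
  apply: opnormM_le; last exact: (cocycle_pos_bound AU AK _ _).2.
  by apply: opnorm_near1; move: nD; rewrite expr0 mulr1.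
have hy : opnorm (extpow t (AA m y)) <= opnorm (extpow t h) * M2 t.
  have [|D eD nD] := @stable_factor _ _ _ _ A rho K theta M hrho K1 hth AU hS 0 y (sigma_shift L%:Z eta) m.
    move=> i; rewrite oppr0 => hi; rewrite symbol_shift e2; last by move: hi; clear; lia.
    by congr (symbol y _); clear; lia.
  have -> : AA m y = h *m (invmx V *m Huloc A p eta *m invmx (AA L eta) *m D).
    rewrite /h !mulmxA mulmxK // -(mulmxA _ (Huloc A eta p)) H4 mulmx1.
    by rewrite /b cocycle_posD mulmxK.
  apply: le_trans (opnorm_extpowM _ _ _) _; rewrite ler_wpM2l ?opnorm_ge0 //.
  apply: (hM2 t).2; rewrite /B2; apply: opnormM_le; last first.
    by apply: opnorm_near1; move: nD; rewrite expr0 mulr1.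
  apply: opnormM_le; last exact: (cocycle_pos_bound AU AK _ _).2.
  apply: opnormM_le; [exact: lexx | exact: H4n].
apply: (product_lower_bound _ _ c0 (ltW (M10 t)) (ltW (M20 t)) _ hx hy tw); rewrite ?opnorm_ge0 //.
by rewrite (bigD1 t) //= addrCA lerDl addr_ge0 // sumr_ge0.
Qed.

End Gluing.

Lemma dist_step (R : realType) (a b c d e : R) :
  `|b - a| <= d -> c <= e + b -> b <= e + c -> `|c - a| <= d + e.
Proof. by rewrite !ler_norml => /andP[h1 h2] h3 h4; apply/andP; split; lra. Qed.

Lemma dist_le_sym (R : realType) (a b e f : R) :
  a <= e + b -> b <= e + a -> e <= f -> `|a - b| <= f.
Proof. by rewrite ler_norml => h1 h2 h3; apply/andP; split; lra. Qed.

Lemma glue_estimate (R : realType) (X Y Z W a b b' G m c s f : R) :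
  `|X - Y| <= G -> `|Z - W| <= G -> a + b <= c + Y -> Y <= b' + Z -> W <= m + a -> b' <= m + b ->
  0 <= m -> 0 <= G -> c <= s -> 0 <= s -> s + 2 * m + 2 * G <= f -> `|X - (a + b)| <= f.
Proof.
rewrite !ler_norml => /andP[h1 h2] /andP[h3 h4] h5 h6 h7 h8 h9 h10 h11 h12 h13.
by apply/andP; split; lra.
Qed.

(** * Almost additivity of the logarithms of the norms *)

Section LogNorms.
Context {N : nat} {Q : 'M[bool]_N} {R : realType} {k : nat}.
Local Notation Sigma := (subshift Q).
Variables (A : Sigma -> 'M[R]_k) (omega r : R).
Hypotheses (homega : 0 < omega < 1) (hr : 0 < r).
Hypothesis hmix : topologically_mixing (Q := Q) omega.
Hypothesis hA : typical_map A omega r.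
Implicit Types x y z : Sigma.

Definition log_norm (i : 'I_k) (n : nat) x : R := ln (opnorm (extpow i.+1 (cocycle A n%:Z x))).

Lemma extpow_cocycle_gt0 (t : 'I_k.+1) n x : 0 < opnorm (extpow t (cocycle_pos A n x)).
Proof.
apply: opnorm_unit_gt0; first by apply: card_multi_index_gt0; rewrite -ltnS.
exact/extpow_unit/(cocycle_pos_unit hA.1).
Qed.

(** The estimates on which the entropy argument rests. The connecting length [l] varies, but one
    step changes a logarithm by a bounded amount, so the glued point may be evaluated at the fixed
    time [n + m + g]. *)
Lemma log_norm_properties : exists2 C, 1 <= C & exists g : nat,
  [/\ forall i x, `|log_norm i 0 x| <= C,
      forall i n x y, (forall j : nat, (j < n)%N -> symbol x j = symbol y j) ->
        `|log_norm i n x - log_norm i n y| <= C,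
      forall i n m x, `|log_norm i (n + m) x - log_norm i n x| <= C * m%:R
    & forall x n y m, exists v : Sigma, exists2 l : nat, (l <= g)%N &
      [/\ forall i : int, i < n%:Z -> symbol v i = symbol x i,
          forall i : int, 0 <= i -> symbol (sigma_shift (n + l)%N%:Z v) i = symbol y i
        & forall i, `|log_norm i (n + m + g) v - (log_norm i n x + log_norm i m y)| <= C]].
Proof.
have [hAb _] := hA; have hrho := rho_bounds homega hr.
have [K [theta [M [K1 hth AK hS hU]]]] := close_factors_exist homega hr hAb.
have AU := A_unit hAb.
have [c c0 [g glue]] := cocycle_gluing homega hr hmix hA.
pose K2 := K + (1 + hol_const K theta M).
have h0 : 0 < hol_const K theta M by exact: hol_const_gt0.
have /choice[Mt hMt] : forall t : 'I_k.+1, exists M1, 0 < M1 /\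
    forall B : 'M[R]_k, opnorm B <= K2 -> opnorm (extpow t B) <= M1.
  by move=> t; have [m m0 hm] := @opnorm_extpow_bound R t k K2; exists m.
pose MM := 1 + \sum_t Mt t.
have MM1 : 1 <= MM by rewrite lerDl sumr_ge0 // => t _; have [/ltW] := hMt t.
have MM0 : 0 < MM by exact: lt_le_trans MM1.
have MME (t : 'I_k.+1) (B : 'M[R]_k) : opnorm B <= K2 -> opnorm (extpow t B) <= MM.
  move=> hB; apply: le_trans ((hMt t).2 B hB) _; rewrite /MM (bigD1 t) //= addrCA lerDl.
  by rewrite addr_ge0 // sumr_ge0 // => s _; have [/ltW] := hMt s.
pose phi (t : 'I_k.+1) n x := opnorm (extpow t (cocycle_pos A n x)).
have phi0 t n x : 0 < phi t n x by exact: extpow_cocycle_gt0.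
have lnE i n x : log_norm i n x = ln (phi (lift ord0 i) n x) by [].
have lnle t n x n' x' a : 0 < a -> phi t n x <= a * phi t n' x' ->
    ln (phi t n x) <= ln a + ln (phi t n' x').
  by move=> a0 h; rewrite -lnM ?posrE // ler_ln ?posrE // mulr_gt0.
have lnMM : 0 <= ln MM by exact: ln_ge0.
have stepE t n x : phi t n.+1 x <= MM * phi t n x /\ phi t n x <= MM * phi t n.+1 x.
  have [a1 a2] := AK (sigma_shift n%:Z x); rewrite /phi /=; split.
    apply: le_trans (opnorm_extpowM _ _ _) _; rewrite ler_wpM2r ?opnorm_ge0 // MME //.
    by rewrite (le_trans a1) // lerDl addr_ge0 // ltW.
  have {1}-> : cocycle_pos A n x = invmx (A (sigma_shift n%:Z x)) *m
      (A (sigma_shift n%:Z x) *m cocycle_pos A n x) by rewrite mulKmx.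
  apply: le_trans (opnorm_extpowM _ _ _) _; rewrite ler_wpM2r ?opnorm_ge0 // MME //.
  by rewrite (le_trans a2) // lerDl addr_ge0 // ltW.
have E t n m x : `|ln (phi t (n + m)%N x) - ln (phi t n x)| <= ln MM * m%:R.
  elim: m => [|m IH]; first by rewrite addn0 subrr normr0 mulr0.
  have [s1 s2] := stepE t (n + m)%N x.
  have {s1} s1 := lnle _ _ _ _ _ _ MM0 s1; have {s2} s2 := lnle _ _ _ _ _ _ MM0 s2.
  have -> : ln MM * m.+1%:R = ln MM * m%:R + ln MM by rewrite -natr1 mulrDr mulr1.
  by rewrite addnS; exact: dist_step IH s1 s2.
have D t n x y : (forall j : nat, (j < n)%N -> symbol x j = symbol y j) ->
    ln (phi t n x) <= ln MM * 2 + ln (phi t n y).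
  move=> e; have [D1 [D2 [eD n1 n2]]] := cocycle_distortion hrho K1 hth AU hS hU e.
  have -> : ln MM * 2 = ln (MM * MM) by rewrite lnM ?posrE // mulr2n mulrDr mulr1.
  apply: lnle; first exact: mulr_gt0.
  rewrite /phi eD mulrAC; apply: le_trans (opnorm_extpowM _ _ _) _.
  have K2D : 1 + hol_const K theta M <= K2 by rewrite lerDr (le_trans _ K1).
  rewrite ler_pM ?opnorm_ge0 ?MME ?(le_trans n2) //.
  apply: le_trans (opnorm_extpowM _ _ _) _; rewrite ler_wpM2r ?opnorm_ge0 ?MME //.
  exact: le_trans n1 _.
have g0 : 0 <= ln MM * g%:R by rewrite mulr_ge0.
(* Bounds the values at time 0, where the cocycle is the identity. *)
pose c1 := \sum_(i < k) `|ln (opnorm (extpow i.+1 (1%:M : 'M[R]_k)))|.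
have c10 : 0 <= c1 by rewrite sumr_ge0.
pose C := 1 + c1 + ln MM * 4 + `|ln c| + ln MM * g%:R * 2.
have nlc : 0 <= `|ln c| by [].
have [C1 [Cc [CM CG]]] : 1 <= C /\ c1 <= C /\ ln MM * 4 <= C /\
    `|ln c| + 2 * (ln MM * 2) + 2 * (ln MM * g%:R) <= C.
  by rewrite /C; move: g0 c10 lnMM nlc; move: (ln MM * g%:R) (c1) (ln MM) `|ln c| => *; lra.
have CM1 : ln MM <= C by apply: le_trans CM; rewrite ler_peMr // ler1n.
have CM2 : ln MM * 2 <= C by apply: le_trans CM; rewrite ler_wpM2l // ler_nat.
clearbody C; exists C => //; exists g; split.
- move=> i x; rewrite /log_norm /=; apply: le_trans Cc.
  by rewrite /c1 (bigD1 i) //= lerDl sumr_ge0.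
- move=> i n x y e; rewrite !lnE; apply: dist_le_sym CM2; apply: D => // j jn.
  by rewrite e.
- by move=> i n m x; rewrite !lnE; apply: le_trans (E _ _ _ _) _; rewrite ler_wpM2r.
- move=> x n y m; have [v [l lg [h1 h2 h3]]] := glue x n y m.
  exists v, l => //; split=> // i; rewrite !lnE.
  set t := lift ord0 i.
  have hg : `|ln (phi t (n + l + m + (g - l))%N v) - ln (phi t (n + l + m)%N v)| <= ln MM * g%:R.
    by apply: le_trans (E _ _ _ _) _; rewrite ler_wpM2l // ler_nat leq_subr.
  have eqn : (n + l + m + (g - l) = n + m + g)%N by move: lg; clear; lia.
  rewrite eqn in hg.
  have hl : `|ln (phi t (n + l)%N v) - ln (phi t n v)| <= ln MM * g%:R.
    by apply: le_trans (E _ _ _ _) _; rewrite ler_wpM2l // ler_nat.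
  have low : ln (phi t n x) + ln (phi t m y) <= ln c + ln (phi t (n + l + m)%N v).
    rewrite -!lnM ?posrE // ler_ln ?posrE ?mulr_gt0 //; exact: h3.
  have up : ln (phi t (n + l + m)%N v) <= ln (phi t m (sigma_shift (n + l)%N%:Z v)) + ln (phi t (n + l)%N v).
    rewrite -lnM ?posrE // ler_ln ?posrE ?mulr_gt0 // /phi cocycle_posD.
    exact: opnorm_extpowM.
  have d1 : ln (phi t n v) <= ln MM * 2 + ln (phi t n x) by apply: D => j jn; exact: h1.
  have d2 : ln (phi t m (sigma_shift (n + l)%N%:Z v)) <= ln MM * 2 + ln (phi t m y).
    by apply: D => j jn; exact: h2.
  apply: glue_estimate hg hl low up d1 d2 _ g0 (ler_norm _) nlc CG.
  by rewrite mulr_ge0.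
Qed.

End LogNorms.

(** * Words and partition sums *)

Lemma dist_triangle3 (R : realType) (a b c d x y z : R) :
  `|a - b| <= x -> `|b - c| <= y -> `|c - d| <= z -> `|a - d| <= x + y + z.
Proof.
move=> h1 h2 h3; have -> : a - d = (a - b) + (b - c) + (c - d) by ring.
apply: le_trans (ler_normD _ _) _; apply: lerD => //.
by apply: le_trans (ler_normD _ _) _; exact: lerD.
Qed.

Section Words.
Context {N : nat} {Q : 'M[bool]_N}.
Local Notation Sigma := (subshift Q).
Implicit Types x y : Sigma.

Definition word n x : {ffun 'I_n -> 'I_N} := [ffun j : 'I_n => symbol x (j : nat)%:Z].

Lemma word_eqP n x y : word n x = word n y <->
  forall j : nat, (j < n)%N -> symbol x j%:Z = symbol y j%:Z.
Proof.
split=> [/ffunP h j jn|h]; first by have := h (Ordinal jn); rewrite !ffunE.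
by apply/ffunP => j; rewrite !ffunE h.
Qed.

Definition language n : {set {ffun 'I_n -> 'I_N}} :=
  [set w | `[< exists x, word n x = w >]]%SET.

Lemma word_language n x : word n x \in language n.
Proof. by rewrite inE; apply/asboolP; exists x. Qed.

Variable x0 : Sigma.

(** Evaluates functions of points on words, at the price of the distortion constant; the default
    [x0] is taken outside the language. *)
Definition rep n (w : {ffun 'I_n -> 'I_N}) : Sigma := xget x0 [set x | word n x = w].

Lemma repK n w : w \in language n -> word n (rep w) = w.
Proof. by rewrite inE => /asboolP ex; apply: (xgetPex x0 ex). Qed.

Lemma rep_word n x j : (j < n)%N -> symbol (rep (word n x)) j%:Z = symbol x j%:Z.
Proof. by move: j; apply/word_eqP; rewrite repK // word_language. Qed.

End Words.

Section GluedSequences.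
Context {N : nat} {Q : 'M[bool]_N} {R : realType} {k : nat}.
Local Notation Sigma := (subshift Q).
Local Notation lang := (@language N Q).
Variables (psi : 'I_k -> nat -> Sigma -> R) (C : R) (g : nat) (x0 : Sigma).
Implicit Types x y : Sigma.
Hypothesis C1 : 1 <= C.
Hypothesis psi0 : forall i x, `|psi i 0 x| <= C.
Hypothesis psiD : forall i n x y, (forall j : nat, (j < n)%N -> symbol x j = symbol y j) ->
  `|psi i n x - psi i n y| <= C.
Hypothesis psiE : forall i n m x, `|psi i (n + m) x - psi i n x| <= C * m%:R.
Hypothesis psiG : forall x n y m, exists v : Sigma, exists2 l : nat, (l <= g)%N &
  [/\ forall i : int, i < n%:Z -> symbol v i = symbol x i,
      forall i : int, 0 <= i -> symbol (sigma_shift (n + l)%N%:Z v) i = symbol y i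
    & forall i, `|psi i (n + m + g) v - (psi i n x + psi i m y)| <= C].

Let C0 : 0 <= C. Proof. exact: le_trans C1. Qed.

Lemma psi_bound i n x : `|psi i n x| <= C * n.+1%:R.
Proof.
have := psiE i 0 n x; rewrite add0n => h; rewrite -[psi i n x](subrK (psi i 0 x)).
apply: le_trans (ler_normD _ _) _; apply: le_trans (lerD h (psi0 i x)) _.
by rewrite -natr1 mulrDr mulr1.
Qed.

Definition gluing n x m y : Sigma := sval (cid (psiG x n y m)).
Definition glue_gap n x m y : nat := s2val (cid2 (svalP (cid (psiG x n y m)))).

Lemma glue_gap_le n x m y : (glue_gap n x m y <= g)%N.
Proof. by rewrite /glue_gap; case: (cid2 _). Qed.

Lemma glueP n x m y :
  [/\ forall i : int, i < n%:Z -> symbol (gluing n x m y) i = symbol x i,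
      forall i : int, 0 <= i ->
        symbol (sigma_shift (n + glue_gap n x m y)%N%:Z (gluing n x m y)) i = symbol y i
    & forall i, `|psi i (n + m + g) (gluing n x m y) - (psi i n x + psi i m y)| <= C].
Proof. by rewrite /glue_gap; case: (cid2 _). Qed.

Section Sequence.
Variables (nn : nat -> nat) (y : nat -> Sigma).

(** Every block is charged the full [g], although the actual gap may be shorter. Positions of levels
    are thus independent of the blocks; the coordinates after a block are whatever the glued point
    happens to have there. *)
Fixpoint glued_length l := if l is j.+1 then (glued_length j + nn j + g)%N else 0%N.

Fixpoint glued l : Sigma :=
  if l is j.+1 then gluing (glued_length j) (glued j) (nn j) (y j) else x0.

Definition gap l := glue_gap (glued_length l) (glued l) (nn l) (y l).

Lemma glued_length_le l l' : (l <= l')%N -> (glued_length l <= glued_length l')%N.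
Proof.
elim: l' => [|l' IH]; first by rewrite leqn0 => /eqP ->.
rewrite leq_eqVlt => /orP[/eqP -> //|]; rewrite ltnS => /IH h.
by rewrite (leq_trans h) //= -addnA leq_addr.
Qed.

Lemma glued_agree l l' (i : int) : (l <= l')%N -> i < (glued_length l)%:Z ->
  symbol (glued l') i = symbol (glued l) i.
Proof.
move=> ll hi; elim: l' ll => [|l' IH]; first by rewrite leqn0 => /eqP ->.
rewrite leq_eqVlt => /orP[/eqP -> //|]; rewrite ltnS => ll.
have [h _ _] := glueP (glued_length l') (glued l') (nn l') (y l').
rewrite /= h ?IH //; apply: lt_le_trans hi _; rewrite lez_nat.
exact: glued_length_le.
Qed.

Lemma glued_psi i l :
  `|psi i (glued_length l) (glued l) - \sum_(j < l) psi i (nn j) (y j)| <= C * l.+1%:R.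
Proof.
elim: l => [|l IH]; first by rewrite big_ord0 subr0 mulr1 psi0.
have [_ _ h] := glueP (glued_length l) (glued l) (nn l) (y l).
rewrite big_ord_recr /= -natr1 mulrDr mulr1; move: (h i) IH.
set a := psi i _ (gluing _ _ _ _); set b := psi i _ (glued l); set c := psi i (nn l) _.
set s := \sum_(_ < _) _ => h1 h2.
have -> : a - (s + c) = (b - s) + (a - (b + c)) by ring.
by apply: le_trans (ler_normD _ _) _; rewrite lerD.
Qed.

Lemma glued_subword l L j (w : Sigma) : (l < L)%N ->
  (forall i : int, i < (glued_length l.+1)%:Z -> symbol w i = symbol (glued L) i) ->
  (j < nn l)%N -> symbol w (glued_length l + gap l + j)%N%:Z = symbol (y l) j%:Z.
Proof.
move=> lL hw jn; have gg : (gap l <= g)%N by exact: glue_gap_le.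
have hb : (glued_length l + gap l + j < glued_length l.+1)%N by rewrite /=; lia.
rewrite hw ?ltz_nat // (glued_agree lL) ?ltz_nat //.
have [_ h _] := glueP (glued_length l) (glued l) (nn l) (y l).
have := h j%:Z isT; rewrite symbol_shift /= => <-; congr (symbol _ _).
by rewrite -PoszD addnC.
Qed.

End Sequence.

Lemma glued_word_inj nn (y y' : nat -> Sigma) L M : (glued_length nn L <= M)%N ->
  word M (glued nn y L) = word M (glued nn y' L) ->
  (forall j, (j < L)%N -> gap nn y j = gap nn y' j) ->
  forall j, (j < L)%N -> word (nn j) (y j) = word (nn j) (y' j).
Proof.
move=> LM /word_eqP e hg j jL; apply/word_eqP => i hi.
have hb : (glued_length nn j + gap nn y j + i < M)%N.
  have := glued_length_le nn jL; have := glue_gap_le (glued_length nn j) (glued nn y j) (nn j) (y j).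
  rewrite -/(gap nn y j) /=; lia.
have := e _ hb; rewrite (glued_subword jL) // => ->.
by rewrite hg // (glued_subword jL).
Qed.

Section Blocks.
Variables (n M : nat).
Local Notation X := {ffun 'I_n -> 'I_N}.

Definition block_seq (f : {ffun 'I_M -> X}) (j : nat) : Sigma :=
  if insub j is Some i then rep x0 (f i) else x0.

Definition glued_block f := glued (fun=> n) (block_seq f) M.

Lemma block_length l : glued_length (fun=> n) l = (l * (n + g))%N.
Proof. by elim: l => [//|l IH] /=; rewrite IH -addnA addnC -mulSn. Qed.

Lemma block_seqE f (i : 'I_M) : block_seq f i = rep x0 (f i).
Proof. by rewrite /block_seq valK. Qed.

(* A glued word together with the gap lengths determines the blocks, so gluing is at most
   [g.+1 ^ M] to one. *)
Lemma sum_glued_block L (P : pred {ffun 'I_M -> X}) (F : {ffun 'I_L -> 'I_N} -> R) :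
  (M * (n + g) <= L)%N -> (forall f, P f -> forall i, f i \in lang n) ->
  (forall w, 0 <= F w) ->
  \sum_(f | P f) F (word L (glued_block f)) <=
    g.+1%:R ^+ M * \sum_(w in lang L) F w.
Proof.
move=> ML Pl F0.
pose Phi (f : {ffun 'I_M -> X}) : {ffun 'I_L -> 'I_N} * {ffun 'I_M -> 'I_g.+1} :=
  (word L (glued_block f), [ffun j : 'I_M => inord (gap (fun=> n) (block_seq f) j)]).
have inj_Phi : {in [set f | P f]%SET &, injective Phi}.
  move=> f f'; rewrite !inE => Pf Pf' [ew /ffunP eg].
  apply/ffunP => i.
  have := @glued_word_inj (fun=> n) (block_seq f) (block_seq f') M L.
  rewrite block_length => /(_ ML ew _ i (ltn_ord i)); rewrite !block_seqE.
  rewrite !repK ?Pl //; apply=> j jM; have := eg (Ordinal jM).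
  rewrite !ffunE /= => /(congr1 (@nat_of_ord _)); by rewrite !inordK ?ltnS ?glue_gap_le.
rewrite [leLHS](_ : _ = \sum_(u in Phi @: [set f | P f]%SET) F u.1); last first.
  by rewrite big_imset //=; apply: eq_bigl => f; rewrite inE.
apply: (@le_trans _ _ (\sum_(u : {ffun 'I_L -> 'I_N} * {ffun 'I_M -> 'I_g.+1} | u.1 \in lang L) F u.1)).
  rewrite [leRHS](bigID [pred u | u \in Phi @: [set f | P f]%SET]) /=.
  rewrite [X in _ <= X + _](_ : _ = \sum_(u in Phi @: [set f | P f]%SET) F u.1); last first.
    apply: eq_bigl => u /=; rewrite andb_idl // => /imsetP[f _ ->] /=.
    exact: word_language.
  by rewrite lerDl sumr_ge0.
rewrite le_eqVlt; apply/orP; left; apply/eqP.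
transitivity (\sum_(w in lang L) \sum_(o : {ffun 'I_M -> 'I_g.+1}) F w).
  by rewrite pair_big /=; apply: eq_bigl => u; rewrite andbT.
rewrite mulr_sumr; apply: eq_bigr => w _.
by rewrite sumr_const card_ffun !card_ord -[LHS]mulr_natl natrX.
Qed.

End Blocks.

Definition qpsi (q : 'rV[R]_k) n x : R := \sum_i q 0 i * psi i n x.
Definition qnorm (q : 'rV[R]_k) : R := \sum_i `|q 0 i|.
Definition Zsum (q : 'rV[R]_k) n : R := \sum_(w in lang n) expR (qpsi q n (rep x0 w)).

Lemma qnorm_ge0 q : 0 <= qnorm q. Proof. exact: sumr_ge0. Qed.

Lemma Zsum_gt0 q n : 0 < Zsum q n.
Proof.
rewrite /Zsum (bigD1 (word n x0)) ?word_language //= ltr_pwDl ?expR_gt0 // sumr_ge0 //.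
Qed.

Lemma qpsi_dist (q : 'rV[R]_k) (a b : 'I_k -> R) e : (forall i, `|a i - b i| <= e) ->
  `|\sum_i q 0 i * a i - \sum_i q 0 i * b i| <= qnorm q * e.
Proof.
move=> h; rewrite -sumrB; apply: le_trans (ler_norm_sum _ _ _) _.
rewrite mulr_suml ler_sum // => i _; rewrite -mulrBr normrM.
by rewrite ler_wpM2l.
Qed.

Lemma glued_block_psi n M L (f : {ffun 'I_M -> {ffun 'I_n -> 'I_N}}) i :
  (M * (n + g) <= L)%N ->
  `|psi i L (rep x0 (word L (glued_block f))) - \sum_j psi i n (rep x0 (f j))| <=
    C * (M + 2 + (L - M * (n + g)))%N%:R.
Proof.
move=> ML; set v := glued_block f.
have h1 : `|psi i L (rep x0 (word L v)) - psi i L v| <= C.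
  by apply: psiD => j; exact: rep_word.
have h2 := psiE i (M * (n + g)) (L - M * (n + g)) v; rewrite subnKC // in h2.
have h3 := glued_psi (fun=> n) (block_seq f) i M; rewrite block_length -/v in h3.
have e : \sum_(j < M) psi i n (block_seq f j) = \sum_j psi i n (rep x0 (f j)).
  by apply: eq_bigr => j _; rewrite block_seqE.
rewrite e in h3.
have -> : C * (M + 2 + (L - M * (n + g)))%N%:R = C + C * (L - M * (n + g))%N%:R + C * M.+1%:R.
  by rewrite addnS addn1 !natrD -[M.+2%:R]natr1 -[M.+1%:R]natr1; ring.
exact: dist_triangle3 h1 h2 h3.
Qed.

(** The power expands over [M]-tuples of words, each glued into one word of length [L]. The
    exponential pays for the errors of gluing and for the remaining [L - M * (n + g)] symbols, the
    power of [g.+1] for the multiplicity. *)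
Lemma Zsum_supermultiplicative q n M L : (M * (n + g) <= L)%N ->
  Zsum q n ^+ M <= g.+1%:R ^+ M *
    expR (qnorm q * (C * (M + 2 + (L - M * (n + g)))%N%:R)) * Zsum q L.
Proof.
move=> ML; set e := qnorm q * _.
have -> : Zsum q n ^+ M = \sum_(f in ffun_on [in lang n])
     \prod_(j < M) expR (qpsi q n (rep x0 (f j))).
  rewrite -(bigA_distr_big [in lang n] (fun (j : 'I_M) w => expR (qpsi q n (rep x0 w)))).
  by rewrite prodr_const card_ord.
apply: (@le_trans _ _ (\sum_(f in ffun_on [in lang n])
   (expR e * expR (qpsi q L (rep x0 (word L (glued_block f))))))).
  apply: ler_sum => f _; rewrite -expR_sum -expRD ler_expR.
  have -> : \sum_j qpsi q n (rep x0 (f j)) = \sum_i q 0 i * \sum_j psi i n (rep x0 (f j)).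
    by rewrite exchange_big /=; apply: eq_bigr => i _; rewrite mulr_sumr.
  have := qpsi_dist q (fun i => @glued_block_psi n M L f i ML).
  rewrite -/(qpsi q L _) -/e ler_norml => /andP[h _]; move: h.
  by rewrite lerBrDl lerBlDr addrC.
rewrite -mulr_sumr mulrAC [leRHS]mulrC ler_wpM2l ?(ltW (expR_gt0 _)) //.
by apply: sum_glued_block => // f /ffun_onP h i; exact: h.
Qed.

End GluedSequences.

(** * Words with prescribed exponents *)

Lemma archi_lt (R : realType) (x : R) : exists n : nat, x < n%:R.
Proof.
exists (Num.bound `|x|); apply: le_lt_trans (ler_norm x) _; exact: archi_boundP.
Qed.

(** A Fekete argument with gaps: one long [n] with a good value controls every large [L] through
    division by [n + g]. It turns the upper limit in the pressure into a lower bound for all large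
    lengths. *)
Lemma superadditive_liminf (R : realType) (z : nat -> R) (p a b : R) (g : nat) :
  0 <= a -> 0 <= b ->
  (forall n M L, (M * (n + g) <= L)%N ->
     M%:R * z n <= M%:R * b + a * (M + 2 + (L - M * (n + g)))%N%:R + z L) ->
  (forall e n0, 0 < e -> exists2 n, (n0 <= n)%N & n%:R * (p - e) <= z n) ->
  forall e, 0 < e -> exists n0, forall L, (n0 <= L)%N -> L%:R * (p - e) <= z L.
Proof.
move=> a0 b0 hz hp e e0.
have [n1 hn1] := archi_lt (2 / e * (1 + g%:R * `|p - e| + b + a)).
have [n nn1 zn] := hp (e / 2) n1.+1 (divr_gt0 e0 (ltr0n _ 2)).
have n0 : (0 < n)%N by exact: leq_ltn_trans nn1.
(* The losses per block are absorbed by [n * (e / 2)]; the spare 1 per block pays, once there are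
   [K] blocks, for the remainder. *)
have brk : 1 + g%:R * `|p - e| + b + a <= n%:R * (e / 2).
  have n1n : n1%:R <= n%:R :> R by rewrite ler_nat ltnW.
  have := le_trans (ltW hn1) n1n; rewrite mulrAC ler_pdivrMr // => h.
  by rewrite mulrA ler_pdivlMr // mulrC.
have [K hK] := archi_lt (2 * a + (n + g)%:R * (a + `|p - e|)).
exists (K * (n + g))%N => L hL.
pose M := (L %/ (n + g))%N; pose rem := (L %% (n + g))%N.
have ng0 : (0 < n + g)%N by rewrite addn_gt0 n0.
have LE : L = (M * (n + g) + rem)%N by exact: divn_eq.
have remlt : (rem < n + g)%N by exact: ltn_pmod.
have KM : (K <= M)%N by rewrite leq_divRL.
have := hz n M L; rewrite {1}LE leq_addr => /(_ isT).
rewrite {1}LE addKn {2}LE.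
clearbody M rem; clear LE hL hz hp.
rewrite !natrD natrM !natrD.
have KM' : K%:R <= M%:R :> R by rewrite ler_nat.
have M0 : 0 <= M%:R :> R by [].
have rem0 : 0 <= rem%:R :> R by [].
have rem1 : rem%:R <= n%:R + g%:R :> R by rewrite -natrD ler_nat ltnW.
have g0 : 0 <= g%:R :> R by [].
have hK2 : 2 * a + (n%:R + g%:R) * (a + `|p - e|) <= M%:R.
  by rewrite -natrD (le_trans (ltW hK)).
have := ler_norm (p - e); have := normr_ge0 (p - e).
move: zn brk KM' M0 rem0 rem1 g0 hK2; move: (`|p - e|) (M%:R) (rem%:R) (g%:R) (n%:R) (z n) (z L).
move=> P m s G v x y zn brk _ m0 s0 s1 G0 hm P0 hP hyp.
have h1 : m * (v * (p - e / 2)) <= m * x by rewrite ler_wpM2l.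
have h2 : m * (1 + G * P + b + a) <= m * (v * (e / 2)) by rewrite ler_wpM2l.
have h3 : m * (G * (p - e)) <= m * (G * P) by rewrite ler_wpM2l // ler_wpM2l.
have h4 : s * (a + P) <= (v + G) * (a + P) by rewrite ler_wpM2r // addr_ge0.
have h5 : s * (p - e) <= s * P by rewrite ler_wpM2l.
have h6 : m * (1 + G * P + b + a) = m + m * (G * P) + m * b + m * a by ring.
have h7 : m * (v * (p - e / 2)) = m * v * p - m * (v * (e / 2)) by ring.
have h8 : (m * (v + G) + s) * (p - e) = m * v * p - 2 * (m * (v * (e / 2))) + m * (G * (p - e)) + s * (p - e).
  by field.
have h9 : a * (m + 2 + s) = m * a + 2 * a + s * a by ring.
have h10 : s * (a + P) = s * a + s * P by ring.
rewrite h8; rewrite h9 in hyp; rewrite h6 in h2; rewrite h7 in h1; rewrite h10 in h4.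
move: h1 h2 h3 h4 h5 hyp hm.
move: (m * v * p) (m * (v * (e / 2))) (m * (G * (p - e))) (s * (p - e)) (m * a) (s * a) (s * P).
by clear => *; lra.
Qed.

Lemma expR_le_quadratic (R : realType) (y : R) : `|y| <= 1 / 2 -> expR y <= 1 + y + 2 * y ^+ 2.
Proof.
rewrite ler_norml => /andP[y1 y2].
have h : 0 < 1 - y by lra.
have h1 := expR_ge1Dx (- y).
have e : expR y * expR (- y) = 1 by rewrite -expRD subrr expR0.
rewrite -(ler_pM2r h); apply: (@le_trans _ _ 1).
  apply: (@le_trans _ _ (expR y * expR (- y))); last by rewrite e.
  by rewrite ler_wpM2l ?expR_ge0.
have : 0 <= y ^+ 2 * (1 - 2 * y) by rewrite mulr_ge0 ?sqr_ge0 //; lra.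
have -> : (1 + y + 2 * y ^+ 2) * (1 - y) = 1 + y ^+ 2 * (1 - 2 * y) by ring.
lra.
Qed.

(** * Gibbs weights and the law of large numbers *)

Section GibbsWeights.
Context {R : realType} {X : finType}.
Variables (W : {set X}) (u : X -> R) (w0 : X).
Hypothesis w0W : w0 \in W.

Let Z := \sum_(w in W) expR (u w).
Definition gibbs w := expR (u w) / Z.

Lemma gibbs_sum_gt0 : 0 < Z.
Proof.
rewrite /Z (bigD1 w0) //= ltr_pwDl ?expR_gt0 // sumr_ge0 // => w _; exact: expR_ge0.
Qed.

Lemma gibbs_ge0 w : 0 <= gibbs w.
Proof. by rewrite divr_ge0 ?expR_ge0 // ltW // gibbs_sum_gt0. Qed.

Lemma gibbs_sum1 : \sum_(w in W) gibbs w = 1.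
Proof. by rewrite -mulr_suml divff // gt_eqF // gibbs_sum_gt0. Qed.

Lemma gibbs_mean_bound (a : X -> R) D : (forall w, w \in W -> `|a w| <= D) ->
  `|\sum_(w in W) gibbs w * a w| <= D.
Proof.
move=> h; apply: le_trans (ler_norm_sum _ _ _) _; rewrite -[leRHS]mul1r -gibbs_sum1 mulr_suml.
apply: ler_sum => w wW; rewrite normrM ger0_norm ?gibbs_ge0 // ler_wpM2l ?gibbs_ge0 //.
exact: h.
Qed.

(** The Gibbs mean is the derivative of the logarithm of the partition sum; a quadratic upper bound
    for the exponential gives the first-order expansion from above with an explicit error, which is
    all that near minimality requires. *)
Lemma gibbs_perturbation (a : X -> R) D h : (forall w, w \in W -> `|a w| <= D) ->
  `|h| * D <= 1 / 2 ->
  ln (\sum_(w in W) expR (u w + h * a w)) <=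
    ln Z + h * (\sum_(w in W) gibbs w * a w) + 2 * (h * D) ^+ 2.
Proof.
move=> aD hD; set m := \sum_(w in W) gibbs w * _; have Z0 := gibbs_sum_gt0.
have D0 : 0 <= D by exact: le_trans (aD w0 w0W).
have S0 : 0 < \sum_(w in W) expR (u w + h * a w).
  rewrite (bigD1 w0) //= ltr_pwDl ?expR_gt0 // sumr_ge0 // => w _; exact: expR_ge0.
suff hle : \sum_(w in W) expR (u w + h * a w) <= Z * expR (h * m + 2 * (h * D) ^+ 2).
  rewrite -[leRHS]addrA -[X in _ <= _ + X]expRK -lnM ?posrE ?expR_gt0 // ler_ln ?posrE ?mulr_gt0 ?expR_gt0 //.
apply: (@le_trans _ _ (Z * (1 + (h * m + 2 * (h * D) ^+ 2)))); last first.
  by apply: ler_wpM2l; [exact: ltW | exact: expR_ge1Dx].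
have mE : Z * m = \sum_(w in W) expR (u w) * a w.
  rewrite /m mulr_sumr; apply: eq_bigr => w _.
  by rewrite /gibbs mulrA mulrCA divff ?mulr1 // gt_eqF.
have -> : Z * (1 + (h * m + 2 * (h * D) ^+ 2)) = Z + h * (Z * m) + Z * (2 * (h * D) ^+ 2) by ring.
rewrite mE /Z mulr_sumr mulr_suml -!big_split /=; apply: ler_sum => w wW.
rewrite expRD; have aw := aD w wW.
have ha : `|h * a w| <= `|h| * D by rewrite normrM ler_wpM2l.
have := expR_le_quadratic (le_trans ha hD).
have sq : (h * a w) ^+ 2 <= (h * D) ^+ 2.
  rewrite -(real_normK (num_real (h * a w))) -(real_normK (num_real (h * D))).
  by rewrite ler_pXn2r ?nnegrE // [`|h * D|]normrM (ger0_norm D0).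
move=> hq; have : expR (h * a w) <= 1 + h * a w + 2 * (h * D) ^+ 2.
  by apply: le_trans hq _; rewrite lerD2l ler_wpM2l.
move=> /(ler_wpM2l (expR_ge0 (u w))) /le_trans; apply.
by rewrite le_eqVlt; apply/orP; left; apply/eqP; ring.
Qed.

End GibbsWeights.

Section Chebyshev.
Context {R : realType} {X : finType}.
Variables (W : {set X}) (p : X -> R).
Hypotheses (p0 : forall w, 0 <= p w) (p1 : \sum_(w in W) p w = 1).
Variable M : nat.

Lemma product_expectation (F : 'I_M -> X -> R) :
  \sum_(f in ffun_on [in W]) \prod_(j < M) F j (f j) = \prod_(j < M) \sum_(w in W) F j w.
Proof. by rewrite (bigA_distr_big [in W]). Qed.

Lemma product_mass1 : \sum_(f in ffun_on [in W]) \prod_(j < M) p (f j) = 1.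
Proof. by rewrite (product_expectation (fun _ => p)) big1 // => j _; exact: p1. Qed.

(** Independence: the factors [c i j] write each product of two terms of the square as a product
    over coordinates, so that sums and products exchange and the off-diagonal terms vanish with the
    mean. *)
Lemma product_variance (a : X -> R) D : (forall w, w \in W -> `|a w| <= D) ->
  \sum_(w in W) p w * a w = 0 ->
  \sum_(f in ffun_on [in W])
     (\prod_(j < M) p (f j)) * (\sum_(j < M) a (f j)) ^+ 2 <= M%:R * D ^+ 2.
Proof.
move=> aD a0.
pose c (i j : 'I_M) (x : X) : R := if i == j then a x else 1.
have step (f : {ffun 'I_M -> X}) : (\prod_(j < M) p (f j)) * (\sum_(j < M) a (f j)) ^+ 2 =
    \sum_j \sum_l \prod_i (p (f i) * c i j (f i) * c i l (f i)).
  have ce (j : 'I_M) : \prod_i c i j (f i) = a (f j).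
    by rewrite (bigD1 j) //= big1 ?mulr1 /c ?eqxx // => i /negbTE ->.
  rewrite expr2 big_distrlr /= mulr_sumr; apply: eq_bigr => j _.
  by rewrite mulr_sumr; apply: eq_bigr => l _; rewrite !big_split /= !ce mulrA.
rewrite (eq_bigr _ (fun f _ => step f)) exchange_big /=.
under eq_bigr do rewrite exchange_big /=.
under eq_bigr do under eq_bigr do
  rewrite (product_expectation (fun i x => p x * c i _ x * c i _ x)).
apply: (@le_trans _ _ (\sum_(j < M) D ^+ 2)); last by rewrite sumr_const card_ord mulr_natl.
apply: ler_sum => j _; rewrite (bigD1 j) //= [X in _ + X]big1 ?addr0; last first.
  move=> l lj; rewrite (bigD1 j) //= [X in X * _](_ : _ = 0) ?mul0r //.
  rewrite -[RHS]a0; apply: eq_bigr => w _.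
  by rewrite /c eqxx eq_sym (negbTE lj) mulr1.
rewrite (bigD1 j) //= [X in _ * X]big1 ?mulr1; last first.
  by move=> i ij; rewrite -[RHS]p1; apply: eq_bigr => w _; rewrite /c (negbTE ij) !mulr1.
rewrite -[leRHS]mul1r -p1 mulr_suml; apply: ler_sum => w wW.
rewrite /c eqxx -mulrA ler_wpM2l // -expr2 -real_normK ?num_real //.
by rewrite ler_pXn2r ?nnegrE ?aD // (le_trans _ (aD w wW)).
Qed.

Lemma chebyshev_product (a : X -> R) D kappa : (forall w, w \in W -> `|a w| <= D) ->
  \sum_(w in W) p w * a w = 0 -> 0 < kappa -> (0 < M)%N ->
  \sum_(f in ffun_on [in W] | M%:R * kappa < `|\sum_(j < M) a (f j)|)
     \prod_(j < M) p (f j) <= D ^+ 2 / (M%:R * kappa ^+ 2).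
Proof.
move=> aD a0 k0 M0; have M0' : 0 < M%:R :> R by rewrite ltr0n.
have := product_variance aD a0.
set V := \sum_(f in _) _ => hV.
have Mk : 0 < M%:R * kappa by rewrite mulr_gt0.
rewrite ler_pdivlMr ?mulr_gt0 ?exprn_gt0 //.
rewrite -(ler_pM2l M0'); apply: le_trans _ hV.
rewrite mulr_suml mulr_sumr /V big_mkcondr /=; apply: ler_sum => f _.
have pf : 0 <= \prod_(j < M) p (f j) by exact: prodr_ge0.
case: ifP => [hf|_]; last by rewrite mulr_ge0 // sqr_ge0.
rewrite mulrCA ler_wpM2l // mulrA -expr2 -exprMn -[leRHS]real_normK ?num_real //.
by rewrite ler_pXn2r ?nnegrE // ltW.
Qed.

End Chebyshev.

Lemma first_order_algebra (R : realType) (n a b A S U V t c m d : R) :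
  b - n * A + n * d / 2 * S <= a - n * (A + U) + n * d / 2 * (S + V) + c ->
  a <= b + m + t -> - m + n * U - n * d / 2 * V <= t + c.
Proof. by move=> h1 h2; lra. Qed.

Section TiltedMeans.
Context {N : nat} {Q : 'M[bool]_N} {R : realType} {k : nat}.
Local Notation Sigma := (subshift Q).
Local Notation lang := (@language N Q).
Variables (psi : 'I_k -> nat -> Sigma -> R) (C : R) (g : nat) (x0 : Sigma).
Implicit Types (x y : Sigma) (q : 'rV[R]_k).
Hypothesis C1 : 1 <= C.
Hypothesis psi0 : forall i x, `|psi i 0 x| <= C.
Hypothesis psiD : forall i n x y, (forall j : nat, (j < n)%N -> symbol x j = symbol y j) ->
  `|psi i n x - psi i n y| <= C.
Hypothesis psiE : forall i n m x, `|psi i (n + m) x - psi i n x| <= C * m%:R.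
Hypothesis psiG : forall x n y m, exists v : Sigma, exists2 l : nat, (l <= g)%N &
  [/\ forall i : int, i < n%:Z -> symbol v i = symbol x i,
      forall i : int, 0 <= i -> symbol (sigma_shift (n + l)%N%:Z v) i = symbol y i
    & forall i, `|psi i (n + m + g) v - (psi i n x + psi i m y)| <= C].

Local Notation Z := (Zsum psi x0).

Lemma ln_Zsum_glue q n M L : (M * (n + g) <= L)%N ->
  M%:R * ln (Z q n) <= M%:R * ln g.+1%:R +
    (qnorm q * C) * (M + 2 + (L - M * (n + g)))%N%:R + ln (Z q L).
Proof.
move=> ML; have := Zsum_supermultiplicative x0 C1 psi0 psiD psiE psiG q ML.
have Z1 := Zsum_gt0 psi x0 q n; have Z2 := Zsum_gt0 psi x0 q L.
have gp : 0 < g.+1%:R ^+ M :> R by rewrite exprn_gt0.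
rewrite -ler_ln ?posrE ?mulr_gt0 ?expR_gt0 ?exprn_gt0 //.
rewrite lnM ?posrE ?mulr_gt0 ?expR_gt0 // lnM ?posrE ?expR_gt0 // expRK.
by rewrite !lnXn ?ltr0n // -[ln (Z q n) *+ M]mulr_natl -[ln _ *+ M]mulr_natl [qnorm q * (C * _)]mulrA.
Qed.

Variable p : 'rV[R]_k -> R.
Hypothesis hp : forall q e n0, 0 < e ->
  exists2 n, (n0 <= n)%N & n%:R * (p q - e) <= ln (Z q n).

Lemma Zsum_liminf q e : 0 < e ->
  exists n0, forall n, (n0 <= n)%N -> n%:R * (p q - e) <= ln (Z q n).
Proof.
apply: (@superadditive_liminf R (fun n => ln (Z q n)) (p q) (qnorm q * C) (ln g.+1%:R) g).
- by rewrite mulr_ge0 ?qnorm_ge0 // (le_trans _ C1).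
- by rewrite ln_ge0 // ler1n.
- by move=> n M L; exact: ln_Zsum_glue.
- by move=> e' n0; exact: hp.
Qed.

Lemma ln_Zsum_lipschitz q q' n :
  ln (Z q n) <= qnorm (q - q') * (C * n.+1%:R) + ln (Z q' n).
Proof.
have Z1 := Zsum_gt0 psi x0 q n; have Z2 := Zsum_gt0 psi x0 q' n.
rewrite -[X in X + _]expRK -lnM ?posrE ?expR_gt0 // ler_ln ?posrE ?mulr_gt0 ?expR_gt0 //.
rewrite /Zsum mulr_sumr; apply: ler_sum => w _; rewrite -expRD ler_expR -lerBlDr.
rewrite /qpsi -sumrB mulr_suml; apply: ler_sum => i _.
rewrite -mulrBl; apply: le_trans (ler_norm _) _; rewrite normrM !mxE ler_wpM2l //.
exact: psi_bound.
Qed.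

Lemma ln_Zsum0 n : (0 < N)%N -> ln (Z 0 n) <= n%:R * ln N%:R.
Proof.
move=> N0; have Z1 := Zsum_gt0 psi x0 0 n.
rewrite mulr_natl -lnXn ?ltr0n // ler_ln ?posrE ?exprn_gt0 ?ltr0n //.
rewrite /Zsum (eq_bigr (fun=> 1)) => [|w _]; last first.
  by rewrite /qpsi big1 ?expR0 // => i _; rewrite mxE mul0r.
rewrite sumr_const -natrX ler_nat (leq_trans (max_card _)) //.
by rewrite card_ffun !card_ord.
Qed.

Lemma near_minimizer (T : Type) (P : T -> Prop) (F : T -> R) (b e : R) t0 : P t0 -> 0 < e ->
  (forall t, P t -> b <= F t) -> exists2 t, P t & forall t', P t' -> F t <= F t' + e.
Proof.
move=> Pt0 e0 hb; pose S := [set F t | t in P]%classic.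
have hS : has_inf S by split; [exists (F t0), t0 | exists b => _ [t Pt <-]; exact: hb].
have [_ [t Pt <-] ht] := inf_adherent e0 hS.
exists t => // t' Pt'; apply: le_trans (ltW ht) _; rewrite lerD2r.
by apply: ge_inf; [exact: hS.2 | exists t'].
Qed.

Lemma small_step (D B c : R) : 0 <= D -> 0 <= B -> 0 < c ->
  exists h, [/\ 0 < h, h <= 1, h * D <= 1 / 2 & h * B <= c].
Proof.
move=> D0 B0 c0; have Bc : 0 <= B / c by rewrite divr_ge0 // ltW.
have d0 : 0 < 1 + 2 * D + B / c by lra.
exists (1 + 2 * D + B / c)^-1; split.
- by rewrite invr_gt0.
- by rewrite invf_le1 //; lra.
- by rewrite mulrC ler_pdivrMr //; lra.
- rewrite mulrC ler_pdivrMr // mulrDr.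
  by rewrite [c * (B / c)]mulrCA divff ?mulr1 ?gt_eqF // lerDr mulr_ge0 ?ltW //; lra.
Qed.

Definition tilted_mean q n i : R :=
  \sum_(w in lang n) gibbs (lang n) (fun w => qpsi psi q n (rep x0 w)) w * psi i n (rep x0 w).

Variables (alpha : 'rV[R]_k) (s : R).
Hypothesis hs : forall q, \sum_i alpha 0 i * q 0 i + s <= p q.

(** The logarithmic partition sum minus its linear constraint, with a quadratic penalty. The penalty
    gives bounded near minimisers even if the unpenalised infimum is not attained. *)
Let J d n q := ln (Z q n) - n%:R * (\sum_i alpha 0 i * q 0 i) +
  n%:R * d / 2 * (\sum_i q 0 i ^+ 2).

(** Comparing [J] at [q] and at [q] moved by [h] in both directions of the coordinate [i], with
    [gibbs_perturbation], bounds the would-be partial derivative; division by [h] leaves an error of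
    order [h]. *)
Lemma tilted_first_order d n q h i : 0 < h -> h * (C * n.+1%:R) <= 1 / 2 -> 0 <= d ->
  (forall e : R, `|e| = 1 -> J d n q <= J d n (q + (e * h) *: delta_mx 0 i) + h ^+ 2) ->
  `|tilted_mean q n i - n%:R * alpha 0 i + n%:R * d * q 0 i| <=
    h * (2 * (C * n.+1%:R) ^+ 2 + 1 + n%:R * d / 2).
Proof.
move=> h0 hD d0 hJ; set D := C * n.+1%:R in hD *.
have key (e : R) : `|e| = 1 -> - (e * (tilted_mean q n i - n%:R * alpha 0 i + n%:R * d * q 0 i)) <=
    h * (2 * D ^+ 2 + 1 + n%:R * d / 2).
  move=> e1; have := hJ e e1; rewrite /J; set q' := q + _.
  have sum_pert (F : 'I_k -> R -> R) : \sum_j F j (q' 0 j) = \sum_j F j (q 0 j) +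
      (F i (q 0 i + e * h) - F i (q 0 i)).
    rewrite (bigD1 i) //= [in RHS](bigD1 i) //= {1}/q' !mxE !eqxx mulr1.
    rewrite [X in _ + X = _](_ : _ = \sum_(j | j != i) F j (q 0 j)); first by ring.
    by apply: eq_bigr => j ji; rewrite !mxE (negbTE ji) andbF mulr0 addr0.
  have Zle : ln (Z q' n) <= ln (Z q n) + (e * h) * tilted_mean q n i + 2 * (h * D) ^+ 2.
    have eh2 : 2 * (h * D) ^+ 2 = 2 * (e * h * D) ^+ 2.
      have e2 : e ^+ 2 = 1 by rewrite -real_normK ?num_real // e1 expr1n.
      by rewrite -(mulrA e) [(e * _) ^+ 2]exprMn e2 mul1r.
    rewrite eh2.
    have eh : `|e * h| = h by rewrite normrM e1 mul1r gtr0_norm.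
    have hD' : `|e * h| * D <= 1 / 2 by rewrite eh; exact: hD.
    have pD w : w \in lang n -> `|psi i n (rep x0 w)| <= D by move=> _; exact: psi_bound.
    have gp := @gibbs_perturbation R _ (lang n) (fun w => qpsi psi q n (rep x0 w)) _
      (word_language n x0) _ D _ pD hD'.
    apply: le_trans gp.
    rewrite /Zsum (eq_bigr (fun w => expR (qpsi psi q n (rep x0 w) + e * h * psi i n (rep x0 w)))) //.
    move=> w _; congr expR; rewrite /qpsi.
    by rewrite (sum_pert (fun j t => t * psi j n (rep x0 w))); ring.
  rewrite (sum_pert (fun j t => alpha 0 j * t)) (sum_pert (fun j t => t ^+ 2)).
  move: Zle; have e2 : e ^+ 2 = 1 by rewrite -real_normK ?num_real // e1 expr1n.
  move: (ln (Z q' n)) (ln (Z q n)) (tilted_mean q n i) (\sum_j alpha 0 j * q 0 j) (\sum_j q 0 j ^+ 2).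
  move=> a b m A S ha hb.
  rewrite -(ler_pM2l h0).
  have -> : h * (h * (2 * D ^+ 2 + 1 + n%:R * d / 2)) =
    2 * (h * D) ^+ 2 + h ^+ 2 + n%:R * d / 2 * (e ^+ 2 * h ^+ 2) by rewrite e2; ring.
  have -> : h * - (e * (m - n%:R * alpha 0 i + n%:R * d * q 0 i)) =
     - (e * h * m) + n%:R * (alpha 0 i * (q 0 i + e * h) - alpha 0 i * q 0 i)
     - n%:R * d / 2 * ((q 0 i + e * h) ^+ 2 - q 0 i ^+ 2) + n%:R * d / 2 * (e ^+ 2 * h ^+ 2) by field.
  rewrite lerD2r; move: hb ha; set U := _ - alpha 0 i * q 0 i; set V := _ - q 0 i ^+ 2.
  exact: first_order_algebra.
have k1 := key 1 (normr1 _); have := key (-1); rewrite normrN1 => /(_ erefl) k2.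
rewrite mul1r in k1; rewrite mulN1r opprK in k2.
by rewrite ler_norml k2 andbT lerNl.
Qed.

End TiltedMeans.

Lemma confinement_algebra (R : realType) (n L A S s c d lnN eta : R) :
  1 <= n -> n * (A + s - 2 * eta) <= L -> 2 * eta <= 1 -> c <= 1 ->
  L - n * A + n * d / 2 * S <= n * lnN + c -> d / 2 * S <= lnN + 2 - s.
Proof.
move=> n1 h1 h2 h3 h4; have n0 : 0 < n by exact: lt_le_trans n1.
rewrite -(ler_pM2l n0).
have : n * 1 >= 1 by rewrite mulr1.
have : n * (2 * eta) <= n * 1 by rewrite ler_pM2l.
lra.
Qed.

Lemma limit_comparison_algebra (R : realType) (n L L' P A A' s kk C e a eta : R) :
  1 <= n -> n * (P - eta) <= L' -> L' <= kk * e * (C * (n + 1)) + L -> A' + s <= P ->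
  A <= A' + a * e -> 0 <= kk -> 0 <= e -> 0 <= C -> (2 * C * kk + a) * e <= eta ->
  n * (A + s - 2 * eta) <= L.
Proof.
move=> n1 h1 h2 h3 h4 k0 e0 C0 h5; have n0 : 0 <= n by exact: le_trans n1.
have : kk * e * (C * (n + 1)) <= kk * e * (C * (2 * n)).
  by rewrite ler_wpM2l ?mulr_ge0 // ler_wpM2l //; lra.
have : n * ((2 * C * kk + a) * e) <= n * eta by rewrite ler_wpM2l.
have : n * (A' + s) <= n * P by rewrite ler_wpM2l.
have : n * A <= n * (A' + a * e) by rewrite ler_wpM2l.
lra.
Qed.

Lemma square_bound (R : realType) (d x K e : R) : 0 < d -> 0 <= e ->
  d / 2 * x ^+ 2 <= K -> 8 * K * d <= e ^+ 2 -> `|d * x| <= e / 2.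
Proof.
move=> d0 e0 h1 h2; rewrite -(ler_pXn2r (n := 2)) ?nnegrE ?divr_ge0 // real_normK ?num_real //.
have : d * (d / 2 * x ^+ 2) <= d * K by rewrite ler_pM2l.
have -> : (d * x) ^+ 2 = 2 * (d * (d / 2 * x ^+ 2)) by field.
have -> : (e / 2) ^+ 2 = e ^+ 2 / 4 by field.
lra.
Qed.

Section TiltedMeanExists.
Context {N : nat} {Q : 'M[bool]_N} {R : realType} {k : nat}.
Local Notation Sigma := (subshift Q).
Local Notation lang := (@language N Q).
Variables (psi : 'I_k -> nat -> Sigma -> R) (C : R) (g : nat) (x0 : Sigma).
Implicit Types (x y : Sigma) (q : 'rV[R]_k).
Hypothesis C1 : 1 <= C.
Hypothesis psi0 : forall i x, `|psi i 0 x| <= C.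
Hypothesis psiD : forall i n x y, (forall j : nat, (j < n)%N -> symbol x j = symbol y j) ->
  `|psi i n x - psi i n y| <= C.
Hypothesis psiE : forall i n m x, `|psi i (n + m) x - psi i n x| <= C * m%:R.
Hypothesis psiG : forall x n y m, exists v : Sigma, exists2 l : nat, (l <= g)%N &
  [/\ forall i : int, i < n%:Z -> symbol v i = symbol x i,
      forall i : int, 0 <= i -> symbol (sigma_shift (n + l)%N%:Z v) i = symbol y i
    & forall i, `|psi i (n + m + g) v - (psi i n x + psi i m y)| <= C].

Local Notation Z := (Zsum psi x0).
Local Notation tmean := (tilted_mean psi x0).
Variable p : 'rV[R]_k -> R.
Hypothesis hp : forall q e n0, 0 < e ->
  exists2 n, (n0 <= n)%N & n%:R * (p q - e) <= ln (Z q n).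
Variables (alpha : 'rV[R]_k) (s : R).
Hypothesis hs : forall q, \sum_i alpha 0 i * q 0 i + s <= p q.

Let N0 : (0 < N)%N.
Proof. by case: N (symbol x0 0) => // -[]. Qed.

(* A near minimiser of the regularised functional J has a Gibbs measure with mean close to
   n alpha (first order condition); boundedness of its entropy from below is the hypothesis [hs]. *)
Lemma tilted_mean_exists e n0 : 0 < e -> exists n q, [/\ (n0 <= n)%N, (0 < n)%N,
  forall i, `|tmean q n i - n%:R * alpha 0 i| <= n%:R * e &
  n%:R * (s - e) <= ln (Z q n) - \sum_i q 0 i * tmean q n i].
Proof.
move=> e0; have C0 : 0 <= C by exact: le_trans C1.
pose lnN := ln (N%:R : R); pose K := `|lnN + 2 - s| + 1.
have K0 : 0 < K by rewrite ltr_wpDl.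
(* The penalty contributes [d * q 0 i] to the mean. Since [d / 2] times the squared length of [q] is
   at most [K], this choice makes that contribution at most [e / 2]. *)
pose d := e ^+ 2 / (8 * K).
have d0 : 0 < d by rewrite divr_gt0 ?exprn_gt0 // mulr_gt0.
have Kd : 8 * K * d <= e ^+ 2 by rewrite /d mulrCA divff ?mulr1 // gt_eqF // mulr_gt0.
(* One more than the a priori bound [e / 2 / d], so that perturbations of size at most 1 stay in the
   box. *)
pose Rb := 1 + e / 2 / d.
have e20 : 0 < e / 2 by exact: divr_gt0.
have ed0 : 0 < e / 2 / d by exact: divr_gt0.
have Rb0 : 0 < Rb by rewrite ltr_pwDl // ltW.
pose xi := e / 2 / (k%:R * Rb + 1).
have kRb : 0 <= k%:R * Rb by rewrite mulr_ge0 // ltW.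
have kRb1 : 0 < k%:R * Rb + 1 by exact: ltr_wpDl.
have xi0 : 0 < xi by exact: divr_gt0.
pose eta := Num.min 1 (e / 2) / 2.
have eta0 : 0 < eta by rewrite divr_gt0 // lt_min ltr01 divr_gt0.
have eta1 : 2 * eta <= 1 by rewrite /eta mulrC divfK // ge_min lexx.
have etae : 2 * eta <= e / 2 by rewrite /eta mulrC divfK // ge_min lexx orbT.
pose nal := \sum_i `|alpha 0 i|.
have nal0 : 0 <= nal by exact: sumr_ge0.
pose e1 := eta / (2 * C * k%:R + nal + 1).
have den : 0 <= 2 * C * k%:R + nal by rewrite addr_ge0 // !mulr_ge0.
have den1 : 0 < 2 * C * k%:R + nal + 1 by exact: ltr_wpDl.
have e10 : 0 < e1 by exact: divr_gt0.
have e1eta : (2 * C * k%:R + nal) * e1 <= eta.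
  rewrite /e1 mulrCA ler_piMr ?(ltW eta0) // ler_pdivrMr ?ltr_wpDl // mul1r lerDl //.
pose box q := forall i, `|q 0 i| <= Rb.
pose J n q := ln (Z q n) - n%:R * (\sum_i alpha 0 i * q 0 i) +
  n%:R * d / 2 * (\sum_i q 0 i ^+ 2).
have box0 : box 0 by move=> i; rewrite mxE normr0 ltW.
have abox q : box q -> qnorm q <= k%:R * Rb.
  move=> bq; rewrite /qnorm; apply: le_trans (ler_sum _ (fun i _ => bq i)) _.
  by rewrite sumr_const card_ord mulr_natl.
have /choice[h hh] n : exists h, [/\ 0 < h, h <= 1, h * (C * n.+1%:R) <= 1 / 2 &
    h * (2 * (C * n.+1%:R) ^+ 2 + 1 + n%:R * d / 2) <= xi].
  apply: small_step => //; first by rewrite mulr_ge0.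
  have nd : 0 <= n%:R * d / 2 by rewrite divr_ge0 // mulr_ge0 // ltW.
  apply: addr_ge0 nd; apply: addr_ge0 => //; apply: mulr_ge0 => //; exact: sqr_ge0.
have /choice[qn hqn] n : exists q, box q /\ forall q', box q' -> J n q <= J n q' + h n ^+ 2.
  have [hn0 _ _ _] := hh n.
  have [||q bq hq] := @near_minimizer R _ box (J n)
     (- (k%:R * Rb * (C * n.+1%:R)) + ln (Z 0 n) - n%:R * (nal * Rb)) (h n ^+ 2) 0 box0.
  - by rewrite exprn_gt0.
  - move=> q bq; rewrite /J.
    have l1 := ln_Zsum_lipschitz x0 psi0 psiE 0 q n.
    have l2 : qnorm (0 - q) * (C * n.+1%:R) <= k%:R * Rb * (C * n.+1%:R).
      rewrite ler_wpM2r ?mulr_ge0 //; apply: le_trans (abox q bq).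
      by rewrite le_eqVlt /qnorm; apply/orP; left; apply/eqP; apply: eq_bigr => i _; rewrite !mxE sub0r normrN.
    have l3 : n%:R * (\sum_i alpha 0 i * q 0 i) <= n%:R * (nal * Rb).
      rewrite ler_wpM2l // /nal mulr_suml; apply: ler_sum => i _.
      by apply: le_trans (ler_norm _) _; rewrite normrM ler_wpM2l.
    have l4 : 0 <= n%:R * d / 2 * (\sum_i q 0 i ^+ 2).
      apply: mulr_ge0; first by rewrite divr_ge0 // mulr_ge0 // ltW.
      by apply: sumr_ge0 => i _; exact: sqr_ge0.
    move: l1 l2 l3 l4.
    move: (ln (Z q n)) (ln (Z 0 n)) (qnorm _ * _) (k%:R * Rb * _) (n%:R * (\sum_i _)) (n%:R * (nal * _)) (n%:R * d / 2 * _).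
    by move=> t1 t2 t3 t4 t5 t6 t7; lra.
  - by exists q.
(* The lower bound on [Z q n] starts at a rank that depends on [q], while the near minimiser varies
   with [n]. A cluster point gives one fixed parameter, and the Lipschitz bound transfers its
   estimate to the nearby [q]. *)
have [l [lK hl]] := @bounded_cluster R 'I_k Rb (fun n i => qn n 0 i) (fun n i => (hqn n).1 i).
pose qi : 'rV[R]_k := \row_i l i.
have [n2 hn2] := Zsum_liminf C1 psi0 psiD psiE psiG hp qi eta0.
have [n nn hn] := hl e1 (n0 + n2 + 1)%N e10.
have n00 : (n0 <= n)%N by rewrite (leq_trans _ nn) // -addnA leq_addr.
have n20 : (n2 <= n)%N by rewrite (leq_trans _ nn) // addnAC leq_addl.
have n10 : (0 < n)%N by rewrite (leq_trans _ nn) // addn1.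
have n1R : 1 <= n%:R :> R by rewrite ler1n.
have [bq hq] := hqn n; have [h0 h1 hD hB] := hh n.
set q := qn n in bq hq.
have low : n%:R * (\sum_i alpha 0 i * q 0 i + s - 2 * eta) <= ln (Z q n).
  apply: (limit_comparison_algebra n1R (hn2 n n20) _ (hs qi) _ (ler0n _ k) (ltW e10) C0 e1eta).
    rewrite natr1; apply: le_trans (ln_Zsum_lipschitz x0 psi0 psiE qi q n) _.
    rewrite lerD2r ler_wpM2r ?mulr_ge0 //.
    rewrite /qnorm mulr_natl -[k in leRHS]card_ord -sumr_const; apply: ler_sum => i _.
    by rewrite !mxE distrC; exact: hn.
  rewrite /nal mulr_suml -lerBlDl -sumrB; apply: ler_sum => i _.
  by rewrite mxE -mulrBr; apply: le_trans (ler_norm _) _; rewrite normrM ler_wpM2l.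
(* Comparison with [q = 0], where the partition sum just counts words. *)
have J0 : ln (Z q n) - n%:R * (\sum_i alpha 0 i * q 0 i) +
    n%:R * d / 2 * (\sum_i q 0 i ^+ 2) <= n%:R * lnN + h n ^+ 2.
  apply: le_trans (hq 0 box0) _; rewrite lerD2r /J.
  have a0 : \sum_i alpha 0 i * (0 : 'rV[R]_k) 0 i = 0.
    by rewrite big1 // => i _; rewrite mxE mulr0.
  have s0 : \sum_i (0 : 'rV[R]_k) 0 i ^+ 2 = 0.
    by rewrite big1 // => i _; rewrite mxE expr0n.
  by rewrite a0 s0 !mulr0 subr0 addr0; exact: ln_Zsum0.
have hS : d / 2 * (\sum_i q 0 i ^+ 2) <= K.
  have h2 : h n ^+ 2 <= 1 by rewrite exprn_ile1 // ltW.
  apply: le_trans (confinement_algebra n1R low eta1 h2 J0) _.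
  by rewrite (le_trans (ler_norm _)) // lerDl.
have dq i : `|d * q 0 i| <= e / 2.
  apply: (square_bound d0 (ltW e0) _ Kd); apply: le_trans hS.
  apply: ler_wpM2l; first by rewrite divr_ge0 // ltW.
  by rewrite (bigD1 i) //= lerDl sumr_ge0 // => j _; exact: sqr_ge0.
have qR i : `|q 0 i| + 1 <= Rb.
  rewrite addrC lerD2l ler_pdivlMr //; have := dq i.
  by rewrite normrM gtr0_norm // mulrC.
have fo i : `|tmean q n i - n%:R * alpha 0 i + n%:R * d * q 0 i| <= n%:R * xi.
  apply: le_trans (tilted_first_order psi0 psiE h0 hD (ltW d0) _) _.
    move=> ee ee1; apply: hq => j; rewrite !mxE.
    apply: le_trans (ler_normD _ _) _; apply: le_trans _ (qR j); rewrite lerD2l.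
    rewrite !normrM ee1 mul1r gtr0_norm //.
    by case: (_ && _); rewrite ?normr1 ?normr0 ?mulr1 ?mulr0.
  by apply: le_trans hB _; rewrite ler_peMl // ltW.
have xie : xi <= e / 2.
  by rewrite ler_pdivrMr ?ltr_wpDl // ler_peMr ?divr_ge0 ?(ltW e0) // lerDr.
exists n, q; split => //.
- move=> i; have fi := fo i; have di := dq i.
  have nx : n%:R * xi <= n%:R * (e / 2) by rewrite ler_wpM2l.
  have nd : `|n%:R * d * q 0 i| <= n%:R * (e / 2).
    by rewrite -mulrA normrM ger0_norm // ler_wpM2l.
  rewrite -[tmean q n i - _](addrK (n%:R * d * q 0 i)).
  apply: le_trans (ler_normB _ _) _; apply: le_trans (lerD (le_trans fi nx) nd) _.
  by rewrite -mulrDr -splitr.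
(* When the mean is replaced by [n alpha] through the first-order condition, the penalty enters with
   a favourable sign and is dropped. *)
- have ent : \sum_i q 0 i * tmean q n i <= n%:R * (\sum_i alpha 0 i * q 0 i) + k%:R * Rb * (n%:R * xi).
    have -> : k%:R * Rb * (n%:R * xi) = \sum_(i < k) Rb * (n%:R * xi).
      by rewrite sumr_const card_ord -mulrA mulr_natl.
    rewrite mulr_sumr -big_split /=; apply: ler_sum => i _.
    have fi := fo i; set t := _ + n%:R * d * q 0 i in fi.
    have -> : q 0 i * tmean q n i = n%:R * (alpha 0 i * q 0 i) + q 0 i * t - n%:R * d * q 0 i ^+ 2.
      by rewrite /t; ring.
    have t1 : q 0 i * t <= Rb * (n%:R * xi).
      by apply: le_trans (ler_norm _) _; rewrite normrM ler_pM.
    have t2 : 0 <= n%:R * d * q 0 i ^+ 2.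
      by apply: mulr_ge0; [rewrite mulr_ge0 // ltW | exact: sqr_ge0].
    apply: (@le_trans _ _ (n%:R * (alpha 0 i * q 0 i) + q 0 i * t)); first by rewrite gerBl.
    by rewrite lerD2l.
  have kx : k%:R * Rb * (n%:R * xi) <= n%:R * (e / 2).
    have kk : k%:R * Rb / (k%:R * Rb + 1) <= 1 by rewrite ler_pdivrMr // mul1r lerDl.
    rewrite mulrCA ler_wpM2l // /xi mulrCA; apply: ler_piMr => //; exact: ltW.
  have : n%:R * (2 * eta) <= n%:R * (e / 2) by rewrite ler_wpM2l.
  move: low ent kx; move: (\sum_i q 0 i * _) (k%:R * Rb * _) (ln _) (\sum_i _).
  by move=> t1 t2 t3 t4; lra.
Qed.

End TiltedMeanExists.

Lemma gibbs_mass_algebra (R : realType) (M n s e t1 t2 t3 t4 kappa : R) :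
  M * (n * (s - e)) <= M * (t2 - t1) -> M * (t4 * kappa) <= M * (n * e) ->
  t3 - M * t1 <= t4 * (M * kappa) -> t3 - M * t2 <= - (M * (n * (s - 2 * e))).
Proof. by move=> h1 h2 h3; lra. Qed.

Lemma good_exponent_algebra (R : realType) (L M n g rem e C x S m a al kappa eps : R) :
  L = M * (n + g) + rem -> 0 <= M -> 0 <= n -> 0 <= g -> 0 <= rem -> 0 <= C -> 0 <= e ->
  `|x - S| <= C * (M + 2 + rem) -> `|S - M * m| <= M * kappa -> `|m - n * a| <= n * e ->
  kappa <= n * e -> C <= n * e -> `|a| <= al -> g * al <= n * e ->
  C * (2 + rem) + rem * al <= L * e -> 5 * e <= eps -> `|x - L * a| <= L * eps.
Proof.
move=> LE M0 n0 g0 r0 C0 e0 h1 h2 h3 hk hC ha hg hr he.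
have ML : M * (n * e) <= L * e.
  by rewrite mulrA ler_wpM2r // LE mulrDr -addrA lerDl addr_ge0 // mulr_ge0.
have -> : x - L * a = (x - S) + (S - M * m) + M * (m - n * a) - (M * g + rem) * a.
  by rewrite LE; ring.
have t1 : `|M * (m - n * a)| <= M * (n * e) by rewrite normrM (ger0_norm M0) ler_wpM2l.
have t2 : `|(M * g + rem) * a| <= M * (n * e) + rem * al.
  have p : 0 <= M * g + rem by rewrite addr_ge0 // mulr_ge0.
  rewrite normrM (ger0_norm p); apply: le_trans (ler_wpM2l p ha) _.
  by rewrite mulrDl lerD2r -mulrA ler_wpM2l.
have t3 : M * kappa <= M * (n * e) by rewrite ler_wpM2l.
have t4 : C * M <= M * (n * e) by rewrite mulrC ler_wpM2l.
have t5 : L * (5 * e) <= L * eps.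
  by rewrite ler_wpM2l // LE addr_ge0 // mulr_ge0 // addr_ge0.
apply: le_trans (ler_normB _ _) _.
apply: le_trans (lerD (ler_normD _ _) t2) _.
apply: le_trans (lerD (lerD (ler_normD _ _) t1) (lexx _)) _.
lra.
Qed.

Lemma good_count_algebra (R : realType) (L M n g rem e s s' b c2 : R) :
  L = M * (n + g) + rem -> 0 <= M -> 0 <= n -> 0 <= g -> 0 <= rem -> rem <= n + g -> 0 <= e ->
  8 * e <= s - s' -> b <= n * e -> `|s'| * g <= n * e -> c2 + `|s'| * (n + g) <= M * (n * e) ->
  s' * L + M * b + c2 <= M * (n * (s - 2 * e)).
Proof.
move=> LE M0 n0 g0 r0 r1 e0 hs hb hg hc.
have t1 : M * b <= M * (n * e) by rewrite ler_wpM2l.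
have t2 : M * (s' * g) <= M * (n * e).
  by rewrite ler_wpM2l // (le_trans _ hg) // ler_wpM2r // ler_norm.
have t3 : s' * rem <= `|s'| * (n + g).
  by apply: le_trans (ler_norm _) _; rewrite normrM ler_wpM2l // ger0_norm.
have t4 : M * n * (8 * e) <= M * n * (s - s') by rewrite ler_wpM2l // mulr_ge0.
rewrite LE; have t5 : 0 <= M * (n * e) by rewrite !mulr_ge0.
lra.
Qed.

Section GoodWords.
Context {N : nat} {Q : 'M[bool]_N} {R : realType} {k : nat}.
Local Notation Sigma := (subshift Q).
Local Notation lang := (@language N Q).
Variables (psi : 'I_k -> nat -> Sigma -> R) (C : R) (g : nat) (x0 : Sigma).
Implicit Types (x y : Sigma) (q : 'rV[R]_k).
Hypothesis C1 : 1 <= C.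
Hypothesis psi0 : forall i x, `|psi i 0 x| <= C.
Hypothesis psiD : forall i n x y, (forall j : nat, (j < n)%N -> symbol x j = symbol y j) ->
  `|psi i n x - psi i n y| <= C.
Hypothesis psiE : forall i n m x, `|psi i (n + m) x - psi i n x| <= C * m%:R.
Hypothesis psiG : forall x n y m, exists v : Sigma, exists2 l : nat, (l <= g)%N &
  [/\ forall i : int, i < n%:Z -> symbol v i = symbol x i,
      forall i : int, 0 <= i -> symbol (sigma_shift (n + l)%N%:Z v) i = symbol y i
    & forall i, `|psi i (n + m + g) v - (psi i n x + psi i m y)| <= C].

Local Notation Z := (Zsum psi x0).
Variable p : 'rV[R]_k -> R.
Hypothesis hp : forall q e n0, 0 < e ->
  exists2 n, (n0 <= n)%N & n%:R * (p q - e) <= ln (Z q n).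
Variables (alpha : 'rV[R]_k) (s : R).
Hypothesis hs : forall q, \sum_i alpha 0 i * q 0 i + s <= p q.

Definition good_words n (eps : R) : {set {ffun 'I_n -> 'I_N}} :=
  [set w in lang n | `[< forall i, `|psi i n (rep x0 w) - n%:R * alpha 0 i| <= n%:R * eps >]]%SET.

(** The weak law for independent Gibbs blocks, with Chebyshev's inequality in each of the [k]
    coordinates; [M0] makes the sum of the exceptional masses at most [1 / 2]. *)
Lemma typical_sequences_mass n q (kappa : R) : 0 < kappa -> exists M0, forall M, (M0 <= M)%N ->
  1 / 2 <= \sum_(f in ffun_on [in lang n] |
      [forall i : 'I_k, `|\sum_(j < M) psi i n (rep x0 (f j)) - M%:R * tilted_mean psi x0 q n i|
        <= M%:R * kappa])
    \prod_(j < M) gibbs (lang n) (fun w => qpsi psi q n (rep x0 w)) (f j).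
Proof.
move=> k0; pose P := gibbs (lang n) (fun w => qpsi psi q n (rep x0 w)).
pose D := 2 * (C * n.+1%:R); pose m := tilted_mean psi x0 q n.
have Pge0 := gibbs_ge0 (fun w => qpsi psi q n (rep x0 w)) (word_language n x0).
have P1 := gibbs_sum1 (fun w => qpsi psi q n (rep x0 w)) (word_language n x0).
have [M0 hM0] := archi_lt (2 * k%:R * D ^+ 2 / kappa ^+ 2).
exists M0.+1 => M MM; have M0' : (0 < M)%N by exact: leq_trans MM.
have pb (i : 'I_k) (w : {ffun 'I_n -> 'I_N}) : `|psi i n (rep x0 w)| <= C * n.+1%:R.
  exact: psi_bound.
have mb (i : 'I_k) : `|m i| <= C * n.+1%:R.
  have h := @gibbs_mean_bound R _ (lang n) (fun w => qpsi psi q n (rep x0 w)) _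
    (word_language n x0) (fun w => psi i n (rep x0 w)) _ (fun w _ => pb i w).
  exact: h.
pose a i (w : {ffun 'I_n -> 'I_N}) := psi i n (rep x0 w) - m i.
have aD i w : w \in lang n -> `|a i w| <= D.
  move=> _; apply: le_trans (ler_normB _ _) _; rewrite /D mulr2n mulrDl !mul1r; exact: lerD.
have a0 i : \sum_(w in lang n) P w * a i w = 0.
  under eq_bigr do rewrite mulrBr.
  by rewrite sumrB -mulr_suml P1 mul1r subrr.
pose good (f : {ffun 'I_M -> {ffun 'I_n -> 'I_N}}) :=
  [forall i : 'I_k, `|\sum_(j < M) psi i n (rep x0 (f j)) - M%:R * m i| <= M%:R * kappa].
have sumE i (f : {ffun 'I_M -> {ffun 'I_n -> 'I_N}}) :
    \sum_(j < M) psi i n (rep x0 (f j)) - M%:R * m i = \sum_(j < M) a i (f j).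
  by rewrite /a sumrB sumr_const card_ord mulr_natl.
have bad : \sum_(f in ffun_on [in lang n] | ~~ good f) \prod_(j < M) P (f j) <=
    \sum_(i < k) \sum_(f in ffun_on [in lang n] | M%:R * kappa < `|\sum_(j < M) a i (f j)|)
      \prod_(j < M) P (f j).
  rewrite big_mkcondr /=; under [leRHS]eq_bigr => i _ do rewrite big_mkcondr /=.
  rewrite [leRHS]exchange_big /=.
  apply: ler_sum => f _; have pf : 0 <= \prod_(j < M) P (f j) by exact: prodr_ge0.
  case: ifP => [|_]; last by apply: sumr_ge0 => i _; case: ifP.
  rewrite negb_forall => /existsP[i]; rewrite -ltNge sumE => hi.
  rewrite (bigD1 i) //= hi lerDl; apply: sumr_ge0 => j _; by case: ifP.
have := product_mass1 P1 M.
rewrite (bigID good) /= => tot.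
have {bad} : \sum_(f in ffun_on [in lang n] | ~~ good f) \prod_(j < M) P (f j) <= 1 / 2.
  apply: le_trans bad _.
  apply: (@le_trans _ _ (\sum_(i < k) D ^+ 2 / (M%:R * kappa ^+ 2))).
    by apply: ler_sum => i _; apply: (chebyshev_product Pge0 P1 (aD i) (a0 i) k0 M0').
  rewrite sumr_const card_ord -[_ *+ k]mulr_natl mulrA ler_pdivrMr ?mulr_gt0 ?ltr0n ?exprn_gt0 //.
  have h : M0%:R <= M%:R :> R by rewrite ler_nat ltnW.
  have := le_trans (ltW hM0) h; rewrite ler_pdivrMr ?exprn_gt0 //.
  rewrite -mulrA; move: (k%:R * D ^+ 2) (M%:R * kappa ^+ 2) => t1 t2.
  by move=> hh; lra.
move: tot; rewrite /good; set x := \sum_(_ | _ && ~~ _) _; set y := \sum_(_ | _) _.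
by move=> tot hx; lra.
Qed.

(** A typical tuple has product weight at most [expR (- (M * (n * (s - 2 * e))))] because of the
    entropy bound in [tilted_mean_exists], and typical tuples have total mass at least [1 / 2], so
    they are numerous. Gluing sends them to good words, at most [g.+1 ^ M] to one. *)
Lemma good_words_many s' eps : s' < s -> 0 < eps ->
  exists n0, forall n, (n0 <= n)%N -> expR (s' * n%:R) <= #|good_words n eps|%:R.
Proof.
move=> ss eps0; have C0 : 0 <= C by exact: le_trans C1.
(* Five errors of relative size [e] enter the exponents; the room between [s'] and [s] must cover
   the losses in the count. *)
pose e := Num.min (eps / 5) ((s - s') / 8).
have e0 : 0 < e by rewrite lt_min !divr_gt0 // subr_gt0.
have e5 : 5 * e <= eps by rewrite mulrC -ler_pdivlMr // ge_min lexx.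
have e8 : 8 * e <= s - s' by rewrite mulrC -ler_pdivlMr // ge_min lexx orbT.
pose al := \sum_i `|alpha 0 i|.
have al0 : 0 <= al by exact: sumr_ge0.
have ali i : `|alpha 0 i| <= al by rewrite /al (bigD1 i) //= lerDl sumr_ge0.
have [n1 hn1] := archi_lt ((C + g%:R * al + ln g.+1%:R + `|s'| * g%:R) / e).
have [n [q [nn n0 hm hz]]] := tilted_mean_exists C1 psi0 psiD psiE psiG hp hs n1 e0.
have lng : 0 <= ln (g.+1%:R : R) by rewrite ln_ge0 // ler1n.
have gal : 0 <= g%:R * al by rewrite mulr_ge0.
have sg : 0 <= `|s'| * g%:R by rewrite mulr_ge0.
have ne : C + g%:R * al + ln g.+1%:R + `|s'| * g%:R <= n%:R * e.
  rewrite -ler_pdivrMr //; apply: le_trans (ltW hn1) _; by rewrite ler_nat.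
have ne1 : C <= n%:R * e by lra.
have ne2 : g%:R * al <= n%:R * e by lra.
have ne3 : ln g.+1%:R <= n%:R * e by lra.
have ne4 : `|s'| * g%:R <= n%:R * e by lra.
have nR0 : 0 < n%:R :> R by rewrite ltr0n.
have qn0 := qnorm_ge0 q.
(* Chosen after [q], so that fluctuations of the exponents weighted by [q] still cost at most
   [n * e] per block. *)
pose kappa := n%:R * e / (1 + qnorm q).
have q10 : 0 < 1 + qnorm q by rewrite ltr_pwDl.
have neg0 : 0 < n%:R * e by exact: mulr_gt0.
have k0 : 0 < kappa by exact: divr_gt0.
have kn : kappa <= n%:R * e by rewrite ler_pdivrMr // ler_peMr ?(ltW neg0) // lerDl.
have kq : qnorm q * kappa <= n%:R * e.
  rewrite /kappa mulrCA ler_piMr ?(ltW neg0) // ler_pdivrMr // mul1r lerDr //.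
have [M0 hM0] := typical_sequences_mass n q k0.
have [M1 hM1] := archi_lt ((ln 2 + `|s'| * (n + g)%:R) / (n%:R * e)).
have [L0 hL0] := archi_lt ((C * (2 + (n + g)%:R) + (n + g)%:R * al) / e).
exists ((M0 + M1) * (n + g) + L0)%N => L hL.
pose M := (L %/ (n + g))%N; pose rem := (L %% (n + g))%N.
have ng0 : (0 < n + g)%N by rewrite addn_gt0 n0.
have LE : L = (M * (n + g) + rem)%N by exact: divn_eq.
have remlt : (rem < n + g)%N by exact: ltn_pmod.
have MM : (M0 + M1 <= M)%N by rewrite leq_divRL // (leq_trans _ hL) // leq_addr.
have LL0 : (L0 <= L)%N by rewrite (leq_trans _ hL) // leq_addl.
have ML : (M * (n + g) <= L)%N by rewrite LE leq_addr.
have Lrem : (L - M * (n + g) = rem)%N by rewrite LE addKn.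
clearbody M rem; clear hL.
have LER : L%:R = M%:R * (n%:R + g%:R) + rem%:R :> R by rewrite LE natrD natrM natrD.
have remR : rem%:R <= n%:R + g%:R :> R by rewrite -natrD ler_nat ltnW.
pose good (f : {ffun 'I_M -> {ffun 'I_n -> 'I_N}}) := [forall i : 'I_k,
  `|\sum_(j < M) psi i n (rep x0 (f j)) - M%:R * tilted_mean psi x0 q n i| <= M%:R * kappa].
have mass : 1 / 2 <= \sum_(f in ffun_on [in lang n] | good f)
    \prod_(j < M) gibbs (lang n) (fun w => qpsi psi q n (rep x0 w)) (f j).
  exact: hM0 M (leq_trans (leq_addr _ _) MM).
have goodE f : good f -> f \in ffun_on [in lang n] ->
    word L (glued_block x0 psiG f) \in good_words L eps.
  move=> /forallP gf _; rewrite inE word_language; apply/asboolP => i.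
  have h1 := glued_block_psi x0 psi0 psiD psiE psiG f i ML.
  rewrite Lrem !natrD in h1.
  apply: (good_exponent_algebra LER _ _ _ _ C0 (ltW e0) h1 (gf i) (hm i) kn ne1 (ali i) ne2 _ e5) => //.
  have hr : C * (2 + rem%:R) + rem%:R * al <= C * (2 + (n + g)%:R) + (n + g)%:R * al.
    by rewrite natrD; apply: lerD; [rewrite ler_wpM2l // lerD2l | rewrite ler_wpM2r].
  apply: le_trans hr _; rewrite -ler_pdivrMr // (le_trans (ltW hL0)) // ler_nat //.
have cnt : (#|[set f : {ffun 'I_M -> {ffun 'I_n -> 'I_N}} | (f \in ffun_on [in lang n]) && good f]%SET|%:R : R)
    <= g.+1%:R ^+ M * #|good_words L eps|%:R.
  have := @sum_glued_block _ _ _ _ psi C g x0 C1 psiG n M L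
    (fun f => (f \in ffun_on [in lang n]) && good f)
    (fun w => (w \in good_words L eps)%:R) ML.
  move=> /(_ _ _)/wrap[].
  - by move=> f /andP[/ffun_onP h _] i; exact: h.
  - by move=> w; case: (_ \in _).
  rewrite (eq_bigr (fun=> 1)) => [|f /andP[f1 f2]]; last by rewrite goodE.
  move=> hs'; rewrite -sum1_card natr_sum (eq_bigl (fun f => (f \in ffun_on [in lang n]) && good f)); last first.
    by move=> f; rewrite inE.
  apply: le_trans hs' _; rewrite ler_wpM2l ?exprn_ge0 //.
  rewrite -sum1_card natr_sum big_mkcond [leRHS]big_mkcond /=; apply: ler_sum => w _.
  by case: ifP => _; case: ifP.
have massle : 1 / 2 <= #|[set f : {ffun 'I_M -> {ffun 'I_n -> 'I_N}} | (f \in ffun_on [in lang n]) && good f]%SET|%:R *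
    expR (- (M%:R * (n%:R * (s - 2 * e)))).
  apply: le_trans mass _.
  rewrite -sum1_card natr_sum mulr_suml [leRHS](eq_bigl (fun f => (f \in ffun_on [in lang n]) && good f)); last first.
    by move=> f; rewrite inE.
  apply: ler_sum => f /andP[_ /forallP gf]; rewrite mul1r.
  rewrite /gibbs prodf_div prodr_const card_ord -expR_sum.
  have Z0 := Zsum_gt0 psi x0 q n.
  have -> : \sum_(w in lang n) expR (qpsi psi q n (rep x0 w)) = expR (ln (Z q n)) by rewrite lnK ?posrE.
  rewrite -expRM_natl -expRN -expRD ler_expR.
  have -> : \sum_(j < M) qpsi psi q n (rep x0 (f j)) = \sum_i q 0 i * \sum_(j < M) psi i n (rep x0 (f j)).
    by rewrite exchange_big /=; apply: eq_bigr => i _; rewrite mulr_sumr.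
  have := qpsi_dist q gf; rewrite ler_norml => /andP[_].
  have -> : \sum_i q 0 i * (M%:R * tilted_mean psi x0 q n i) = M%:R * \sum_i q 0 i * tilted_mean psi x0 q n i.
    by rewrite mulr_sumr; apply: eq_bigr => i _; rewrite mulrCA.
  have h1 : M%:R * (n%:R * (s - e)) <= M%:R * (ln (Z q n) - \sum_i q 0 i * tilted_mean psi x0 q n i).
    by rewrite ler_wpM2l.
  have h2 : M%:R * (qnorm q * kappa) <= M%:R * (n%:R * e) by rewrite ler_wpM2l.
  exact: gibbs_mass_algebra h1 h2.
pose X := (#|[set f : {ffun 'I_M -> {ffun 'I_n -> 'I_N}} | (f \in ffun_on [in lang n]) && good f]%SET|%:R : R).
rewrite -/X in cnt massle.
have hc : ln 2 + `|s'| * (n%:R + g%:R) <= M%:R * (n%:R * e).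
  rewrite -natrD -ler_pdivrMr // (le_trans (ltW hM1)) // ler_nat (leq_trans _ MM) // leq_addl //.
have := good_count_algebra LER _ _ _ _ remR (ltW e0) e8 ne3 ne4 hc => /(_ _ _ _ _)/wrap[//|//|//|//|fin].
have gp : 0 < g.+1%:R ^+ M :> R by rewrite exprn_gt0.
rewrite -(ler_pM2l gp); apply: le_trans _ cnt.
have E1 : expR (M%:R * (n%:R * (s - 2 * e))) / 2 <= X.
  have := ler_wpM2r (expR_ge0 (M%:R * (n%:R * (s - 2 * e)))) massle.
  by rewrite -(mulrA X) -expRD addNr expR0 mulr1 mul1r mulrC.
apply: le_trans _ E1; rewrite ler_pdivlMr //.
have -> : g.+1%:R ^+ M = expR (M%:R * ln g.+1%:R) :> R by rewrite expRM_natl lnK // posrE.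
have e2 : expR (ln 2) = 2 :> R by rewrite lnK // posrE.
rewrite -[X in _ * X <= _]e2 -!expRD ler_expR; move: fin.
rewrite [_ + s' * _]addrC => /(le_trans _); apply; exact: lexx.
Qed.

End GoodWords.

(** * Lower bound for the entropy *)

Section Kraft.
Context {R : realType} {T : choiceType}.
Variables (c : nat -> nat) (U : set T) (j : T -> nat) (D : T -> nat -> nat).
Hypothesis c0 : forall l, (0 < c l)%N.

(** The mass of a node of depth [l] when a unit mass is split evenly among children. *)
Let P l : R := \prod_(i < l) (c i)%:R^-1.
Let compat t l (d : nat -> nat) := [forall i : 'I_(minn l (j t)), d i == D t i].
(* The share of the mass of [t] that lies below the node of depth [l] with digits [d]. *)
Let share l d t : R := if compat t l d then P (maxn l (j t)) else 0.
Let upd d l v : nat -> nat := fun i => if i == l then v else d i.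

Let P_gt0 l : 0 < P l.
Proof. by apply: prodr_gt0 => i _; rewrite invr_gt0 ltr0n. Qed.

Let PS l : \sum_(v < c l) P l.+1 = P l.
Proof.
rewrite sumr_const card_ord /P big_ord_recr /= -[LHS]mulr_natr mulfVK //.
by rewrite pnatr_eq0 -lt0n.
Qed.

Let share_ge0 l d t : 0 <= share l d t.
Proof. by rewrite /share; case: ifP => // _; exact: ltW. Qed.

Let share_split l d t : \sum_(v < c l) share l.+1 (upd d l v) t <= share l d t.
Proof.
have updE v (i : nat) : (i < l)%N -> upd d l v i = d i.
  by move=> il; rewrite /upd ltn_eqF.
have sub v : compat t l.+1 (upd d l v) -> compat t l d.
  move=> /forallP h; apply/forallP => i.
  have hi : (i < minn l.+1 (j t))%N by have := ltn_ord i; lia.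
  have := h (Ordinal hi); rewrite /= updE //; have := ltn_ord i; lia.
case: (boolP (compat t l d)) => [hc|hc]; last first.
  rewrite big1 // => v _; rewrite /share; case: ifP => // /sub h.
  by rewrite h in hc.
have -> : share l d t = P (maxn l (j t)) by rewrite /share hc.
have [jl|lj] := leqP (j t) l.
  rewrite -PS; apply: ler_sum => v _; rewrite /share.
  rewrite (maxn_idPl (leqW jl)); case: ifP => // _; exact: ltW.
have key (v : 'I_(c l)) : v != D t l :> nat -> share l.+1 (upd d l v) t = 0.
  move=> hv; rewrite /share; case: ifP => // /forallP h.
  have hl : (l < minn l.+1 (j t))%N by lia.
  by have := h (Ordinal hl); rewrite /= /upd eqxx (negbTE hv).
have [Dc|Dc] := ltnP (D t l) (c l); last first.
  rewrite big1 ?(ltW (P_gt0 _)) // => v _; apply: key.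
  by rewrite neq_ltn (leq_trans (ltn_ord v) Dc).
rewrite (bigD1 (Ordinal Dc)) //= big1 ?addr0 => [|v hv]; last exact: key.
by rewrite /share (maxn_idPr lj); case: ifP => // _; exact: ltW.
Qed.

Let S l d : \bar R := (\esum_(t in U) (share l d t)%:E)%E.

Let S_split l d : (\sum_(v < c l) S l.+1 (upd d l v) <= S l d)%E.
Proof.
rewrite /S -esum_sum => [|v t _ _]; last by rewrite lee_fin.
apply: le_esum => t _; rewrite sumEFin lee_fin; exact: share_split.
Qed.

Let light_child l d : (S l d < (P l)%:E)%E ->
  exists2 v : nat, (v < c l)%N & (S l.+1 (upd d l v) < (P l.+1)%:E)%E.
Proof.
move=> h; apply: contrapT => hn; move: h; rewrite ltNge => /negP; apply.
apply: le_trans _ (S_split l d); rewrite -PS -sumEFin; apply: lee_sum => v _.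
rewrite leNgt; apply/negP => hv; apply: hn; by exists v.
Qed.

Let next l d := xget 0%N [set v | (v < c l)%N /\ (S l.+1 (upd d l v) < (P l.+1)%:E)%E].
Let Fixpoint pref l : nat -> nat := if l is m.+1 then upd (pref m) m (next m (pref m)) else fun=> 0%N.

(** Each [t] marks the node of depth [j t] with digits [D t]. If the marked mass were less than 1,
    some child would always receive less marked mass than its own; following such children gives an
    infinite branch, yet the mark on that branch alone fills its node. The family may be
    infinite. *)
Lemma kraft : (forall d : nat -> nat, (forall l, (d l < c l)%N) ->
    exists2 t, U t & forall l, (l < j t)%N -> d l = D t l) ->
  ((1 : R)%:E <= \esum_(t in U) (\prod_(i < j t) (c i)%:R^-1)%:E)%E.
Proof.
move=> cover; have -> : (\esum_(t in U) (\prod_(i < j t) (c i)%:R^-1)%:E)%E = S 0 (fun=> 0%N).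
  apply: eq_esum => t _; rewrite /share (_ : compat t 0 _); last first.
    by apply/forallP => -[i]; rewrite min0n.
  by rewrite max0n.
rewrite leNgt; apply/negP => S0.
have nextP l d : (S l d < (P l)%:E)%E -> (next l d < c l)%N /\ (S l.+1 (upd d l (next l d)) < (P l.+1)%:E)%E.
  move=> /light_child[v v1 v2].
  exact: (@xgetPex _ 0%N [set v | (v < c l)%N /\ (S l.+1 (upd d l v) < (P l.+1)%:E)%E]) (ex_intro _ v (conj v1 v2)).
have Sp l : (S l (pref l) < (P l)%:E)%E.
  elim: l => [|l IH] /=; first by rewrite /P big_ord0.
  by have [] := nextP _ _ IH.
pose d i := pref i.+1 i.
have dE l i : (i < l)%N -> pref l i = d i.
  elim: l => [//|l IH]; rewrite ltnS leq_eqVlt => /orP[/eqP ->//|il].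
  by rewrite /= /upd ltn_eqF // IH.
have [t Ut tD] : exists2 t, U t & forall l, (l < j t)%N -> d l = D t l.
  by apply: cover => l; rewrite /d /= /upd eqxx; have [] := nextP _ _ (Sp l).
have := Sp (j t); rewrite ltNge => /negP; apply.
rewrite /S; apply: esum_ge; exists [set t]; first by split=> // u ->.
rewrite fsbig_set1 lee_fin /share (_ : compat _ _ _) ?maxnn //.
apply/forallP => i; have il := ltn_ord i; rewrite dE; last lia.
by rewrite tD //; lia.
Qed.

End Kraft.

(** Lets the tolerance tend to 0 along the lengths: [J n] is the largest index below [n] whose
    threshold [n] has passed. *)
Lemma diagonal_index (P : nat -> nat -> Prop) :
  (forall j, exists n0, forall n, (n0 <= n)%N -> P n j) ->
  exists J : nat -> nat, exists2 n1, (0 < n1)%N & (forall n, (n1 <= n)%N -> P n (J n)) /\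
    forall j, exists n0, forall n, (n0 <= n)%N -> (j <= J n)%N.
Proof.
move=> /choice[n0 hn0]; pose J n := \max_(i < n | (n0 i <= n)%N) (i : nat).
exists J; exists (n0 0%N).+1 => //; split=> [n hn|j].
  have n_gt0 : (0 < n)%N by lia.
  have h0 : (n0 (Ordinal n_gt0) <= n)%N by rewrite /= ltnW.
  have hc : (0 < #|[pred i : 'I_n | (n0 i <= n)%N]|)%N by apply/card_gt0P; exists (Ordinal n_gt0).
  have [i hi E] := @eq_bigmax_cond _ [pred i : 'I_n | (n0 i <= n)%N] (fun i => (i : nat)) hc.
  by rewrite /J E; apply: hn0.
exists (maxn (n0 j) j.+1) => n; rewrite geq_max => /andP[h1 h2].
exact: (@leq_bigmax_cond _ (fun i : 'I_n => (n0 i <= n)%N) (fun i => (i : nat)) (Ordinal h2)).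
Qed.

(** The fibres of [f] on [F] have at most [g.+1] elements, so the image has at least the rounded-up
    quotient of [#|F|] by [g.+1]; one preimage is kept for each value. *)
Lemma fiber_selection (S B : finType) (F : {set S}) (f : S -> B) g (h : S -> 'I_g.+1) (s0 : S) :
  {in F &, injective (fun a => (f a, h a))} ->
  exists sel : nat -> S, forall v, (v < (#|F| + g) %/ g.+1)%N -> sel v \in F /\
    forall v', (v' < (#|F| + g) %/ g.+1)%N -> f (sel v) = f (sel v') -> v = v'.
Proof.
move=> inj; set c := (_ %/ _)%N.
have cI : (c <= #|f @: F|)%N.
  have hF : (#|F| <= #|f @: F| * g.+1)%N.
    rewrite -(card_in_imset inj) -[X in (_ * X)%N]card_ord -cardsT -cardsX.
    apply: subset_leq_card; apply/fintype.subsetP => _ /imsetP[a aF ->]; rewrite inE /= inE andbT.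
    exact: imset_f.
  rewrite /c -ltnS ltn_divLR // mulSn; move: hF; lia.
pose im := enum (f @: F); pose sel v := odflt s0 [pick a in F | f a == nth (f s0) im v].
have selP v : (v < c)%N -> sel v \in F /\ f (sel v) = nth (f s0) im v.
  move=> vc; have vi : (v < size im)%N by rewrite -cardE (leq_trans vc).
  have := mem_nth (f s0) vi; rewrite mem_enum => /imsetP[a aF ea].
  rewrite /sel; case: pickP => [b /andP[bF /eqP]//|/(_ a)] /=.
  by rewrite aF ea eqxx.
exists sel => v vc; have [h1 h2] := selP v vc; split=> // v' vc'.
have [_ h2'] := selP v' vc'; rewrite h2 h2' => /eqP.
by rewrite nth_uniq ?enum_uniq -?cardE ?(leq_trans vc) ?(leq_trans vc') // => /eqP.
Qed.

Lemma level_exists (len : nat -> nat) : len 0%N = 0%N -> (forall l, (l <= len l)%N) ->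
  exists j : nat -> nat, forall n, (len (j n) <= n < len (j n).+1)%N.
Proof.
move=> len0 hlen.
suff /choice[j hj] : forall n, exists l, (len l <= n < len l.+1)%N by exists j.
move=> n.
have ex : exists l, (n < len l.+1)%N by exists n; exact: hlen.
case: (ex_minnP ex) => l hl hmin; exists l; rewrite hl andbT.
case: l hl hmin => [|l] hl hmin; first by rewrite len0.
by rewrite leqNgt; apply/negP => /hmin; rewrite ltnn.
Qed.

(** Young's inequality. It absorbs losses proportional to the number of levels, the length being
    quadratic in it. *)
Lemma linear_le_square (R : realType) (K l n d : R) : 0 < d -> l ^+ 2 <= 2 * n ->
  K * l <= d * n + K ^+ 2 / (2 * d).
Proof.
move=> d0 h; have h2 : 0 <= (K - d * l) ^+ 2 by exact: sqr_ge0.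
have d2 : 0 < 2 * d by rewrite mulr_gt0.
rewrite -(ler_pM2l d2) mulrDr [2 * d * (_ / _)]mulrC divfK ?gt_eqF //.
have h3 : d ^+ 2 * l ^+ 2 <= d ^+ 2 * (2 * n) by rewrite ler_wpM2l // sqr_ge0.
have e2 : (K - d * l) ^+ 2 = K ^+ 2 - 2 * d * (K * l) + d ^+ 2 * l ^+ 2 by ring.
have e3 : d ^+ 2 * (2 * n) = 2 * d * (d * n) by ring.
rewrite e2 in h2; rewrite e3 in h3; lra.
Qed.

Lemma branch_level_algebra (R : realType) (X Y S K c q hn hl : R) :
  S <= K + hl -> X + Y <= hn + q -> c + K + q <= hn -> hl <= hn -> X + c + Y + S <= 3 * hn.
Proof. by move=> h1 h2 h3 h4; lra. Qed.

Lemma branch_weight_algebra (R : realType) (s s' n S d j lg A b c : R) :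
  n = d + S -> lg * j + A <= (s * n - s' * n) / 2 + c -> b + c <= (s * n - s' * n) / 2 ->
  s * d <= A + b -> - (s * S - lg * j) <= - (s' * n).
Proof. by move=> -> h1 h2 h3; lra. Qed.

(** * Growth of the tree of glued words *)

Section Branching.
Context {N : nat} {R : realType}.
Variables (g n1 : nat) (F : forall l, {set {ffun 'I_(l + n1.+1) -> 'I_N}}).

Local Notation nn := (fun l => (l + n1.+1)%N).
Local Notation len := (glued_length g nn).

Definition branching l : nat := ((#|F l| + g) %/ g.+1)%N.

Lemma le_glued_length l : (l <= len l)%N.
Proof. by elim: l => [//|l IH] /=; lia. Qed.

Lemma block_length_sum l : (len l = \sum_(j < l) nn j + l * g)%N.
Proof.
elim: l => [|l IH]; first by rewrite big_ord0.
rewrite big_ord_recr /= IH mulSn; move: (\sum_(_ < _) _)%N (l * g)%N => a b; lia.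
Qed.

(** Blocks get longer by one symbol per level. The gaps and the incomplete last block are then
    linear in [l], hence negligible against the total length, while block lengths still tend to
    infinity. *)
Lemma glued_length_square l : (l * l <= 2 * len l)%N.
Proof. by elim: l => [//|l IH] /=; lia. Qed.

Lemma glued_length_square_le l n : (len l <= n)%N -> (l%:R : R) ^+ 2 <= 2 * n%:R.
Proof.
move=> ln; rewrite -natrX -natrM ler_nat -mulnn.
by apply: leq_trans (glued_length_square l) _; rewrite leq_mul2l.
Qed.

Variables (s1 s' : R).
Hypothesis Fcard : forall l, expR (s1 * (nn l)%:R) <= #|F l|%:R.

Lemma branching_ge l : expR (s1 * (nn l)%:R - ln g.+1%:R) <= (branching l)%:R.
Proof.
have gp : 0 < g.+1%:R :> R by rewrite ltr0n.
rewrite expRD expRN lnK ?posrE // ler_pdivrMr //; apply: le_trans (Fcard l) _.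
rewrite -natrM ler_nat /branching.
have := divn_eq (#|F l| + g) g.+1; have := ltn_pmod (#|F l| + g) (ltn0Sn g).
move: (_ %/ _)%N (_ %% _)%N => a b hb ha; rewrite -(leq_add2r g) ha; lia.
Qed.

Lemma branching_gt0 l : (0 < branching l)%N.
Proof. by rewrite -(ltr0n R); apply: lt_le_trans (branching_ge l); exact: expR_gt0. Qed.

Lemma branch_weight : s' < s1 -> exists n0, forall n j, (n0 <= n)%N -> (len j <= n < len j.+1)%N ->
  \prod_(l < j) (branching l)%:R^-1 <= expR (- s' * n%:R).
Proof.
move=> s1s; pose h := (s1 - s') / 2; have h0 : 0 < h by rewrite divr_gt0 // subr_gt0.
(* Per level: the multiplicity of gluing, the gap, and the growth of the incomplete block. The
   constant [c0] is the part of the incomplete block that does not depend on the level. *)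
pose c1 := ln g.+1%:R + `|s1| * g.+1%:R; pose c0 := `|s1| * (n1 + g + 1)%:R.
have [n0 hn0] := archi_lt ((c0 + c1 ^+ 2 / (2 * h)) / h).
exists n0 => n j hn /andP[jn nj].
apply: (@le_trans _ _ (\prod_(l < j) expR (- (s1 * (nn l)%:R - ln g.+1%:R)))).
  apply: ler_prod => l _; rewrite invr_ge0 ler0n /= expRN lef_pV2 ?posrE ?expR_gt0 //.
    exact: branching_ge.
  by rewrite ltr0n branching_gt0.
rewrite -expR_sum ler_expR sumrN sumrB -mulr_sumr -natr_sum sumr_const card_ord -[_ *+ j]mulr_natl.
have b3 := linear_le_square c1 h0 (glued_length_square_le jn).
have b4 : c0 + c1 ^+ 2 / (2 * h) <= h * n%:R.
  by rewrite [h * _]mulrC -ler_pdivrMr //; apply: le_trans (ltW hn0) _; rewrite ler_nat.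
set S := (\sum_(_ < _) _)%N.
have b5 : s1 * (n - S)%:R <= `|s1| * (j * g.+1 + (n1 + g + 1))%:R.
  apply: (@le_trans _ _ (`|s1| * (n - S)%:R)); first by rewrite ler_wpM2r // ler_norm.
  rewrite ler_wpM2l // ler_nat; move: nj => /=; rewrite block_length_sum -/S mulnS.
  move: (j * g)%N => jg; lia.
have Sn : (S <= n)%N.
  by apply: leq_trans jn; rewrite block_length_sum; exact: leq_addr.
have e1 : n%:R = (n - S)%:R + S%:R :> R by rewrite -natrD subnK.
have e2 : `|s1| * (j * g.+1 + (n1 + g + 1))%:R = `|s1| * g.+1%:R * j%:R + c0.
  by rewrite natrD mulrDr natrM [_ * g.+1%:R]mulrC mulrA.
have e4 : c1 * j%:R = ln g.+1%:R * j%:R + `|s1| * g.+1%:R * j%:R by rewrite mulrDl.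
have e5 : h * n%:R = (s1 * n%:R - s' * n%:R) / 2 by rewrite /h; field.
rewrite e5 in b3 b4; rewrite e4 in b3; rewrite e2 in b5.
rewrite mulNr [j%:R * _]mulrC; exact: branch_weight_algebra e1 b3 b4 b5.
Qed.

End Branching.

Section MoranTree.
Context {N : nat} {Q : 'M[bool]_N} {R : realType} {k : nat}.
Local Notation Sigma := (subshift Q).
Local Notation lang := (@language N Q).
Variables (psi : 'I_k -> nat -> Sigma -> R) (C : R) (g : nat) (x0 : Sigma).
Implicit Types (x : Sigma) (d : nat -> nat).
Hypothesis C1 : 1 <= C.
Hypothesis psi0 : forall i x, `|psi i 0 x| <= C.
Hypothesis psiD : forall i n x y, (forall j : nat, (j < n)%N -> symbol x j = symbol y j) ->
  `|psi i n x - psi i n y| <= C.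
Hypothesis psiE : forall i n m x, `|psi i (n + m) x - psi i n x| <= C * m%:R.
Hypothesis psiG : forall x n y m, exists v : Sigma, exists2 l : nat, (l <= g)%N &
  [/\ forall i : int, i < n%:Z -> symbol v i = symbol x i,
      forall i : int, 0 <= i -> symbol (sigma_shift (n + l)%N%:Z v) i = symbol y i
    & forall i, `|psi i (n + m + g) v - (psi i n x + psi i m y)| <= C].
Variables (n1 : nat) (F : forall l, {set {ffun 'I_(l + n1.+1) -> 'I_N}}).
Hypothesis Flang : forall l w, w \in F l -> w \in lang (l + n1.+1)%N.

Local Notation nn := (fun l => (l + n1.+1)%N).
Local Notation len := (glued_length g nn).

(** Block and gap length can be read off the glued word together; keeping one block per word makes
    the word alone decisive. The selection depends on the node [x], because gluing does. *)
Lemma child_selection l x : exists sel : nat -> {ffun 'I_(nn l) -> 'I_N},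
  forall v, (v < branching g F l)%N -> sel v \in F l /\ forall v', (v' < branching g F l)%N ->
    word (len l.+1) (gluing psiG (len l) x (nn l) (rep x0 (sel v))) =
    word (len l.+1) (gluing psiG (len l) x (nn l) (rep x0 (sel v'))) -> v = v'.
Proof.
apply: (@fiber_selection _ _ (F l)
  (fun w => word (len l.+1) (gluing psiG (len l) x (nn l) (rep x0 w))) g
  (fun w => inord (glue_gap psiG (len l) x (nn l) (rep x0 w))) (word (nn l) x0)).
move=> w w' wF w'F [/word_eqP e /(congr1 (@nat_of_ord _))].
rewrite !inordK ?ltnS ?glue_gap_le // => eg.
rewrite -(repK x0 (Flang wF)) -(repK x0 (Flang w'F)); apply/word_eqP => i hi.
have [_ h _] := glueP psiG (len l) x (nn l) (rep x0 w).
have [_ h' _] := glueP psiG (len l) x (nn l) (rep x0 w').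
rewrite -h // -h' // !symbol_shift -eg -PoszD e //=.
have := glue_gap_le psiG (len l) x (nn l) (rep x0 w); lia.
Qed.

Definition child l x : nat -> {ffun 'I_(nn l) -> 'I_N} := sval (cid (child_selection l x)).

Lemma child_good l x v : (v < branching g F l)%N -> child l x v \in F l.
Proof. by rewrite /child; case: (cid _) => sel /= h /h[]. Qed.

Lemma child_inj l x v v' : (v < branching g F l)%N -> (v' < branching g F l)%N ->
  word (len l.+1) (gluing psiG (len l) x (nn l) (rep x0 (child l x v))) =
  word (len l.+1) (gluing psiG (len l) x (nn l) (rep x0 (child l x v'))) -> v = v'.
Proof. by rewrite /child; case: (cid _) => sel /= h /h[_ h'] /h'. Qed.

Fixpoint node d l : Sigma := if l is m.+1
  then gluing psiG (len m) (node d m) (nn m) (rep x0 (child m (node d m) (d m))) else x0.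

Let block d l : Sigma := rep x0 (child l (node d l) (d l)).

Lemma node_glued d l : node d l = glued x0 psiG nn (block d) l.
Proof. by elim: l => [//|l IH] /=; rewrite -IH. Qed.

Lemma node_agree d l l' (i : int) : (l <= l')%N -> i < (len l)%:Z ->
  symbol (node d l') i = symbol (node d l) i.
Proof. by move=> ll il; rewrite !node_glued; exact: glued_agree. Qed.

Lemma branch_limit d : exists x, forall l (i : int), i < (len l)%:Z ->
  symbol x i = symbol (node d l) i.
Proof.
pose f (i : int) := symbol (node d `|i|.+1) i.
have fE l (i : int) : i < (len l)%:Z -> f i = symbol (node d l) i.
  move=> il; rewrite /f -(@node_agree d `|i|.+1 (maxn `|i|.+1 l)) ?leq_maxl //; last first.
    have := le_glued_length g n1 `|i|.+1; lia.
  by apply: node_agree => //; exact: leq_maxr.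
have fQ i : Q (f i) (f (i + 1)).
  have h := le_glued_length g n1 (maxn `|i|.+1 `|i + 1|.+1).
  rewrite (fE (maxn `|i|.+1 `|i + 1|.+1) i); last lia.
  by rewrite (fE (maxn `|i|.+1 `|i + 1|.+1)) ?(svalP (node d _)) //; lia.
by exists (exist _ f fQ) => l i il; exact: fE.
Qed.

Definition branch d : Sigma := sval (cid (branch_limit d)).

Lemma branchE d l (i : int) : i < (len l)%:Z -> symbol (branch d) i = symbol (node d l) i.
Proof. by rewrite /branch; case: (cid _) => x /= h /h. Qed.

(** Induction on the level: equal digits so far give the same node, hence the same selection, and
    the next digit is decided by the word up to [len l.+1]. *)
Lemma branch_digits d d' n J : (forall l, (d l < branching g F l)%N) ->
  (forall l, (d' l < branching g F l)%N) -> (len J <= n)%N ->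
  word n (branch d) = word n (branch d') -> forall l, (l < J)%N -> d l = d' l.
Proof.
move=> hd hd' Jn /word_eqP e.
suff h l : (l <= J)%N -> node d l = node d' l /\ forall m, (m < l)%N -> d m = d' m.
  by case: (h J (leqnn J)).
elim: l => [//|l IH] lJ; have [en ed] := IH (ltnW lJ).
have dl : d l = d' l.
  apply: (@child_inj l (node d l)) => //; apply/word_eqP => j hj.
  rewrite [in RHS]en -/(node d l.+1) -/(node d' l.+1) -!branchE ?ltz_nat // e //.
  by apply: leq_trans hj _; apply: leq_trans Jn; exact: glued_length_le.
by split=> [|m]; [rewrite /= en dl | rewrite ltnS leq_eqVlt => /orP[/eqP->//|/ed]].
Qed.

Lemma branch_block_sum d i l :
  `|psi i (len l) (branch d) - \sum_(j < l) psi i (nn j) (block d j)| <= C * (l + 2)%:R.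
Proof.
have h1 : `|psi i (len l) (branch d) - psi i (len l) (node d l)| <= C.
  by apply: psiD => j hj; rewrite (@branchE d l) // ltz_nat.
have h2 := @glued_psi _ _ _ _ psi C g x0 psi0 psiG nn (block d) i l.
rewrite -node_glued in h2.
have -> : C * (l + 2)%:R = C + C * l.+1%:R by rewrite addn2 -[l.+2%:R]natr1; ring.
by apply: le_trans (ler_distD (psi i (len l) (node d l)) _ _) _; exact: lerD.
Qed.

Variables (alpha : 'rV[R]_k) (e : nat -> R).
Hypothesis Fgood : forall l w, w \in F l -> forall i,
  `|psi i (nn l) (rep x0 w) - (nn l)%:R * alpha 0 i| <= (nn l)%:R * e l.

Let al i := `|alpha 0 i|.

Lemma branch_exponent d i l n : (forall l, (d l < branching g F l)%N) -> (len l <= n < len l.+1)%N ->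
  `|psi i n (branch d) - n%:R * alpha 0 i| <=
    (C * 2 + al i) * (l + n1 + g + 2)%:R + l%:R * g%:R * al i + \sum_(j < l) (nn j)%:R * e j.
Proof.
move=> hd /andP[ln nl]; have C0 : 0 <= C by exact: le_trans C1.
have h1 := psiE i (len l) (n - len l) (branch d); rewrite subnKC // in h1.
have h2 := branch_block_sum d i l.
have h3 : `|\sum_(j < l) psi i (nn j) (block d j) - (\sum_(j < l) nn j)%:R * alpha 0 i| <=
    \sum_(j < l) (nn j)%:R * e j.
  rewrite natr_sum mulr_suml -sumrB; apply: le_trans (ler_norm_sum _ _ _) _.
  by apply: ler_sum => j _; apply: Fgood; exact: child_good.
have h4 : (n - len l <= l + n1 + g + 2)%N by move: nl => /=; lia.
have h5 : `|(\sum_(j < l) nn j)%:R * alpha 0 i - n%:R * alpha 0 i| <=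
    l%:R * g%:R * al i + (l + n1 + g + 2)%:R * al i.
  have -> : n%:R = (\sum_(j < l) nn j)%:R + l%:R * g%:R + (n - len l)%:R :> R.
    by rewrite -natrM -!natrD; congr (_%:R); rewrite -block_length_sum subnKC.
  rewrite -mulrBl normrM -mulrDl ler_wpM2r ?normr_ge0 //.
  rewrite -addrA opprD addrA subrr add0r normrN ger0_norm; last first.
    by apply: addr_ge0 => //; exact: mulr_ge0.
  by rewrite lerD2l ler_nat.
have h6 : C * (n - len l)%:R <= C * (l + n1 + g + 2)%:R by rewrite ler_wpM2l // ler_nat.
have h7 : C * (l + 2)%:R <= C * (l + n1 + g + 2)%:R by rewrite ler_wpM2l // ler_nat; lia.
have h8 := dist_triangle3 (le_trans h1 h6) (le_trans h2 h7) h3.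
have -> : psi i n (branch d) - n%:R * alpha 0 i =
  (psi i n (branch d) - (\sum_(j < l) nn j)%:R * alpha 0 i) +
  ((\sum_(j < l) nn j)%:R * alpha 0 i - n%:R * alpha 0 i) by rewrite addrA subrK.
apply: le_trans (ler_normD _ _) _; apply: le_trans (lerD h8 h5) _.
rewrite le_eqVlt; apply/orP; left; apply/eqP; ring.
Qed.

Hypothesis e_ge0 : forall l, 0 <= e l.
Hypothesis e_small : forall h : R, 0 < h -> exists l0, forall l, (l0 <= l)%N -> e l <= h.

(** A Cesàro argument: the first [l0] levels contribute a constant, the others at most [h] per
    symbol. *)
Lemma tolerance_sum (h : R) : 0 < h -> exists K, forall l,
  \sum_(j < l) (nn j)%:R * e j <= K + h * (len l)%:R.
Proof.
move=> h0; have [l0 hl0] := e_small h0.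
exists (\sum_(j < l0) (nn j)%:R * e j) => l.
have pos j : 0 <= (nn j)%:R * e j by exact: mulr_ge0.
have [ll|ll] := leqP l l0.
  apply: (@le_trans _ _ (\sum_(j < l0) (nn j)%:R * e j)); last first.
    by rewrite lerDl mulr_ge0 // ltW.
  rewrite -!(big_mkord xpredT (fun j => (nn j)%:R * e j)) [leRHS](big_cat_nat (leq0n _) ll) //=.
  by rewrite lerDl sumr_ge0.
rewrite -!(big_mkord xpredT (fun j => (nn j)%:R * e j)) (big_cat_nat (leq0n _) (ltnW ll)) //=.
rewrite lerD2l; apply: (@le_trans _ _ (\sum_(l0 <= j < l) (nn j)%:R * h)).
  rewrite big_nat_cond [leRHS]big_nat_cond; apply: ler_sum => j /andP[/andP[jl _] _].
  by rewrite ler_wpM2l ?hl0.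
rewrite -mulr_suml mulrC ler_wpM2l ?(ltW h0) // -natr_sum ler_nat block_length_sum.
apply: (@leq_trans (\sum_(j < l) nn j)%N); last exact: leq_addr.
rewrite -[X in (_ <= X)%N](big_mkord xpredT (fun j => nn j)) (big_cat_nat (leq0n _) (ltnW ll)) //=.
exact: leq_addl.
Qed.

Lemma branch_level d i : (forall l, (d l < branching g F l)%N) ->
  n%:R^-1 * psi i n (branch d) @[n --> \oo] --> alpha 0 i.
Proof.
move=> hd; apply/cvgrPdist_le => eta eta0; 
have [j hj] := @level_exists len erefl (le_glued_length g n1).
(* Three shares of [h * n]: the losses linear in the level, the tolerances of the blocks, and all
   the constants. *)
pose h := eta / 3; have h0 : 0 < h by exact: divr_gt0.
have [K hK] := tolerance_sum h0.
pose c1 := C * 2 + al i + g%:R * al i; pose c0 := (C * 2 + al i) * (n1 + g + 2)%:R.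
have [n0 hn0] := archi_lt ((c0 + K + c1 ^+ 2 / (2 * h)) / h).
exists n0.+1 => // n /= hn; have nR : 0 < n%:R :> R by rewrite ltr0n (leq_trans _ hn).
have hjn := hj n; have /andP[jn _] := hjn.
have b1 := branch_exponent i hd hjn.
have b2 := hK (j n).
have b3 := linear_le_square c1 h0 (glued_length_square_le jn).
have b4 : c0 + K + c1 ^+ 2 / (2 * h) <= h * n%:R.
  rewrite [h * _]mulrC -ler_pdivrMr //; apply: le_trans (ltW hn0) _; rewrite ler_nat; exact: ltnW.
have b5 : h * (len (j n))%:R <= h * n%:R by rewrite ler_wpM2l ?(ltW h0) // ler_nat.
have b6 : `|psi i n (branch d) - n%:R * alpha 0 i| <= n%:R * eta.
  have e3 : n%:R * eta = 3 * (h * n%:R) by rewrite /h; field.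
  have e4 : (C * 2 + al i) * (j n + n1 + g + 2)%:R = (C * 2 + al i) * (j n)%:R + c0.
    by rewrite /c0 -mulrDr -natrD -!addnA.
  have e5 : c1 * (j n)%:R = (C * 2 + al i) * (j n)%:R + (j n)%:R * g%:R * al i.
    by rewrite /c1; ring.
  apply: le_trans b1 _; rewrite e4 e3; rewrite e5 in b3.
  exact: branch_level_algebra b2 b3 b4 b5.
rewrite distrC -(ler_pM2l nR) -{1}(gtr0_norm nR) -normrM mulrBr mulrA divff ?gt_eqF //.
by rewrite mul1r.
Qed.

End MoranTree.

Section BowenSums.
Context {N : nat} {Q : 'M[bool]_N} {R : realType}.
Local Notation Sigma := (subshift Q).
Variable omega : R.
Implicit Types (x y : Sigma) (Y : set Sigma).

Lemma ball_word n x y e : e <= 1 -> Bowen_ball omega n x e y -> word n x = word n y.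
Proof.
move=> e1 h; apply/word_eqP => j jn.
have := @dist_lt1 N Q R omega (sigma_shift j x) (sigma_shift j y).
rewrite !symbol_shift add0r; apply; apply: lt_le_trans e1.
apply: le_lt_trans h; rewrite /dist_n.
exact: (@le_bigmax _ R 'I_n 0 (fun j => dist omega (sigma_shift j x) (sigma_shift j y)) (Ordinal jn)).
Qed.

Lemma Bowen_sum_mono Y s e : {homo Bowen_sum omega Y s ^~ e : n m / (n <= m)%N >-> (n <= m)%E}.
Proof.
move=> n m nm; apply: le_ereal_inf => _ [U [Uc Um UY] <-]; exists U => //.
by split=> // c /Um; exact: leq_trans.
Qed.

Lemma Bowen_lim_ge1 Y s e M0 : (forall M, (M0 <= M)%N -> (1 <= Bowen_sum omega Y s M e)%E) ->
  Bowen_lim omega Y s e <> 0%E.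
Proof.
move=> h; suff : (1 <= Bowen_lim omega Y s e)%E by move=> h1 h2; rewrite h2 lee_fin ler10 in h1.
apply: lime_ge; first exact/ereal_nondecreasing_is_cvgn/Bowen_sum_mono.
by exists M0.
Qed.

End BowenSums.

Section LowerBound.
Context {N : nat} {Q : 'M[bool]_N} {R : realType} {k : nat}.
Local Notation Sigma := (subshift Q).
Variables (psi : 'I_k -> nat -> Sigma -> R) (C : R) (g : nat) (x0 : Sigma).
Hypothesis C1 : 1 <= C.
Hypothesis psi0 : forall i x, `|psi i 0 x| <= C.
Hypothesis psiD : forall i n x y, (forall j : nat, (j < n)%N -> symbol x j = symbol y j) ->
  `|psi i n x - psi i n y| <= C.
Hypothesis psiE : forall i n m x, `|psi i (n + m) x - psi i n x| <= C * m%:R.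
Hypothesis psiG : forall x n y m, exists v : Sigma, exists2 l : nat, (l <= g)%N &
  [/\ forall i : int, i < n%:Z -> symbol v i = symbol x i,
      forall i : int, 0 <= i -> symbol (sigma_shift (n + l)%N%:Z v) i = symbol y i
    & forall i, `|psi i (n + m + g) v - (psi i n x + psi i m y)| <= C].
Variables (alpha : 'rV[R]_k) (s : R).
Hypothesis many : forall s' eps, s' < s -> 0 < eps ->
  exists n0, forall n, (n0 <= n)%N -> expR (s' * n%:R) <= #|good_words psi x0 alpha n eps|%:R.

Definition level_set : set Sigma :=
  [set x | forall i, n%:R^-1 * psi i n x @[n --> \oo] --> alpha 0 i].

(** In a ball of radius at most 1 all branches share the digits up to the level reached at its
    length. A cover of the level set therefore marks every branch of the tree; [kraft] bounds the
    total node mass from below, and [branch_weight] bounds each mass by the Bowen weight. *)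
Lemma Bowen_lim_lower_bound omega s' e : s' < s -> e <= 1 ->
  Bowen_lim omega level_set s' e <> 0%E.
Proof.
move=> ss e1; pose s1 := (s + s') / 2.
have [s1s s's1] : s1 < s /\ s' < s1 by rewrite /s1; split; lra.
pose tol j : R := j.+1%:R^-1.
have tol0 j : 0 < tol j by rewrite invr_gt0.
have [J [n1 n1_gt0 [hJ Jinf]]] := @diagonal_index
  (fun n j => expR (s1 * n%:R) <= #|good_words psi x0 alpha n (tol j)|%:R) (fun j => many s1s (tol0 j)).
pose N1 := n1.-1; pose e' l := tol (J (l + N1.+1)%N).
pose F l := good_words psi x0 alpha (l + N1.+1) (e' l).
have Fcard l : expR (s1 * (l + N1.+1)%:R) <= #|F l|%:R.
  by apply: hJ; rewrite /N1 prednK // leq_addl.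
have Flang l w : w \in F l -> w \in @language N Q (l + N1.+1)%N by rewrite inE => /andP[].
have Fgood l (w : {ffun 'I_(l + N1.+1) -> 'I_N}) : w \in F l -> forall i,
    `|psi i (l + N1.+1)%N (rep x0 w) - (l + N1.+1)%:R * alpha 0 i| <= (l + N1.+1)%:R * e' l.
  by rewrite inE => /andP[_ /asboolP].
have e'0 l : 0 <= e' l by exact: ltW (tol0 _).
have e'_small h : 0 < h -> exists l0, forall l, (l0 <= l)%N -> e' l <= h.
  move=> h0; have [j hj] := archi_lt h^-1; have [l0 hl0] := Jinf j.
  exists l0 => l ll; rewrite -[h]invrK /e' /tol lef_pV2 ?posrE ?invr_gt0 //.
  apply: le_trans (ltW hj) _; rewrite ler_nat; apply: leqW; apply: hl0; lia.
have [n0 hn0] := branch_weight g Fcard s's1.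
have c0 := branching_gt0 g Fcard.
pose c := branching g F; pose X d := branch x0 C1 psiG Flang d.
have [j hj] := @level_exists (glued_length g (fun l => (l + N1.+1)%N)) erefl (le_glued_length g N1).
apply: (@Bowen_lim_ge1 _ _ _ _ _ _ _ n0) => M MM.
apply: le_ereal_inf_tmp => _ [U [Uc Um UY] <-].
pose valid (u : nat * Sigma) d := (forall l, (d l < c l)%N) /\ Bowen_ball omega u.1 u.2 e (X d).
(* The digits of one branch inside the ball [u]; the default serves the balls that meet no
   branch. *)
pose D u := xget (fun=> 0%N) [set d | valid u d].
apply: le_trans (@kraft R _ c U (fun u => j u.1) D c0 _) _.
  move=> d hd; have [u Uu hu] : (\bigcup_(c in U) Bowen_ball omega c.1 c.2 e) (X d).
    apply: UY => i; exact: (@branch_level _ _ _ _ psi C g x0 C1 psi0 psiD psiE psiG N1 F Flang alpha e' Fgood e'0 e'_small d i hd).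
  exists u => // l lj; have [hD1 hD2] : valid u (D u).
    exact: (@xgetPex _ _ [set d | valid u d]) (ex_intro _ d (conj hd hu)).
  apply: (@branch_digits _ _ _ _ psi C g x0 C1 psiG N1 F Flang d (D u) u.1 (j u.1)) => //.
    by case/andP: (hj u.1).
  by rewrite -(ball_word e1 hu) -(ball_word e1 hD2).
apply: le_esum => u Uu; rewrite lee_fin; apply: hn0 => //.
exact: leq_trans (Um u Uu).
Qed.

End LowerBound.

(** * Upper bound for the entropy and pressure *)

Section Windows.
Context {N : nat} {Q : 'M[bool]_N} {R : realType}.
Local Notation Sigma := (subshift Q).
Local Notation lang := (@language N Q).
Variable omega : R.
Hypothesis homega : 0 < omega < 1.
Implicit Types (x y : Sigma).

(** A word with [m] further symbols on either side, which determines a point up to [omega ^+ m] in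
    the metric [dist_n]. The number of extensions does not depend on [n]. *)
Definition window m n x : {ffun 'I_n -> 'I_N} * {ffun 'I_(m + m) -> 'I_N} :=
  (word n x, [ffun j : 'I_(m + m) =>
    if (j < m)%N then symbol x ((j : nat)%:Z - m%:Z) else symbol x ((j : nat)%:Z - m%:Z + n%:Z)]).

Lemma windowE m n x y (i : int) : window m n x = window m n y ->
  - m%:Z <= i < (n + m)%N%:Z -> symbol x i = symbol y i.
Proof.
move=> [/word_eqP hw /ffunP ho] /andP[i1 i2].
have [in_|in_] := ltP i 0.
  have jm : (`|(i + m%:Z)%R| < m + m)%N by lia.
  have := ho (Ordinal jm); rewrite !ffunE /= (_ : (_ < m)%N); last lia.
  by have -> : `|(i + m%:Z)%R|%N%:Z - m%:Z = i by lia.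
have [i3|i3] := ltP i n%:Z.
  by have := hw `|i|%N; rewrite gez0_abs //; apply; lia.
have jm : (`|(i - n%:Z + m%:Z)%R| < m + m)%N by lia.
have := ho (Ordinal jm); rewrite !ffunE /= ltnNge (_ : (m <= _)%N); last lia.
by have -> : `|(i - n%:Z + m%:Z)%R|%N%:Z - m%:Z + n%:Z = i by lia.
Qed.

Lemma window_dist m n x y : window m n x = window m n y -> dist_n omega n x y <= omega ^+ m.
Proof.
have /andP[w0 w1] := homega; move=> e; apply: bigmax_le => [|j _].
  by rewrite exprn_ge0 // ltW.
apply: (dist_agree homega) => i hi; rewrite !symbol_shift; apply: (windowE e).
have := ltn_ord j; lia.
Qed.

Lemma esum_finType_le (U : finType) (S : set U) (G : U -> R) : (forall u, 0 <= G u) ->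
  (\esum_(u in S) (G u)%:E <= (\sum_u G u)%:E)%E.
Proof.
move=> G0; rewrite esum_fset; [|exact: finite_finset|by move=> u _; rewrite lee_fin].
rewrite fsbig_mkcond (fsbigE _ _ (index_enum_uniq U)) //; last first.
  by move=> u _; rewrite mem_index_enum.
rewrite -sumEFin (eq_bigl xpredT) => [|u]; last by rewrite in_setT.
by apply: lee_sum => u _; rewrite /patch; case: ifP => _; rewrite ?lexx ?lee_fin.
Qed.

Lemma windowed_sum m n (S : set Sigma) (f : Sigma -> R) (F : {ffun 'I_n -> 'I_N} -> R) :
  (forall w, 0 <= F w) -> (forall x, S x -> f x <= F (word n x)) ->
  {in S &, injective (window m n)} ->
  (\esum_(x in S) (f x)%:E <= (N%:R ^+ (m + m) * \sum_(w in lang n) F w)%:E)%E.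
Proof.
move=> F0 fF inj; pose G (u : {ffun 'I_n -> 'I_N} * {ffun 'I_(m + m) -> 'I_N}) :=
  if u.1 \in lang n then F u.1 else 0.
have G0 u : 0 <= G u by rewrite /G; case: ifP.
apply: (@le_trans _ _ (\esum_(x in S) (G (window m n x))%:E)%E).
  by apply: le_esum => x Sx; rewrite lee_fin /G word_language fF.
rewrite -(@esum_image _ _ _ S (window m n) (fun u => (G u)%:E) inj).
apply: le_trans (esum_finType_le _ G0) _; rewrite lee_fin le_eqVlt; apply/orP; left; apply/eqP.
rewrite -(pair_bigA _ (fun w o => G (w, o))) /= mulr_sumr [RHS]big_mkcond /=.
apply: eq_bigr => w _; rewrite /G /= sumr_const card_ffun !card_ord -[LHS]mulr_natl natrX.
by case: ifP; rewrite ?mulr0.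
Qed.

End Windows.

Lemma geometric_tail (R : realType) (a : R) M : 0 < a < 1 ->
  (\esum_(n in [set n | (M <= n)%N]) (a ^+ n)%:E <= (a ^+ M / (1 - a))%:E)%E.
Proof.
move=> /andP[a0 a1]; have pos n : 0 <= a ^+ n by rewrite exprn_ge0 // ltW.
have a10 : 0 < 1 - a by rewrite subr_gt0.
rewrite -(@nneseries_esum R (fun n => (a ^+ n)%:E) (fun n => (M <= n)%N)); last first.
  by move=> n _; rewrite lee_fin.
apply: lime_le; first by apply: is_cvg_nneseries_cond => n _ _; rewrite lee_fin.
near=> L; rewrite sumEFin lee_fin big_mkord.
(* The partial sum plus the tail after [maxn L M] is constant in [L], which lets the induction also
   cover [L < M]. *)
suff h : \sum_(i < L | (M <= i)%N) a ^+ i + a ^+ maxn L M / (1 - a) = a ^+ M / (1 - a).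
  by rewrite -h lerDl; apply: divr_ge0; [exact: pos | exact: ltW].
elim: {+}L => [|l IH]; first by rewrite big_ord0 add0r max0n.
rewrite -IH -(big_mkord (fun i => (M <= i)%N) (fun i => a ^+ i)) big_mkcond big_nat_recr //=.
rewrite -big_mkcond big_mkord -addrA; congr (_ + _); case: leqP => lM.
  rewrite (maxn_idPl (leqW lM)) exprS.
  by field; rewrite gt_eqF.
by rewrite (maxn_idPr lM) add0r.
Unshelve. all: by end_near.
Qed.

Lemma upper_exponent_algebra (R : realType) (n s a p0 D e eta c x y z t : R) :
  0 <= n -> D * e <= t -> eta <= t -> s = p0 - a + 4 * t ->
  a * n - D * (n * e) <= x -> x <= y + c -> z <= n * (p0 + eta) ->
  - s * n + (- y + z) <= c - 2 * t * n.
Proof.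
move=> n0 h1 h2 -> h3 h4 h5; have h6 : n * (D * e) <= n * t by rewrite ler_wpM2l.
have h7 : n * eta <= n * t by rewrite ler_wpM2l.
have e1 : D * (n * e) = n * (D * e) by rewrite mulrCA.
rewrite e1 in h3; lra.
Qed.

Section UpperBound.
Context {N : nat} {Q : 'M[bool]_N} {R : realType} {k : nat}.
Local Notation Sigma := (subshift Q).
Local Notation lang := (@language N Q).
Variables (psi : 'I_k -> nat -> Sigma -> R) (C : R) (x0 : Sigma) (omega : R).
Implicit Types (x y : Sigma) (q : 'rV[R]_k).
Hypothesis homega : 0 < omega < 1.
Hypothesis psiD : forall i n x y, (forall j : nat, (j < n)%N -> symbol x j = symbol y j) ->
  `|psi i n x - psi i n y| <= C.

Local Notation Z := (Zsum psi x0).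

Lemma qpsi_rep q n x : `|qpsi psi q n x - qpsi psi q n (rep x0 (word n x))| <= qnorm q * C.
Proof. by apply: qpsi_dist => i; apply: psiD => j jn; rewrite rep_word. Qed.

Lemma window_scale (e : R) : 0 < e -> exists m, omega ^+ m < e.
Proof.
move=> e0; have /andP[w0 w1] := homega; have e2 : 0 < e / 2 by exact: divr_gt0.
have [|m hm] := @geometric_small R 1 omega (e / 2) _ e2; first by rewrite ltW.
by exists m; have := hm m (leqnn m); rewrite mul1r => h; apply: le_lt_trans h _; lra.
Qed.

Variables (alpha : 'rV[R]_k) (p : 'rV[R]_k -> R).
Hypothesis pub : forall q h, 0 < h ->
  exists n0, forall n, (n0 <= n)%N -> ln (Z q n) <= n%:R * (p q + h).

Let good eps n x := forall i, `|psi i n x - n%:R * alpha 0 i| <= n%:R * eps.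

(* One point for each window that contains a good point. *)
Let net eps m n : set Sigma := [set x | good eps n x /\
  x = xget x0 [set y | good eps n y /\ window m n y = window m n x]].

Lemma net_inj eps m n : {in net eps m n &, injective (window m n)}.
Proof. by move=> x y; rewrite !inE => -[_ xE] [_ yE] e; rewrite xE yE e. Qed.

(** An exponential Markov bound: on good points the Gibbs exponent for [q] is at least the value
    prescribed by [alpha] up to the stated errors, so counting them is dominated by the partition
    sum. *)
Lemma net_sum eps m n q s : 
  (\esum_(x in net eps m n) (expR (- s * n%:R))%:E <=
   (N%:R ^+ (m + m) * expR (- s * n%:R + (- (\sum_i q 0 i * alpha 0 i * n%:R - qnorm q * (n%:R * eps) - qnorm q * C)
     + ln (Z q n))))%:E)%E.
Proof.
set E := _ - _ - qnorm q * C.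
pose F (w : {ffun 'I_n -> 'I_N}) := expR (- s * n%:R - E) * expR (qpsi psi q n (rep x0 w)).
have h0 := @windowed_sum N Q R m n (net eps m n) (fun=> expR (- s * n%:R)) F.
apply: (le_trans (h0 _ _ _)).
- by move=> w; rewrite mulr_ge0 ?expR_ge0.
- move=> x [gx _]; rewrite /F -expRD ler_expR -addrA lerDl addrC subr_ge0.
  have := qpsi_dist q gx; rewrite ler_norml => /andP[h1 _].
  have := qpsi_rep q n x; rewrite ler_norml => /andP[_ h2].
  have e1 : \sum_i q 0 i * (n%:R * alpha 0 i) = \sum_i q 0 i * alpha 0 i * n%:R.
    by apply: eq_bigr => i _; rewrite [n%:R * _]mulrC mulrA.
  rewrite e1 in h1; rewrite /E; move: h1 h2; rewrite -/(qpsi psi q n x).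
  by move: (\sum_i _) => t h1 h2; lra.
- exact: net_inj.
rewrite lee_fin /F -mulr_sumr -/(Z q n) -[X in _ * (_ * X)]lnK ?posrE ?Zsum_gt0 //.
by rewrite -expRD addrA.
Qed.

(** A point of the level set is good for all large [n], hence lies in a ball around a net point of
    some length at least [M']. The weights of these balls form a convergent geometric series. *)
Lemma Bowen_lim_upper_bound q s e : 0 < e -> p q - \sum_i q 0 i * alpha 0 i < s ->
  Bowen_lim omega (level_set psi alpha) s e = 0%E.
Proof.
move=> e0 hs; have /andP[w0 w1] := homega.
have [m hm] := window_scale e0.
(* A quarter of the gap: one for the tolerance of the exponents, one for the pressure, one for the
   constant [K], and one for the ratio of the geometric series. *)
pose t := (s - (p q - \sum_i q 0 i * alpha 0 i)) / 4.
have t0 : 0 < t by rewrite divr_gt0 // subr_gt0.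
have q0 := qnorm_ge0 q; have q1 : 0 < qnorm q + 1 by rewrite ltr_wpDl.
pose eps := t / (qnorm q + 1); have eps0 : 0 < eps by exact: divr_gt0.
have qe : qnorm q * eps <= t.
  by rewrite /eps mulrCA ler_piMr ?(ltW t0) // ler_pdivrMr // mul1r lerDl.
have [n0 hn0] := pub q t0.
pose a := expR (- t); have a0 : 0 < a < 1 by rewrite expR_gt0 expR_lt1 oppr_lt0.
pose K := N%:R ^+ (m + m) * expR (qnorm q * C).
have K0 : 0 <= K by rewrite mulr_ge0 ?exprn_ge0 ?expR_ge0.
have [n2 hn2] := @geometric_small R K a 1 (ltac:(by case/andP: a0 => /ltW -> ->)) ltr01.
have sumle n : (n0 <= n)%N -> (n2 <= n)%N ->
    (\esum_(x in net eps m n) (expR (- s * n%:R))%:E <= (a ^+ n)%:E)%E.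
  move=> h0 h2; apply: le_trans (net_sum eps m n q s) _; rewrite lee_fin.
  have := @upper_exponent_algebra R n%:R s (\sum_i q 0 i * alpha 0 i) (p q) (qnorm q) eps t
    (qnorm q * C) _ _ (ln (Z q n)) t.
  have -> : \sum_i q 0 i * alpha 0 i * n%:R = (\sum_i q 0 i * alpha 0 i) * n%:R by rewrite mulr_suml.
  set x := _ - qnorm q * (n%:R * eps) => /(_ x (x - qnorm q * C)) h.
  apply: (@le_trans _ _ (N%:R ^+ (m + m) * expR (qnorm q * C - 2 * t * n%:R))).
    rewrite ler_wpM2l ?exprn_ge0 // ler_expR; apply: h => //; last exact: hn0.
    - by rewrite /t; field.
    - by rewrite subrK.
  have := ler_wpM2r (expR_ge0 (- (t * n%:R))) (hn2 n h2).
  rewrite mul1r /K /a -expRM_natr !mulNr => h3.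
  have -> : qnorm q * C - 2 * t * n%:R = qnorm q * C + - (t * n%:R) + - (t * n%:R) by ring.
  by rewrite !expRD !mulrA.
have hsum M d : 0 < d -> (Bowen_sum omega (level_set psi alpha) s M e <= d%:E)%E.
  move=> d0; have a1 : 0 < 1 - a by rewrite subr_gt0; case/andP: a0.
  have [n3 hn3] := @geometric_small R 1 a (d * (1 - a)) (ltac:(by case/andP: a0 => /ltW -> ->)) (mulr_gt0 d0 a1).
  pose M' := maxn M (maxn n0 (maxn n2 n3)).
  have [M1 M2 M3 M4] : [/\ (M <= M')%N, (n0 <= M')%N, (n2 <= M')%N & (n3 <= M')%N].
    by rewrite /M' !leq_max !leqnn !orbT.
  pose U : set (nat * Sigma) := [set n | (M' <= n)%N] `*`` net eps m.
  apply: ge_ereal_inf; exists (\esum_(c in U) (expR (- s * c.1%:R))%:E)%E.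
    exists U => //; split.
    - apply/countable_injP; exists (fun c => pickle (c.1, pickle (window m c.1 c.2))).
      move=> [n x] [n' x']; rewrite !inE => -[/= _ nx] [/= _ nx'].
      move=> /(pcan_inj pickleK)[] en; subst n' => /(pcan_inj pickleK) h.
      by congr (_, _); apply: (@net_inj eps m n); rewrite ?inE.
    - by move=> [n x] [/= h _]; exact: leq_trans h.
    move=> x lx.
    have [n4 hn4] : exists n4, forall i, forall n, (n4 <= n)%N ->
        `|psi i n x - n%:R * alpha 0 i| <= n%:R * eps.
      apply: (@finite_common_bound _ (fun i n4 => forall n, (n4 <= n)%N ->
        `|psi i n x - n%:R * alpha 0 i| <= n%:R * eps)).
        by move=> i n n' nn' h l nl; apply: h; exact: leq_trans nl.
      move=> i; have /cvgrPdist_le/(_ eps eps0)[n4 _ h] := lx i.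
      exists n4.+1 => n hn; have nR : 0 < n%:R :> R by rewrite ltr0n (leq_trans _ hn).
      have := h n (ltnW hn); rewrite distrC -(ler_pM2l nR) -{1}(gtr0_norm nR) -normrM mulrBr mulrA divff ?gt_eqF //.
      by rewrite mul1r.
    pose n := maxn M' n4.
    have gx : good eps n x by move=> i; apply: hn4; exact: leq_maxr.
    pose y := xget x0 [set y | good eps n y /\ window m n y = window m n x].
    have [gy yx] : good eps n y /\ window m n y = window m n x.
      exact: (@xgetPex _ x0 [set y | good eps n y /\ window m n y = window m n x]) (ex_intro _ x (conj gx erefl)).
    exists (n, y); first by split; [exact: leq_maxl | split => //=; rewrite yx].
    exact: le_lt_trans (window_dist homega yx) hm.
  rewrite -(@esum_esum _ _ _ _ _ (fun n x => (expR (- s * n%:R))%:E)) => [|n x _ _]; last first.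
    by rewrite lee_fin expR_ge0.
  apply: (@le_trans _ _ (\esum_(n in [set n | (M' <= n)%N]) (a ^+ n)%:E)%E).
    apply: le_esum => n /= hn; apply: sumle; exact: leq_trans hn.
  apply: le_trans (geometric_tail M' a0) _; rewrite lee_fin ler_pdivrMr //.
  by have := hn3 _ M4; rewrite mul1r.
have s0 M : Bowen_sum omega (level_set psi alpha) s M e = 0%E.
  apply/eqP; rewrite eq_le; apply/andP; split.
    by apply/lee_addgt0Pr => d d0; rewrite add0e; exact: hsum.
  by apply: le_ereal_inf_tmp => _ [V _ <-]; apply: esum_ge0 => c _; rewrite lee_fin expR_ge0.
rewrite /Bowen_lim (_ : (fun M => _) = fun=> 0%E) ?lim_cst //.
by apply/funext => M; exact: s0.
Qed.

End UpperBound.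

Lemma ereal_dense (R : realType) (x y : \bar R) : (x < y)%E ->
  exists a : R, (x < a%:E)%E /\ (a%:E < y)%E.
Proof.
case: x y => [x||] [y||] //= h.
- by rewrite lte_fin in h; exists ((x + y) / 2); rewrite !lte_fin !midf_lt.
- by exists (x + 1); rewrite ltry lte_fin ltrDl.
- by exists (y - 1); rewrite ltNyr lte_fin gtrBl.
- by exists 0; rewrite ltNyr ltry.
Qed.

Lemma limn_esup_lt (R : realType) (u : nat -> \bar R) (a : \bar R) :
  (limn_esup u < a)%E -> exists n0, forall n, (n0 <= n)%N -> (u n <= a)%E.
Proof.
move=> /ereal_inf_lt[_ [V [n0 _ hV] <-] h]; exists n0 => n hn.
apply: le_trans (ltW h); apply: ereal_sup_ubound; exists n => //; exact: hV.
Qed.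

Lemma limn_esup_gt (R : realType) (u : nat -> \bar R) (a : \bar R) n0 :
  (a < limn_esup u)%E -> exists2 n, (n0 <= n)%N & (a < u n)%E.
Proof.
move=> h; apply: contrapT => hn; move: h; rewrite ltNge => /negP; apply.
apply: (@le_trans _ _ (ereal_sup [set u n | n in [set n | (n0 <= n)%N]])).
  by apply: ereal_inf_lbound; exists [set n | (n0 <= n)%N] => //; exists n0.
apply: ge_ereal_sup => _ [n /= nn <-]; rewrite leNgt; apply/negP => hu.
by apply: hn; exists n.
Qed.

(** * Pressure as the growth rate of partition sums *)

Section Pressure.
Context {N : nat} {Q : 'M[bool]_N} {R : realType} {k : nat}.
Local Notation Sigma := (subshift Q).
Local Notation lang := (@language N Q).
Variables (A : Sigma -> 'M[R]_k).
Variables (psi : 'I_k -> nat -> Sigma -> R) (C : R) (x0 : Sigma) (omega : R).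
Implicit Types (x y : Sigma) (q : 'rV[R]_k).
Hypothesis homega : 0 < omega < 1.
Hypothesis psiD : forall i n x y, (forall j : nat, (j < n)%N -> symbol x j = symbol y j) ->
  `|psi i n x - psi i n y| <= C.
Hypothesis weightE : forall q n x, weight A q n x = expR (qpsi psi q n x).

Local Notation Z := (Zsum psi x0).

Let S q e n : \bar R :=
  ereal_sup [set (\esum_(x in E) (weight A q n x)%:E)%E | E in dn_separated omega n e].

(** Representatives of distinct words differ at some time below [n], where their distance is 1, so
    they form a separated set. *)
Lemma separated_sum_ge q n e : e < 1 -> ((Z q n)%:E <= S q e n)%E.
Proof.
move=> e1; have injrep : {in [set` lang n] &, injective (@rep N Q x0 n)}.
  by move=> w w'; rewrite !inE /= => hw hw' h; rewrite -(repK x0 hw) h repK.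
apply: (@le_trans _ _ (\esum_(x in [set rep x0 w | w in [set` lang n]]) (weight A q n x)%:E)%E).
  rewrite (@esum_image _ _ _ [set` lang n] (@rep N Q x0 n) (fun x => (weight A q n x)%:E) injrep).
  rewrite esum_fset; [|exact: finite_finset|by move=> w _; rewrite lee_fin weightE expR_ge0].
  rewrite -(bigfs _ (index_enum_uniq _)) => [|w _]; last by rewrite mem_index_enum.
  by rewrite sumEFin lee_fin le_eqVlt; apply/orP; left; apply/eqP/eq_bigr => w _; rewrite weightE.
apply: ereal_sup_ubound; exists [set rep x0 w | w in [set` lang n]] => //.
move=> _ _ [w /= hw <-] [w' /= hw' <-] ww'; apply: lt_le_trans e1 _.
rewrite leNgt; apply/negP => h; apply: ww'.
have := @ball_word N Q R omega n (rep x0 w) (rep x0 w') 1 (lexx _) h.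
by rewrite !repK // => ->.
Qed.

(** Once [omega ^+ m < e], separated points have distinct windows, and each word has at most
    [N ^ (m + m)] of them. *)
Lemma separated_sum_le q e : 0 < e -> exists2 K, 0 < K & forall n, (S q e n <= (K * Z q n)%:E)%E.
Proof.
move=> e0; have [m hm] := window_scale homega e0.
have N0 : (0 < N)%N by exact: leq_ltn_trans (ltn_ord (symbol x0 0)).
exists (N%:R ^+ (m + m) * expR (qnorm q * C)); first by rewrite mulr_gt0 ?exprn_gt0 ?ltr0n ?expR_gt0.
move=> n; apply: ge_ereal_sup => _ [E hE <-].
pose F (w : {ffun 'I_n -> 'I_N}) := expR (qnorm q * C) * expR (qpsi psi q n (rep x0 w)).
apply: (le_trans (@windowed_sum N Q R m n E (fun x => weight A q n x) F _ _ _)).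
- by move=> w; rewrite mulr_ge0 ?expR_ge0.
- move=> x _; rewrite weightE /F -expRD ler_expR.
  have := qpsi_rep x0 psiD q n x; rewrite ler_norml => /andP[_]; by rewrite lerBlDr.
- move=> x y; rewrite !inE => Ex Ey h; apply: contrapT => xy.
  have := lt_le_trans (hE x y Ex Ey xy) (window_dist homega h).
  by move=> /lt_trans/(_ hm); rewrite ltxx.
by rewrite lee_fin /F -mulr_sumr mulrA.
Qed.

Lemma pressure_scale_lt q e a : e < 1 -> (pressure_scale A omega q e < a%:E)%E ->
  exists n0, forall n, (n0 <= n)%N -> ln (Z q n) <= n%:R * a.
Proof.
move=> e1 /limn_esup_lt[n0 hn0]; exists n0.+1 => n hn; have := hn0 n (ltnW hn).
have n0' : 0 < n%:R :> R by rewrite ltr0n (leq_trans _ hn).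
have Z0 := Zsum_gt0 psi x0 q n; rewrite -/(S q e n) => h.
have : ((n%:R^-1)%:E * lne (Z q n)%:E <= a%:E)%E.
  apply: le_trans h; rewrite lee_pmul2l ?lte_fin ?invr_gt0 //.
  have h := separated_sum_ge q n e1.
  rewrite lee_lne // in_itv /= ?leey ?andbT ?lee_fin ?(ltW Z0) //.
  by apply: le_trans h; rewrite lee_fin ltW.
by rewrite lne_EFin // -EFinM lee_fin ler_pdivrMl.
Qed.

Lemma pressure_scale_gt q e a a' : 0 < e < 1 -> a' < a -> (a%:E < pressure_scale A omega q e)%E ->
  forall n0, exists2 n, (n0 <= n)%N & n%:R * a' <= ln (Z q n).
Proof.
move=> /andP[e0 e1] aa h n0; have [K K0 hK] := separated_sum_le q e0.
have [n1 hn1] := archi_lt (ln K / (a - a')).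
have [n] := limn_esup_gt (n0 + n1.+1) h; rewrite -/(S q e n) => hn hu.
exists n; first by apply: leq_trans hn; exact: leq_addr.
have n_gt0 : 0 < n%:R :> R by rewrite ltr0n (leq_trans _ hn) // addnS.
have Z0 := Zsum_gt0 psi x0 q n.
have : (a%:E < (n%:R^-1)%:E * lne (K * Z q n)%:E)%E.
  apply: lt_le_trans hu _; rewrite lee_pmul2l ?lte_fin ?invr_gt0 //.
  have h1 := separated_sum_ge q n e1.
  rewrite lee_lne ?hK // in_itv /= ?leey ?andbT ?lee_fin ?mulr_ge0 ?(ltW Z0) ?(ltW K0) //.
  by apply: le_trans h1; rewrite lee_fin ltW.
rewrite lne_EFin ?mulr_gt0 // -EFinM lte_fin ltr_pdivlMl // lnM ?posrE // => h2.
have h3 : ln K <= n%:R * (a - a').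
  rewrite -ler_pdivrMr ?subr_gt0 //; apply: le_trans (ltW hn1) _; rewrite ler_nat.
  by apply: leq_trans hn; rewrite addnS; apply: leqW; exact: leq_addl.
rewrite mulrBr in h3; lra.
Qed.

(** At every scale below 1 the separated sums agree with [Z] up to a factor independent of [n], so
    the growth rate does not depend on the scale. *)
Lemma pressure_scale_le q e e' : 0 < e < 1 -> 0 < e' < 1 ->
  (pressure_scale A omega q e <= pressure_scale A omega q e')%E.
Proof.
move=> he he'; rewrite leNgt; apply/negP => h.
have [a [h1 h2]] := ereal_dense h; have [b [h3 h4]] := ereal_dense h2.
rewrite lte_fin in h3.
have [n0 hn0] := pressure_scale_lt (proj2 (andP he')) h1.
have [n hn hZ] := pressure_scale_gt he (midf_lt h3).2 h4 n0.+1.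
have nR : 0 < n%:R :> R by rewrite ltr0n (leq_trans _ hn).
have := le_trans hZ (hn0 n (ltnW hn)); rewrite ler_pM2l // leNgt.
by rewrite (midf_lt h3).1.
Qed.

Lemma pressureE q e : 0 < e < 1 -> pressure A omega q = pressure_scale A omega q e.
Proof.
move=> he; apply: lim_near_cst => //.
near=> e'; have he' : 0 < e' < 1 by apply/andP; split; near: e'; [exact: nbhs_right_gt | exact: nbhs_right_lt].
by apply/eqP; rewrite eq_le !pressure_scale_le.
Unshelve. all: by end_near.
Qed.

Hypothesis hP : forall q, pressure A omega q \is a fin_num.
Let p q := fine (pressure A omega q).

Lemma pressure_Zsum q h n0 : 0 < h -> exists2 n, (n0 <= n)%N & n%:R * (p q - h) <= ln (Z q n).
Proof.
move=> h0; have he : 0 < (2^-1 : R) < 1 by rewrite invr_gt0 invf_lt1 // ltr1n ltr0n.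
apply: (pressure_scale_gt (a := p q - h / 2) he); first by lra.
rewrite -(pressureE q he) -(fineK (hP q)) lte_fin -/(p q); lra.
Qed.

Lemma Zsum_pressure q h : 0 < h ->
  exists n0, forall n, (n0 <= n)%N -> ln (Z q n) <= n%:R * (p q + h).
Proof.
move=> h0; have he : 0 < (2^-1 : R) < 1 by rewrite invr_gt0 invf_lt1 // ltr1n ltr0n.
apply: (@pressure_scale_lt _ 2^-1); first by case/andP: he.
by rewrite -(pressureE q he) -(fineK (hP q)) lte_fin -/(p q) ltrDl.
Qed.

End Pressure.

(** A cover of a nonempty set contains at least one ball, whose weight is at least 1 when
    [s <= 0]. *)
Lemma Bowen_lim_nonpos (R : realType) (N : nat) (Q : 'M[bool]_N) (omega : R)
    (Y : set (subshift Q)) s e : Y !=set0 -> s <= 0 -> Bowen_lim omega Y s e <> 0%E.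
Proof.
move=> [x Yx] s0; apply: (@Bowen_lim_ge1 _ _ _ _ _ _ _ 0%N) => M _.
apply: le_ereal_inf_tmp => _ [U [_ _ UY] <-]; have [c Uc _] := UY x Yx.
apply: esum_ge; exists [set c]; first by split=> // d ->.
by rewrite fsbig_set1 lee_fin -expR0 ler_expR mulr_ge0 ?oppr_ge0.
Qed.

Lemma weight_log_norm (R : realType) (N : nat) (Q : 'M[bool]_N) (k : nat)
    (A : subshift Q -> 'M[R]_k) omega r : typical_map A omega r ->
  forall q n x, weight A q n x = expR (qpsi (log_norm A) q n x).
Proof.
move=> hA q n x; rewrite /weight /qpsi expR_sum; apply: eq_bigr => i _.
have h : 0 < opnorm (extpow i.+1 (cocycle A n%:Z x)).
  exact: (extpow_cocycle_gt0 hA (Ordinal (ltn_ord i : (i.+1 < k.+1)%N)) n x).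
by rewrite /powR gt_eqF.
Qed.

Theorem theorem4p1 (R : realType) (N : nat) (Q : 'M[bool]_N) (omega r : R)
  (k : nat) (A : subshift Q -> 'M[R]_k)
  (homega : 0 < omega < 1) (hr : 0 < r) (hk : (0 < k)%N)
  (hmix : topologically_mixing (Q := Q) omega)
  (hA : typical_map A omega r)
  (hP : forall q : 'rV[R]_k, pressure A omega q \is a fin_num)
  (alpha : 'rV[R]_k) (halpha : lyapunov_spectrum A alpha) :
  htop omega (lyapunov_level A alpha) =
  ereal_inf [set (pressure A omega q - (\sum_(i < k) alpha 0 i * q 0 i)%:E)%E
            | q in [set: 'rV[R]_k]].
Proof.
have [C C1 [g [psi0 psiD psiE psiG]]] := log_norm_properties homega hr hmix hA.
have [x0 _] := halpha.
have wE := weight_log_norm hA.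
pose p q := fine (pressure A omega q); pose dot (q : 'rV[R]_k) := \sum_(i < k) alpha 0 i * q 0 i.
have upper := Bowen_lim_upper_bound homega psiD (alpha := alpha)
  (Zsum_pressure x0 homega psiD wE hP).
have {}upper q s e : 0 < e -> p q - dot q < s -> Bowen_lim omega (lyapunov_level A alpha) s e = 0%E.
  move=> e0 hs; apply: (upper q) => //; rewrite -/(p q).
  by rewrite (eq_bigr (fun i => alpha 0 i * q 0 i)) // => i _; rewrite mulrC.
pose S := [set p q - dot q | q in [set: 'rV[R]_k]].
(* A negative value would let the upper bound apply with [s = 0], against the nonemptiness of the
   level set. Hence the infimum is a real number. *)
have Sge0 t : S t -> 0 <= t.
  move=> [q _ <-]; rewrite leNgt; apply/negP => h.
  exact: (Bowen_lim_nonpos halpha (lexx 0)) (upper q 0 1 ltr01 h).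
have S0 : S !=set0 by exists (p 0 - dot 0), 0.
have Slb : has_lbound S by exists 0 => t; exact: Sge0.
have -> : [set (pressure A omega q - (dot q)%:E)%E | q in [set: 'rV[R]_k]] = [set t%:E | t in S].
  apply/seteqP; split=> [_ [q _ <-]|_ [_ [q _ <-] <-]]; last by exists q => //; rewrite EFinB fineK.
  by exists (p q - dot q); [exists q | rewrite EFinB fineK].
rewrite ereal_inf_EFin //; set s := inf S.
have hs (q : 'rV[R]_k) : \sum_i alpha 0 i * q 0 i + s <= p q.
  by rewrite -lerBrDl; apply: ge_inf => //; exists q.
have many := good_words_many C1 psi0 psiD psiE psiG
  (pressure_Zsum x0 homega psiD wE hP) hs.
(* The entropy at scale [e] already has its final value for every [e] below 1, so the limit is that
   of a constant. *)
have scale e : 0 < e < 1 -> htop_scale omega (lyapunov_level A alpha) e = s%:E.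
  move=> /andP[e0 e1]; apply/eqP; rewrite eq_le; apply/andP; split.
    apply/lee_addgt0Pr => d d0.
    have [_ [q _ <-] hq] := inf_adherent d0 (conj S0 Slb).
    by apply: ereal_inf_lbound; exists (s + d) => //; exact: upper hq.
  apply: le_ereal_inf_tmp => _ [t /= ht <-]; rewrite lee_fin leNgt; apply/negP => ts.
  exact: (Bowen_lim_lower_bound C1 psi0 psiD psiE psiG many ts (ltW e1)) ht.
apply: lim_near_cst => //; near=> e; apply: scale.
by apply/andP; split; near: e; [exact: nbhs_right_gt | exact: nbhs_right_lt].
Unshelve. all: by end_near.
Qed.
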